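(* Let $k,n\ge 1$ be integers. Then $$\sum_{N\ge 0}\left[(\mathbb C^2)^{[N](k,n)}\right]t^N=(\mathbb L t)^{\frac{kn(n-1)}{2}}\,C_n^{(k)}(\mathbb L,\mathbb L^{-1}t^{-1}),$$ where the classes are taken in $K_0(\nu_{\mathbb C})$.
   Context: $(\mathbb C^2)^{[N]}$ is the Hilbert scheme of $N$ points on the plane, parametrizing ideals $I\subset\mathbb C[x,y]$ with $\dim_{\mathbb C}\mathbb C[x,y]/I=N$. $V_{k,n}\subset\mathbb C[x,y]$ is the vector subspace spanned by the monomials $x^iy^j$ with $i+kj\le kn-k-1$. $(\mathbb C^2)^{[N](k,n)}$ is the (open) subset of $(\mathbb C^2)^{[N]}$ parametrizing ideals $I$ with $I+V_{k,n}=\mathbb C[x,y]$. $K_0(\nu_{\mathbb C})$ is the Grothendieck ring of complex quasi-projective varieties: the abelian group generated by classes $[X]$ of complex quasi-projective varieties modulo $[X]=[Y]$ for isomorphic $X,Y$ and $[X]=[Y]+[X\setminus Y]$ for $Y\subset X$ Zariski closed, with product $[X_1]\cdot[X_2]=[X_1\times X_2]$. $\mathbb L=[\mathbb A^1_{\mathbb C}]$. A $k$-Dyck path is a lattice path from $(0,0)$ to $(kn,n)$ consisting of $(0,1)$ and $(1,0)$ steps and never going below the line $x=ky$; $L^+_{kn,n}$ is the set of these paths. For $\pi\in L^+_{kn,n}$ let $D'_\pi$ be the set of unit squares lying above $\pi$ and contained in the rectangle with vertices $(0,0),(kn,0),(kn,n),(0,n)$; reflected with respect to a horizontal line, $D'_\pi$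 becomes a Young diagram $D_\pi$ (with its corner at the bottom left, so that the bottom row of $D_\pi$ is the top row of $D'_\pi$). For a box $s$ of a Young diagram $D$, $a(s)$ is the number of boxes of $D$ in the same column and strictly above $s$, and $l(s)$ is the number of boxes of $D$ in the same row and strictly to the right of $s$. Let $area(\pi)$ be the number of full unit squares below $\pi$ and above the line $ky=x$, and let $$b_k(\pi)=|\{s\in D_\pi\mid ka(s)\le l(s)\le k(a(s)+1)\}|.$$ The combinatorial $k$-parameter $(q,t)$-Catalan number is $$C_n^{(k)}(q,t)=\sum_{\pi\in L^+_{kn,n}}q^{b_k(\pi)}t^{area(\pi)}.$$ The right-hand side of the theorem is understood by formally cancelling powers of $\mathbb L t$, i.e. as $\sum_{\pi}\mathbb L^{b_k(\pi)}(\mathbb L t)^{kn(n-1)/2-area(\pi)}$. *)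

(* Defs.v *)
From HB Require Import structures.
From mathcomp Require Import all_boot all_order all_algebra.
From mathcomp Require Import mpoly freeg ring_quotient generic_quotient.
From mathcomp Require Import boolp classical_sets.

Set Implicit Arguments.
Unset Strict Implicit.
Unset Printing Implicit Defensive.
Import GRing.Theory.
Local Open Scope ring_scope.
Local Open Scope classical_set_scope.
Local Open Scope quotient_scope.

Section QuasiProjective.
Variable K : closedFieldType.

(* A subset of P(K^n) = P^(n-1) is represented by its cone: a set of nonzero
   vectors stable under scaling by nonzero scalars (stability is automatic for
   locally closed sets, see [lc_scale]). *)
Definition proj_eq n (v w : 'rV[K]_n) := exists2 c : K, c != 0 & w = c *: v.

Definition homogeneous n (p : {mpoly K[n]}) := exists d, p \is d.-homog.

Definition locally_closed n (A : set 'rV[K]_n) :=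
  exists F G : set {mpoly K[n]},
    (forall p, (F `|` G) p -> homogeneous p) /\
    (forall v, A v <-> [/\ v != 0, forall p, F p -> p.@[v 0] = 0
                         & exists2 q, G q & q.@[v 0] != 0]).

(* [A] is closed in the locally closed set [B]. *)
Definition closed_in n (A B : set 'rV[K]_n) :=
  exists F : set {mpoly K[n]},
    (forall p, F p -> homogeneous p) /\
    (forall v, A v <-> B v /\ forall p, F p -> p.@[v 0] = 0).

(* Quasi-projective varieties: reduced, not necessarily irreducible. *)
Record variety := Variety {
  vdim : nat;
  vset : set 'rV[K]_vdim;
  vset_lc : locally_closed vset }.

(* [f] is a map on representatives, meaningful up to [proj_eq]; near every point
   it is given by homogeneous polynomials of the same degree. *)
Definition regular n m (A : set 'rV[K]_n) (B : set 'rV[K]_m)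
    (f : 'rV[K]_n -> 'rV[K]_m) :=
  forall v, A v ->
    exists (d : nat) (h : 'I_m -> {mpoly K[n]}) (q : {mpoly K[n]}),
      [/\ forall i, h i \is d.-homog, homogeneous q, q.@[v 0] != 0 &
          forall w, A w -> q.@[w 0] != 0 ->
            B (\row_i (h i).@[w 0]) /\ proj_eq (\row_i (h i).@[w 0]) (f w)].

Definition isomorphic (X Y : variety) :=
  exists f g,
    [/\ regular (@vset X) (@vset Y) f, regular (@vset Y) (@vset X) g,
        forall v, vset v -> proj_eq v (g (f v)) &
        forall w, vset w -> proj_eq w (f (g w))].

Lemma proj_eq_refl n (v : 'rV[K]_n) : proj_eq v v.
Proof. by exists 1; rewrite ?oner_neq0 ?scale1r. Qed.

Lemma proj_eq_sym n (v w : 'rV[K]_n) : proj_eq v w -> proj_eq w v.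
Proof.
move=> [c c0 ->]; exists c^-1; first by rewrite invr_eq0.
by rewrite scalerA mulVf ?scale1r.
Qed.

Lemma proj_eq_trans n (u v w : 'rV[K]_n) :
  proj_eq u v -> proj_eq v w -> proj_eq u w.
Proof.
move=> [c c0 ->] [d d0 ->]; exists (d * c); first by rewrite mulf_neq0.
by rewrite scalerA.
Qed.

Lemma proj_eqZ n (v : 'rV[K]_n) c : c != 0 -> proj_eq v (c *: v).
Proof. by exists c. Qed.

Lemma mevalZ_homog n d (p : {mpoly K[n]}) (v : 'rV[K]_n) c :
  p \is d.-homog -> p.@[(c *: v) 0] = c ^+ d * p.@[v 0].
Proof.
move=> /dhomogP hp; rewrite !mevalE mulr_sumr !big_seq; apply: eq_bigr => m mp.
rewrite mulrCA; congr (_ * _).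
under eq_bigr do rewrite mxE exprMn.
rewrite big_split /= prodrXr; congr (_ ^+ _ * _).
by rewrite -mdegE; apply: hp.
Qed.

Lemma homog_eq0Z n (p : {mpoly K[n]}) (v : 'rV[K]_n) c :
  homogeneous p -> c != 0 -> (p.@[(c *: v) 0] == 0) = (p.@[v 0] == 0).
Proof.
move=> [d hp] c0; rewrite (mevalZ_homog _ _ hp) mulf_eq0 expf_eq0.
by rewrite (negbTE c0) andbF.
Qed.

Lemma lc_neq0 n (A : set 'rV[K]_n) v : locally_closed A -> A v -> v != 0.
Proof. by move=> [F [G [_ hA]]] /hA[]. Qed.

Lemma lc_scale n (A : set 'rV[K]_n) v c :
  locally_closed A -> c != 0 -> A v -> A (c *: v).
Proof.
move=> [F [G [hom hA]]] c0 /hA[v0 Fv [q Gq qv]]; apply/hA; split.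
- by rewrite scaler_eq0 negb_or c0.
- by move=> p Fp; apply/eqP; rewrite homog_eq0Z ?Fv //; apply: hom; left.
- by exists q; rewrite ?homog_eq0Z //; apply: hom; right.
Qed.

Lemma lc_proj_eq n (A : set 'rV[K]_n) v w :
  locally_closed A -> proj_eq v w -> A v -> A w.
Proof. by move=> lcA [c c0 ->]; apply: lc_scale. Qed.

Definition polyfun n (phi : 'rV[K]_n -> K) :=
  exists p : {mpoly K[n]}, forall v : 'rV[K]_n, p.@[v 0] = phi v.

Lemma polyfun_ext n (phi psi : 'rV[K]_n -> K) :
  phi =1 psi -> polyfun phi -> polyfun psi.
Proof. by move=> e [p hp]; exists p => v; rewrite hp e. Qed.

Lemma polyfunC n c : polyfun (fun _ : 'rV[K]_n => c).
Proof. by exists c%:MP => v; rewrite mevalC. Qed.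

Lemma polyfunX n i : polyfun (fun v : 'rV[K]_n => v 0 i).
Proof. by exists 'X_i => v; rewrite mevalXU. Qed.

Lemma polyfunD n (f g : 'rV[K]_n -> K) :
  polyfun f -> polyfun g -> polyfun (fun v => f v + g v).
Proof. by move=> [p hp] [q hq]; exists (p + q) => v; rewrite mevalD hp hq. Qed.

Lemma polyfunM n (f g : 'rV[K]_n -> K) :
  polyfun f -> polyfun g -> polyfun (fun v => f v * g v).
Proof. by move=> [p hp] [q hq]; exists (p * q) => v; rewrite mevalM hp hq. Qed.

Lemma polyfunB n (f g : 'rV[K]_n -> K) :
  polyfun f -> polyfun g -> polyfun (fun v => f v - g v).
Proof. by move=> [p hp] [q hq]; exists (p - q) => v; rewrite mevalB hp hq. Qed.

Lemma polyfun_sum n (I : finType) (f : I -> 'rV[K]_n -> K) :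
  (forall i, polyfun (f i)) -> polyfun (fun v => \sum_i f i v).
Proof.
move=> /choice[p hp]; exists (\sum_i p i) => v.
by rewrite raddf_sum /=; apply: eq_bigr => i _; rewrite hp.
Qed.

Lemma polyfun_prod n (I : finType) (f : I -> 'rV[K]_n -> K) :
  (forall i, polyfun (f i)) -> polyfun (fun v => \prod_i f i v).
Proof.
move=> /choice[p hp]; exists (\prod_i p i) => v.
by rewrite rmorph_prod /=; apply: eq_bigr => i _; rewrite hp.
Qed.

Lemma polyfun_det n N (M : 'rV[K]_n -> 'M[K]_N) :
  (forall i j, polyfun (fun v => M v i j)) -> polyfun (fun v => \det (M v)).
Proof.
move=> hM; apply: polyfun_sum => s; apply: polyfunM; first exact: polyfunC.
exact: polyfun_prod.
Qed.

Lemma polyfun_comp n m (p : {mpoly K[m]}) (f : 'I_m -> 'rV[K]_n -> K) :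
  (forall i, polyfun (f i)) -> polyfun (fun v => p.@[fun i => f i v]).
Proof.
move=> /choice[q hq]; exists (p \mPo [tuple q i | i < m]) => v.
rewrite comp_mpoly_meval; apply: meval_eq => i.
by rewrite tnth_mktuple hq.
Qed.

Lemma homogenize n (e : 'I_n) (phi : 'rV[K]_n -> K) : polyfun phi ->
  exists d0, forall d, (d0 <= d)%N -> exists2 p : {mpoly K[n]}, p \is d.-homog &
    forall v : 'rV[K]_n,
      p.@[v 0] = if v 0 e == 0 then 0 else v 0 e ^+ d * phi ((v 0 e)^-1 *: v).
Proof.
move=> [q hq]; exists (msize q).+1 => d hd.
have mlt m : m \in msupp q -> (mdeg m < d)%N.
  by move=> /msize_mdeg_lt /leq_trans; apply; apply: ltnW.
exists (\sum_(m <- msupp q) q@_m *: ('X_[m] * 'X_e ^+ (d - mdeg m))).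
  rewrite big_seq; apply: rpred_sum => m mq; apply: rpredZ.
  rewrite -{2}(subnKC (ltnW (mlt _ mq))); apply: dhomogM.
    by rewrite dhomogX /=.
  rewrite -[X in X.-homog]mul1n; apply: dhomogMn.
  by rewrite dhomogX /= mdeg1.
move=> v; rewrite raddf_sum /=; case: ifPn => [/eqP v0|v0].
  rewrite big_seq big1 // => m mq.
  rewrite mevalZ mevalM rmorphXn /= mevalXU v0 expr0n subn_eq0.
  by rewrite leqNgt (mlt _ mq) /= !mulr0.
rewrite -hq mevalE mulr_sumr !big_seq; apply: eq_bigr => m mq.
rewrite mevalZ mulrCA; congr (_ * _).
rewrite mevalM rmorphXn /= mevalXU mevalX.
under [in RHS]eq_bigr do rewrite mxE exprMn.
rewrite big_split /= prodrXr -mdegE exprVn mulrA mulrC; congr (_ * _).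
by rewrite -expfB ?mlt.
Qed.

(* Local closedness can be checked on the charts [v 0 e = 1]. *)
Lemma lc_chart n (A : set 'rV[K]_n) (J : set 'I_n) :
  (forall v, A v -> v != 0) ->
  (forall v c, c != 0 -> A v -> A (c *: v)) ->
  (forall v, A v -> exists2 e, J e & v 0 e != 0) ->
  (forall e, J e -> exists F G : set ('rV[K]_n -> K),
     (forall phi, (F `|` G) phi -> polyfun phi) /\
     (forall v : 'rV[K]_n, v 0 e = 1 ->
        A v <-> (forall phi, F phi -> phi v = 0) /\
                exists2 phi, G phi & phi v != 0)) ->
  locally_closed A.
Proof.
move=> A0 AZ AJ hJ.
have hom e (phi : 'rV[K]_n -> K) : polyfun phi -> exists p : {mpoly K[n]},
    homogeneous p /\ forall v : 'rV[K]_n,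
      (p.@[v 0] == 0) = (v 0 e == 0) || (phi ((v 0 e)^-1 *: v) == 0).
  move=> /(homogenize e)[d /(_ d (leqnn d))[p hp pE]]; exists p.
  split; first by exists d.
  move=> v; rewrite pE; have [_|v0] := eqVneq (v 0 e) 0; first by rewrite eqxx.
  by rewrite mulf_eq0 expf_eq0 (negbTE v0) andbF.
pose G := [set p : {mpoly K[n]} | homogeneous p /\ exists e, exists2 F, J e &
  exists2 G : set ('rV[K]_n -> K),
    (forall phi, (F `|` G) phi -> polyfun phi) /\
    (forall v : 'rV[K]_n, v 0 e = 1 -> A v <-> (forall phi, F phi -> phi v = 0) /\
        exists2 phi, G phi & phi v != 0) &
  exists2 phi, G phi & forall v : 'rV[K]_n,
      (p.@[v 0] == 0) = (v 0 e == 0) || (phi ((v 0 e)^-1 *: v) == 0)].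
pose F := [set p : {mpoly K[n]} | homogeneous p /\
  forall v, A v -> p.@[v 0] = 0].
have nrm (v : 'rV[K]_n) e : v 0 e != 0 -> ((v 0 e)^-1 *: v) 0 e = 1 :> K.
  by move=> v0; rewrite mxE mulVf.
have AZE v c : c != 0 -> A (c *: v) <-> A v.
  move=> c0; split=> [/(AZ _ c^-1)|]; last exact: AZ.
  by rewrite scalerA mulVf // scale1r; apply; rewrite invr_eq0.
exists F, G; split; first by move=> p [[]|[]].
move=> v; split=> [Av|[v0 Fv [q [qh [e [Fe Je [Ge [Hpoly HA] [g Gg qE]]]]] qv]]].
  split; [exact: A0|by move=> p [_ /(_ v Av)]|].
  have [e Je ve0] := AJ _ Av; have [Fe [Ge [Hpoly HA]]] := hJ _ Je.
  have /(HA _ (nrm _ _ ve0))[_ [g Gg gv]] : A ((v 0 e)^-1 *: v).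
    by apply: AZ; rewrite ?invr_eq0.
  have [q [qh qE]] := hom e g (Hpoly g (or_intror Gg)).
  exists q; last by rewrite qE negb_or ve0 gv.
  by split=> //; exists e, Fe => //; exists Ge => //; exists g.
rewrite qE negb_or in qv; case/andP: qv => ve0 gv.
apply/(AZE v (v 0 e)^-1); first by rewrite invr_eq0.
apply/(HA _ (nrm _ _ ve0)); split; last by exists g.
move=> phi Fphi; have [p [ph pE]] := hom e phi (Hpoly phi (or_introl Fphi)).
have /eqP : (p * q).@[v 0] = 0.
  apply: Fv; split.
    by case: ph => d1 ?; case: qh => d2 ?; exists (d1 + d2)%N; apply: dhomogM.
  move=> w Aw; apply/eqP; rewrite mevalM mulf_eq0 pE qE.
  have [//|we0] := eqVneq (w 0 e) 0.
  have /(HA _ (nrm _ _ we0))[/(_ phi Fphi) -> _] : A ((w 0 e)^-1 *: w).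
    by apply: AZ; rewrite ?invr_eq0.
  by rewrite eqxx orbT.
by rewrite mevalM mulf_eq0 pE qE (negbTE ve0) (negbTE gv) /= orbF => /eqP.
Qed.

Lemma regular_chart n m (A : set 'rV[K]_n) (B : set 'rV[K]_m) f :
  locally_closed A -> locally_closed B ->
  (forall v, A v -> exists e g (h : 'I_m -> 'rV[K]_n -> K),
    [/\ polyfun g, forall i, polyfun (h i), v 0 e != 0,
        g ((v 0 e)^-1 *: v) != 0 &
        forall w : 'rV[K]_n, A w -> w 0 e != 0 -> let w' := (w 0 e)^-1 *: w in
          g w' != 0 ->
          B (\row_i h i w') /\ proj_eq (\row_i h i w') (f w)]) ->
  regular A B f.
Proof.
move=> lcA lcB H v Av; have [e [g [h [pg ph ve gv hB]]]] := H v Av.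
have [dg /(_ dg (leqnn _)) [q qh qE]] := homogenize e pg.
have /choice[dh hdh] := fun i => homogenize e (ph i).
pose d := \max_i dh i.
have /choice[p hp] i : exists p : {mpoly K[n]}, p \is d.-homog /\
    forall v : 'rV[K]_n,
      p.@[v 0] = if v 0 e == 0 then 0 else v 0 e ^+ d * h i ((v 0 e)^-1 *: v).
  by have [|p ? ?] := hdh i d; [exact: leq_bigmax|exists p].
exists d, p, q; split.
- by move=> i; case: (hp i).
- by exists dg.
- by rewrite qE (negbTE ve) mulf_neq0 // expf_neq0.
move=> w Aw; rewrite qE; case: ifPn => [|we]; first by rewrite eqxx.
rewrite mulf_eq0 negb_or => /andP[_ /(hB w Aw we)] [Bw fw].
have -> : \row_i (p i).@[w 0]
    = w 0 e ^+ d *: \row_i h i ((w 0 e)^-1 *: w).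
  by apply/rowP => i; rewrite !mxE (hp i).2 (negbTE we).
have c0 : w 0 e ^+ d != 0 by rewrite expf_neq0.
split; first exact: lc_scale.
by apply: proj_eq_trans fw; apply: proj_eq_sym; apply: proj_eqZ.
Qed.

Lemma regular_image n m (A : set 'rV[K]_n) (B : set 'rV[K]_m) f v :
  locally_closed B -> regular A B f -> A v -> B (f v).
Proof.
move=> lcB rf Av; have [d [h [q [_ _ qv /(_ v Av qv)[Bh hf]]]]] := rf v Av.
exact: lc_proj_eq lcB hf Bh.
Qed.

Lemma regular_proj_eq n m (A : set 'rV[K]_n) (B : set 'rV[K]_m) f v w :
  locally_closed A -> regular A B f -> A v -> proj_eq v w ->
  proj_eq (f v) (f w).
Proof.
move=> lcA rf Av [c c0 wE]; have [d [h [q [hh qh qv H]]]] := rf v Av.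
have Aw : A w by rewrite wE; apply: lc_scale.
have qw : q.@[w 0] != 0 by rewrite wE homog_eq0Z.
have [_ e1] := H v Av qv; have [_ e2] := H w Aw qw.
apply: proj_eq_trans (proj_eq_sym e1) _; apply: proj_eq_trans e2.
exists (c ^+ d); first by rewrite expf_neq0.
by apply/rowP => i; rewrite !mxE wE (mevalZ_homog _ _ (hh i)).
Qed.

Lemma row_neq0P n (v : 'rV[K]_n) : v != 0 -> exists e, v 0 e != 0.
Proof. by move=> /rV0Pn. Qed.

Lemma isomorphic_sym X Y : isomorphic X Y -> isomorphic Y X.
Proof. by move=> [f [g [? ? ? ?]]]; exists g, f; split. Qed.

Lemma isomorphic_reindex (X Y : variety)
    (s : 'I_(vdim Y) -> 'I_(vdim X)) (t : 'I_(vdim X) -> 'I_(vdim Y)) :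
  cancel s t -> cancel t s ->
  (forall v, @vset X v -> @vset Y (\row_j v 0 (s j))) ->
  (forall w, @vset Y w -> @vset X (\row_i w 0 (t i))) -> isomorphic X Y.
Proof.
have reg n m (A : set 'rV[K]_n) (B : set 'rV[K]_m) (r : 'I_m -> 'I_n) :
    (forall v, A v -> B (\row_j v 0 (r j))) ->
    regular A B (fun v => \row_j v 0 (r j)).
  move=> AB v Av; exists 1%N, (fun j => 'X_(r j)), 1; split.
  - by move=> j; rewrite dhomogX /= mdeg1.
  - by exists 0%N; apply: dhomog1.
  - by rewrite meval1 oner_neq0.
  move=> w Aw _; suff -> : \row_i ('X_(r i)).@[w 0] = \row_j w 0 (r j).
    by split; [apply: AB|apply: proj_eq_refl].
  by apply/rowP => j; rewrite !mxE mevalXU.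
move=> sK tK fXY gYX; do 2!eexists; split; [exact: reg fXY|exact: reg gYX| |].
- move=> v _; rewrite [X in proj_eq _ X](_ : _ = v) //; first exact: proj_eq_refl.
  by apply/rowP => i; rewrite !mxE tK.
- move=> w _; rewrite [X in proj_eq _ X](_ : _ = w) //; first exact: proj_eq_refl.
  by apply/rowP => i; rewrite !mxE sK.
Qed.

Lemma homogeneousM n (p q : {mpoly K[n]}) :
  homogeneous p -> homogeneous q -> homogeneous (p * q).
Proof. by move=> [d hp] [e hq]; exists (d + e)%N; apply: dhomogM. Qed.

Lemma lc_closed_in n (A B : set 'rV[K]_n) :
  locally_closed B -> closed_in A B -> locally_closed A.
Proof.
move=> [F [G [FG BE]]] [F' [hF' AE]]; exists (F `|` F'), G; split.
  by move=> p [[Fp|/hF'//]|Gp]; apply: FG; [left|right].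
move=> v; split=> [/AE[/BE[v0 Fv Gv] F'v]|[v0 FF'v Gv]].
  by split=> // p [/Fv|/F'v].
apply/AE; split=> [|p F'p]; last by apply: FF'v; right.
by apply/BE; split=> // p Fp; apply: FF'v; left.
Qed.

Lemma lc_setD n (A B : set 'rV[K]_n) :
  locally_closed B -> closed_in A B -> locally_closed (B `\` A).
Proof.
move=> [F [G [FG BE]]] [F' [hF' AE]].
exists F, [set r | exists p q, [/\ F' p, G q & r = p * q]]; split.
  move=> r [Fr|[p [q [F'p Gq ->]]]]; first by apply: FG; left.
  by apply: homogeneousM; [apply: hF'|apply: FG; right].
move=> v; split=> [[Bv nA]|[v0 Fv [_ [p [q [F'p Gq ->]]]]]].
  have /BE[v0 Fv [q Gq qv]] := Bv; split=> //.
  have [p F'p pv] : exists2 p, F' p & p.@[v 0] != 0.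
    apply: contrapT => np; apply: nA; apply/AE; split=> // p F'p.
    by apply/eqP; apply: contrapT => /negP pv; apply: np; exists p.
  by exists (p * q); [exists p, q|rewrite mevalM mulf_neq0].
rewrite mevalM mulf_eq0 negb_or => /andP[pv qv].
split; first by apply/BE; split=> //; exists q.
by move=> /AE[_ /(_ p F'p) pv0]; rewrite pv0 eqxx in pv.
Qed.

End QuasiProjective.

Section Products.
Variable K : closedFieldType.

(* The Segre embedding P(K^n) x P(K^m) -> P(K^(n * m)). *)
Definition segre n m (v : 'rV[K]_n) (w : 'rV[K]_m) : 'rV[K]_(n * m) :=
  mxvec (v^T *m w).

Definition segre_image n m (A : set 'rV[K]_n) (B : set 'rV[K]_m) :
    set 'rV[K]_(n * m) :=
  [set z | exists v w, [/\ A v, B w & z = segre v w]].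

Lemma segreE n m (v : 'rV[K]_n) (w : 'rV[K]_m) i j :
  segre v w 0 (mxvec_index i j) = v 0 i * w 0 j.
Proof. by rewrite mxvecE mxE big_ord1 mxE. Qed.

Lemma segreZl n m c (v : 'rV[K]_n) (w : 'rV[K]_m) :
  segre (c *: v) w = c *: segre v w.
Proof. by rewrite /segre linearZ -scalemxAl linearZ. Qed.

Lemma segreZr n m c (v : 'rV[K]_n) (w : 'rV[K]_m) :
  segre v (c *: w) = c *: segre v w.
Proof. by rewrite /segre -scalemxAr linearZ. Qed.

Lemma segre_proj_eq n m (v v' : 'rV[K]_n) (w w' : 'rV[K]_m) :
  proj_eq v v' -> proj_eq w w' -> proj_eq (segre v w) (segre v' w').
Proof.
move=> [c c0 ->] [d d0 ->]; rewrite segreZl segreZr scalerA.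
by apply: proj_eqZ; rewrite mulf_neq0.
Qed.

Lemma segre_inj n m (v v' : 'rV[K]_n) (w w' : 'rV[K]_m) :
  v != 0 -> w != 0 -> segre v w = segre v' w' ->
  proj_eq v v' /\ proj_eq w w'.
Proof.
move=> /row_neq0P[i vi] /row_neq0P[j wj] E.
have {}E a b : v 0 a * w 0 b = v' 0 a * w' 0 b by rewrite -!segreE E.
have := mulf_neq0 vi wj; rewrite E mulf_eq0 negb_or => /andP[vi' wj'].
split; apply: proj_eq_sym.
  exists (w' 0 j / w 0 j); first by rewrite mulf_neq0 ?invr_eq0.
  apply/rowP => a; rewrite mxE; apply: (mulIf wj).
  by rewrite E mulrAC mulrC divfK // mulrC.
exists (v' 0 i / v 0 i); first by rewrite mulf_neq0 ?invr_eq0.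
apply/rowP => b; rewrite mxE; apply: (mulfI vi).
by rewrite E mulrA [v 0 i * _]mulrC divfK.
Qed.

Lemma segre_image_lc n m (A : set 'rV[K]_n) (B : set 'rV[K]_m) :
  locally_closed A -> locally_closed B -> locally_closed (segre_image A B).
Proof.
move=> lcA lcB.
apply: (@lc_chart _ _ _ setT).
- move=> _ [v [w [Av Bw ->]]].
  have /row_neq0P[i vi] := lc_neq0 lcA Av.
  have /row_neq0P[j wj] := lc_neq0 lcB Bw.
  apply/rV0Pn; exists (mxvec_index i j); rewrite segreE.
  by rewrite mulf_neq0.
- move=> _ c c0 [v [w [Av Bw ->]]]; exists (c *: v), w; split=> //.
  + exact: lc_scale.
  + by rewrite segreZl.
- move=> _ [v [w [Av Bw ->]]].
  have /row_neq0P[i vi] := lc_neq0 lcA Av.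
  have /row_neq0P[j wj] := lc_neq0 lcB Bw.
  by exists (mxvec_index i j) => //; rewrite segreE mulf_neq0.
move=> e _; case/mxvec_indexP: e => i j.
have [FA [GA [_ hA]]] := lcA; have [FB [GB [_ hB]]] := lcB.
pose V (z : 'rV[K]_(n * m)) := \row_a z 0 (mxvec_index a j).
pose W (z : 'rV[K]_(n * m)) := \row_b z 0 (mxvec_index i b).
have pV (p : {mpoly K[n]}) : polyfun (fun z => p.@[V z 0]).
  apply: (@polyfun_comp _ _ _ _ (fun a z => V z 0 a)) => a.
  by apply: (@polyfun_ext _ _ (fun z => z 0 (mxvec_index a j)));
    [move=> z; rewrite mxE|exact: polyfunX].
have pW (p : {mpoly K[m]}) : polyfun (fun z => p.@[W z 0]).
  apply: (@polyfun_comp _ _ _ _ (fun a z => W z 0 a)) => a.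
  by apply: (@polyfun_ext _ _ (fun z => z 0 (mxvec_index i a)));
    [move=> z; rewrite mxE|exact: polyfunX].
exists [set phi | polyfun phi /\ forall z, segre_image A B z ->
                  z 0 (mxvec_index i j) = 1 -> phi z = 0].
exists [set phi | exists p q, [/\ GA p, GB q &
                    phi = fun z => p.@[V z 0] * q.@[W z 0]]].
split.
  by move=> phi [[]//|[p [q [_ _ ->]]]]; apply: polyfunM.
move=> z zij; split=> [zAB|].
  split=> [phi [_ Hphi]|]; first exact: Hphi.
  case: zAB zij => v [w [Av Bw ->]]; rewrite segreE => vw1.
  have vi : v 0 i != 0.
    by apply: contra_eq_neq vw1 => ->; rewrite mul0r eq_sym oner_neq0.
  have wj : w 0 j != 0.
    by apply: contra_eq_neq vw1 => ->; rewrite mulr0 eq_sym oner_neq0.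
  have VE : V (segre v w) = w 0 j *: v.
    by apply/rowP => a; rewrite !mxE segreE mulrC.
  have WE : W (segre v w) = v 0 i *: w.
    by apply/rowP => a; rewrite !mxE segreE.
  have /hA[_ _ [p Gp pv]] := lc_scale lcA wj Av.
  have /hB[_ _ [q Gq qw]] := lc_scale lcB vi Bw.
  exists (fun z => p.@[V z 0] * q.@[W z 0]); first by exists p, q.
  by rewrite VE WE mulf_neq0.
move=> [Fz [_ [p [q [Gp Gq ->]]]]]; rewrite mulf_eq0 negb_or => /andP[pv qw].
have EV (z' : 'rV[K]_(n * m)) v w : z' 0 (mxvec_index i j) = 1 -> z' = segre v w ->
    [/\ V z' = w 0 j *: v, W z' = v 0 i *: w, v 0 i != 0 & w 0 j != 0].
  move=> z1 zE; move: z1; rewrite zE segreE => vw1; split.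
  - by apply/rowP => a; rewrite !mxE segreE mulrC.
  - by apply/rowP => a; rewrite !mxE segreE.
  - by apply: contra_eq_neq vw1 => ->; rewrite mul0r eq_sym oner_neq0.
  - by apply: contra_eq_neq vw1 => ->; rewrite mulr0 eq_sym oner_neq0.
exists (V z), (W z); split.
- apply/hA; split; last by exists p.
    by apply/rV0Pn; exists i; rewrite mxE zij oner_neq0.
  move=> f Ff; apply: (Fz (fun z => f.@[V z 0])); split=> // z' [v [w [Av Bw zE]]] z1.
  have [-> _ _ wj] := EV _ _ _ z1 zE.
  by have /hA[_ /(_ f Ff)] := lc_scale lcA wj Av.
- apply/hB; split; last by exists q.
    by apply/rV0Pn; exists j; rewrite mxE zij oner_neq0.
  move=> f Ff; apply: (Fz (fun z => f.@[W z 0])); split=> // z' [v [w [Av Bw zE]]] z1.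
  have [_ -> vi _] := EV _ _ _ z1 zE.
  by have /hB[_ /(_ f Ff)] := lc_scale lcB vi Bw.
apply/rowP => k; case/mxvec_indexP: k => a b; rewrite segreE !mxE.
apply/eqP; rewrite -subr_eq0; apply/eqP.
apply: (Fz (fun z => z 0 (mxvec_index a b)
                     - z 0 (mxvec_index a j) * z 0 (mxvec_index i b))).
split; first by apply: polyfunB; [|apply: polyfunM]; apply: polyfunX.
move=> _ [v [w [Av Bw ->]]]; rewrite !segreE => vw1.
by rewrite mulrACA [w 0 j * _]mulrC mulrACA vw1 mulr1 subrr.
Qed.

Lemma closed_in_segre n m (A B : set 'rV[K]_n) (C : set 'rV[K]_m) :
  locally_closed A -> locally_closed C -> closed_in B A ->
  closed_in (segre_image B C) (segre_image A C).
Proof.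
move=> lcA lcC [F [hF BE]].
exists [set p | homogeneous p /\ forall z, segre_image B C z -> p.@[z 0] = 0].
split=> [p []//|z]; split=> [zBC|[[v [w [Av Cw ->]]] Fz]].
  split; last by move=> p [_]; apply.
  by case: zBC => v [w [/BE[Av _] Cw ->]]; exists v, w.
exists v, w; split=> //; apply/BE; split=> // f Ff.
have /row_neq0P[i vi] := lc_neq0 lcA Av.
have /row_neq0P[j wj] := lc_neq0 lcC Cw.
pose V (z : 'rV[K]_(n * m)) := \row_a z 0 (mxvec_index a j).
have VE c v' w' : V (c *: segre v' w') = (c * w' 0 j) *: v'.
  by apply/rowP => a; rewrite !mxE segreE mulrAC -mulrA mulrC.
have pV : polyfun (fun z => f.@[V z 0]).
  apply: (@polyfun_comp _ _ _ _ (fun a z => V z 0 a)) => a.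
  by apply: (@polyfun_ext _ _ (fun z => z 0 (mxvec_index a j)));
    [move=> z'; rewrite mxE|exact: polyfunX].
have [d /(_ d (leqnn d))[p hp pE]] := homogenize (mxvec_index i j) pV.
have [e fe] := hF f Ff.
have : p.@[segre v w 0] = 0.
  apply: Fz; split=> [|_ [v' [w' [/BE[_ /(_ f Ff) fv'] _ ->]]]]; first by exists d.
  by rewrite pE VE (mevalZ_homog _ _ fe) fv' !mulr0; case: ifP.
have vw0 : v 0 i * w 0 j != 0 by rewrite mulf_neq0.
rewrite pE VE segreE (negbTE vw0) => /eqP; rewrite mulf_eq0 expf_eq0.
rewrite (negbTE vw0) andbF /= homog_eq0Z; [by move/eqP|by exists e|].
by rewrite mulf_neq0 ?invr_eq0.
Qed.

Definition prodv (X Y : variety K) :=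
  Variety (segre_image_lc (vset_lc X) (vset_lc Y)).

Lemma isomorphic_prodl X X' Y :
  isomorphic X X' -> isomorphic (prodv X Y) (prodv X' Y).
Proof.
have reg (X1 X2 : variety K) f : regular (@vset _ X1) (@vset _ X2) f ->
    exists F : 'rV[K]_(vdim X1 * vdim Y) -> 'rV[K]_(vdim X2 * vdim Y),
      regular (@vset _ (prodv X1 Y)) (@vset _ (prodv X2 Y)) F /\
      forall v w, vset v -> @vset _ Y w ->
        proj_eq (segre (f v) w) (F (segre v w)) /\ vset (f v).
  move=> rf.
  have fX2 v : vset v -> vset (f v) := regular_image (vset_lc X2) rf.
  have fP v v' := regular_proj_eq (vset_lc X1) rf (v := v) (w := v').
  have /choice[dec decP] (z : 'rV[K]_(vdim X1 * vdim Y)) : exists x,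
      @vset _ (prodv X1 Y) z -> [/\ vset x.1, vset x.2 & z = segre x.1 x.2].
    have [[v [w [Xv Yw ->]]]|H] := pselect (@vset _ (prodv X1 Y) z).
      by exists (v, w).
    by exists (0, 0).
  pose F z := segre (f (dec z).1) (dec z).2.
  have FP v w : vset v -> vset w -> proj_eq (segre (f v) w) (F (segre v w)).
    move=> Xv Yw.
    have [|dv dw E] := decP (segre v w); first by exists v, w.
    have [||ev ew] := segre_inj _ _ E.
    - exact: lc_neq0 (vset_lc X1) Xv.
    - exact: lc_neq0 (vset_lc Y) Yw.
    by apply: segre_proj_eq => //; apply: fP.
  exists F; split; last by move=> v w Xv Yw; split; [exact: FP|exact: fX2].
  apply: regular_chart; [exact: vset_lc|exact: vset_lc|].
  move=> _ [v [w [Xv Yw ->]]].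
  have [d [h [q [hh qh qv H]]]] := rf v Xv.
  have /row_neq0P[i vi] := lc_neq0 (vset_lc X1) Xv.
  have /row_neq0P[j wj] := lc_neq0 (vset_lc Y) Yw.
  pose V (z : 'rV[K]_(vdim X1 * vdim Y)) := \row_a z 0 (mxvec_index a j).
  pose W (z : 'rV[K]_(vdim X1 * vdim Y)) := \row_b z 0 (mxvec_index i b).
  have pV (p : {mpoly K[vdim X1]}) : polyfun (fun z => p.@[V z 0]).
    apply: (@polyfun_comp _ _ _ _ (fun a z => V z 0 a)) => a.
    by apply: (@polyfun_ext _ _ (fun z => z 0 (mxvec_index a j)));
      [move=> z; rewrite mxE|exact: polyfunX].
  pose H' (k : 'I_(vdim X2 * vdim Y)) z :=
    segre (\row_a (h a).@[V z 0]) (W z) 0 k.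
  exists (mxvec_index i j), (fun z => q.@[V z 0]), H'.
  have VW v1 w1 : vset v1 -> vset w1 -> v1 0 i * w1 0 j != 0 ->
      let z := (v1 0 i * w1 0 j)^-1 *: segre v1 w1 in
      [/\ exists2 c, c != 0 & V z = c *: v1 & exists2 c, c != 0 & W z = c *: w1].
    move=> Xv1 Yw1; rewrite mulf_eq0 negb_or => /andP[vi1 wj1]; split.
      exists (v1 0 i)^-1; rewrite ?invr_eq0 //.
      apply/rowP => a; rewrite !mxE segreE invfM.
      by rewrite mulrACA mulVf ?mulr1.
    exists (w1 0 j)^-1; rewrite ?invr_eq0 //.
    apply/rowP => a; rewrite !mxE segreE invfM.
    by rewrite mulrACA mulVf ?mul1r.
  split.
  - exact: pV.
  - move=> k; case/mxvec_indexP: k => a b.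
    apply: (@polyfun_ext _ _ (fun z => (h a).@[V z 0] * z 0 (mxvec_index i b))).
      by move=> z; rewrite /H' segreE !mxE.
    by apply: polyfunM => //; apply: polyfunX.
  - by rewrite segreE mulf_neq0.
  - rewrite segreE; have [|[c c0 ->] _] := VW v w Xv Yw; first by rewrite mulf_neq0.
    by rewrite homog_eq0Z.
  move=> _ [v1 [w1 [Xv1 Yw1 ->]]]; rewrite segreE => vw1 /=.
  have [[c c0 VE] [c' c0' WE]] := VW v1 w1 Xv1 Yw1 vw1.
  set z := _^-1 *: _ in VE WE *; rewrite VE homog_eq0Z // => qv1.
  have -> : \row_k H' k z = segre (\row_a (h a).@[V z 0]) (W z).
    by apply/rowP => k; rewrite mxE.
  have [Yh hf] := H _ Xv1 qv1.
  have e1 : proj_eq (\row_a (h a).@[V z 0]) (\row_a (h a).@[v1 0]).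
    apply: proj_eq_sym; exists (c ^+ d); first by rewrite expf_neq0.
    by apply/rowP => a; rewrite !mxE VE (mevalZ_homog _ _ (hh a)).
  have e2 : proj_eq (W z) w1 by apply: proj_eq_sym; exists c'.
  split.
    exists (\row_a (h a).@[V z 0]), (W z); split=> //.
      exact: lc_proj_eq (vset_lc X2) (proj_eq_sym e1) Yh.
    exact: lc_proj_eq (vset_lc Y) (proj_eq_sym e2) Yw1.
  apply: proj_eq_trans (FP _ _ Xv1 Yw1); apply: segre_proj_eq => //.
  exact: proj_eq_trans hf.
move=> [f [g [rf rg fK gK]]].
have [F [rF FE]] := reg _ _ _ rf; have [G [rG GE]] := reg _ _ _ rg.
exists F, G; split=> //.
  move=> _ [v [w [Xv Yw ->]]].
  have [e1 Xfv] := FE v w Xv Yw; have [e2 _] := GE _ w Xfv Yw.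
  apply: proj_eq_trans (segre_proj_eq (fK v Xv) (proj_eq_refl w)) _.
  apply: proj_eq_trans e2 _.
  by apply: regular_proj_eq (vset_lc _) rG _ _ => //; exists (f v), w.
move=> _ [v [w [Xv Yw ->]]].
have [e1 Xfv] := GE v w Xv Yw; have [e2 _] := FE _ w Xfv Yw.
apply: proj_eq_trans (segre_proj_eq (gK v Xv) (proj_eq_refl w)) _.
apply: proj_eq_trans e2 _.
by apply: regular_proj_eq (vset_lc _) rF _ _ => //; exists (g v), w.
Qed.

End Products.

Section ProductLaws.
Variable K : closedFieldType.

(* The inverse of [mxvec_index]. *)
Definition mxvec_unindex n m (k : 'I_(n * m)) : 'I_n * 'I_m :=
  enum_val (cast_ord (esym (mxvec_cast n m)) k).

Lemma mxvec_indexK n m i j : mxvec_unindex (@mxvec_index n m i j) = (i, j).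
Proof. by rewrite /mxvec_unindex cast_ordK enum_rankK. Qed.

Lemma isomorphic_prodC (X Y : variety K) :
  isomorphic (prodv X Y) (prodv Y X).
Proof.
pose s n m (k : 'I_(n * m)) :=
  mxvec_index (mxvec_unindex k).2 (mxvec_unindex k).1.
have sE n m (v : 'rV[K]_n) (w : 'rV[K]_m) :
    \row_k segre v w 0 (s _ _ k) = segre w v.
  apply/rowP => k; case/mxvec_indexP: k => i j.
  by rewrite mxE /s mxvec_indexK /= !segreE mulrC.
apply: (@isomorphic_reindex _ (prodv X Y) (prodv Y X) (s _ _) (s _ _)).
- by move=> k; case/mxvec_indexP: k => i j; rewrite /s !mxvec_indexK.
- by move=> k; case/mxvec_indexP: k => i j; rewrite /s !mxvec_indexK.
- by move=> _ [v [w [Xv Yw ->]]]; exists w, v; split=> //; exact: sE.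
- by move=> _ [v [w [Xv Yw ->]]]; exists w, v; split=> //; exact: sE.
Qed.

Lemma isomorphic_prodA (X Y Z : variety K) :
  isomorphic (prodv X (prodv Y Z)) (prodv (prodv X Y) Z).
Proof.
pose s n m p (k : 'I_(n * m * p)) : 'I_(n * (m * p)) :=
  let: (ij, k) := mxvec_unindex k in
  let: (i, j) := mxvec_unindex ij in mxvec_index i (mxvec_index j k).
pose t n m p (k : 'I_(n * (m * p))) : 'I_(n * m * p) :=
  let: (i, jk) := mxvec_unindex k in
  let: (j, k) := mxvec_unindex jk in mxvec_index (mxvec_index i j) k.
apply: (@isomorphic_reindex _ (prodv X (prodv Y Z)) (prodv (prodv X Y) Z)
          (s _ _ _) (t _ _ _)).
- move=> k; case/mxvec_indexP: k => ij k; case/mxvec_indexP: ij => i j.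
  by rewrite /s !mxvec_indexK /t !mxvec_indexK.
- move=> k; case/mxvec_indexP: k => i jk; case/mxvec_indexP: jk => j k.
  by rewrite /t !mxvec_indexK /s !mxvec_indexK.
- move=> _ [u [_ [Xu [v [w [Yv Zw ->]]] ->]]].
  exists (segre u v), w; split=> //; first by exists u, v.
  apply/rowP => k; case/mxvec_indexP: k => ij k; case/mxvec_indexP: ij => i j.
  by rewrite mxE /s !mxvec_indexK !segreE mulrA.
- move=> _ [_ [w [[u [v [Xu Yv ->]]] Zw ->]]].
  exists u, (segre v w); split=> //; first by exists v, w.
  apply/rowP => k; case/mxvec_indexP: k => i jk; case/mxvec_indexP: jk => j k.
  by rewrite mxE /t !mxvec_indexK !segreE mulrA.
Qed.

Fact point_lc : locally_closed [set v : 'rV[K]_1 | v != 0].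
Proof.
exists set0, [set 1]; split=> [p [//|->]|v].
  by exists 0%N; apply: dhomog1.
split=> [v0|[]//]; split=> //; exists 1 => //.
by rewrite meval1 oner_neq0.
Qed.

Definition pointv := Variety point_lc.

Lemma isomorphic_prod1 (X : variety K) : isomorphic (prodv pointv X) X.
Proof.
pose s n (j : 'I_n) : 'I_(1 * n) := mxvec_index 0 j.
pose t n (k : 'I_(1 * n)) : 'I_n := (mxvec_unindex k).2.
apply: (@isomorphic_reindex _ (prodv pointv X) X (s _) (t _)).
- by move=> j; rewrite /s /t mxvec_indexK.
- by move=> k; case/mxvec_indexP: k => i j; rewrite /t mxvec_indexK /s ord1.
- move=> _ [u [v [/= u0 Xv ->]]].
  have u00 : u 0 0 != 0 by move/rV0Pn: u0 => [i]; rewrite ord1.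
  suff -> : \row_j segre u v 0 (s _ j) = u 0 0 *: v.
    exact: lc_scale (vset_lc X) _ _.
  by apply/rowP => j; rewrite !mxE /s segreE.
- move=> w Xw; exists 1, w; split=> //=; first by rewrite oner_neq0.
  apply/rowP => k; case/mxvec_indexP: k => i j.
  by rewrite mxE /t mxvec_indexK segreE ord1 mxE mul1r.
Qed.

End ProductLaws.

(* The abelian group generated by the classes of varieties is the quotient of
   the free abelian group [fvar] by the subgroup [krel]. *)
Section GrothendieckGroup.
Variable K : closedFieldType.

Local Notation fvar := {freeg {classic (variety K)} / int}.

Definition gen (X : variety K) : fvar := << (X : {classic (variety K)}) >>.

Inductive krel_spec : fvar -> Prop :=
| Krel0 : krel_spec 0
| KrelB a b : krel_spec a -> krel_spec b -> krel_spec (a - b)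
| KrelIso X Y : isomorphic X Y -> krel_spec (gen X - gen Y)
| KrelScissor n (A B : set 'rV[K]_n) (lcA : locally_closed A)
    (lcB : locally_closed B) (lcC : locally_closed (A `\` B)) :
    closed_in B A ->
    krel_spec (gen (Variety lcA) - (gen (Variety lcB) + gen (Variety lcC))).

Definition krel : {pred fvar} := [pred a | `[< krel_spec a >]].

Lemma krelP a : reflect (krel_spec a) (a \in krel).
Proof. by rewrite inE; apply: asboolP. Qed.

Fact krel_zmod_closed : zmod_closed krel.
Proof.
split; first exact/krelP/Krel0.
by move=> a b /krelP ka /krelP kb; apply/krelP/KrelB.
Qed.
HB.instance Definition _ := GRing.isZmodClosed.Build fvar krel krel_zmod_closed.

Definition K0 : Type := Quotient.quot krel.
HB.instance Definition _ := GRing.Zmodule.on K0.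

Definition class (X : variety K) : K0 := \pi_(Quotient.quot krel) (gen X).

Definition fmul (a b : fvar) : fvar :=
  fglift (fun X : {classic (variety K)} =>
    fglift (fun Y : {classic (variety K)} => gen (prodv X Y)) b) a.

Definition kmul (x y : K0) : K0 :=
  \pi_(Quotient.quot krel) (fmul (repr x) (repr y)).


Lemma fvar_ind (P : fvar -> Prop) :
  P 0 -> (forall a b, P a -> P b -> P (a - b)) -> (forall X, P (gen X)) ->
  forall a, P a.
Proof.
move=> P0 PB Pg.
have PN a : P a -> P (- a) by move=> Pa; rewrite -sub0r; apply: PB.
have PD a b : P a -> P b -> P (a + b).
  by move=> Pa Pb; rewrite -[b]opprK; apply: PB => //; apply: PN.
apply: freeg_ind_dom0 => // k X D _ _; apply: (PD).
have -> : << k *g X >> = gen X *~ k :> fvar.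
  by rewrite /gen freegU_mulz intz.
case: k => [n|n].
  by rewrite -pmulrn; elim: n => [//|n IH]; rewrite mulrS; apply: (PD).
rewrite NegzE mulrNz -pmulrn; apply: PN.
by elim: n => [//|n IH]; rewrite mulrS; apply: (PD).
Qed.

Lemma fmulBl a b c : fmul (a - b) c = fmul a c - fmul b c.
Proof. exact: lift_is_additive. Qed.

Lemma fmul0r c : fmul 0 c = 0.
Proof. by rewrite -[X in fmul X]subr0 fmulBl subrr. Qed.

Lemma fmul_genl X b :
  fmul (gen X) b =
  fglift (fun Y : {classic (variety K)} => gen (prodv X Y)) b.
Proof. by rewrite /fmul liftU scale1r. Qed.

Lemma fmul_gen X Y : fmul (gen X) (gen Y) = gen (prodv X Y).
Proof. by rewrite fmul_genl liftU scale1r. Qed.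

Lemma fmulBr a b c : fmul a (b - c) = fmul a b - fmul a c.
Proof.
elim/fvar_ind: a => [|a a' IH IH'|X].
- by rewrite !fmul0r subr0.
- by rewrite !fmulBl IH IH' !opprD addrACA.
- by rewrite !fmul_genl; apply: lift_is_additive.
Qed.

Lemma fmulr0 a : fmul a 0 = 0.
Proof. by rewrite -[X in fmul _ X]subr0 fmulBr subrr. Qed.

Lemma keq_ind2 (f g : fvar -> fvar) :
  (forall a b, f (a - b) = f a - f b) -> (forall a b, g (a - b) = g a - g b) ->
  (forall X, f (gen X) - g (gen X) \in krel) ->
  forall a, f a - g a \in krel.
Proof.
move=> fB gB H; elim/fvar_ind => [|a b Ha Hb|//].
  by rewrite -[X in f X](subrr 0) -[X in g X](subrr 0) fB gB !subrr rpred0.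
by rewrite fB gB opprD addrACA -opprD rpredB.
Qed.


Lemma fmul_krell a b : a \in krel -> fmul a b \in krel.
Proof.
move=> /krelP ka; elim/fvar_ind: b => [|b b' kb kb'|Z].
- by rewrite fmulr0 rpred0.
- by rewrite fmulBr rpredB.
elim: ka => [|{}a {}b _ ka _ kb|X Y XY|n A B lcA lcB lcC cBA].
- by rewrite fmul0r rpred0.
- by rewrite fmulBl rpredB.
- rewrite fmulBl !fmul_gen; apply/krelP/KrelIso.
  exact: isomorphic_prodl.
rewrite opprD addrA !fmulBl !fmul_gen -addrA -opprD.
pose AZ := segre_image A (@vset _ Z); pose BZ := segre_image B (@vset _ Z).
have lcAZ : locally_closed AZ := segre_image_lc lcA (vset_lc Z).
have lcBZ : locally_closed BZ := segre_image_lc lcB (vset_lc Z).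
have BA : B `<=` A by case: cBA => F [_ BE] v /BE[].
have CZ : segre_image (A `\` B) (@vset _ Z) = AZ `\` BZ.
  apply/seteqP; split=> [_ [v [w [[Av Bv] Zw ->]]]|_ [[v [w [Av Zw ->]]] nB]].
    split; first by exists v, w.
    move=> [v' [w' [Bv' Zw' E]]]; apply: Bv.
    have [||ev _] := segre_inj _ _ E.
    - exact: lc_neq0 lcA Av.
    - exact: lc_neq0 (vset_lc Z) Zw.
    exact: lc_proj_eq lcB (proj_eq_sym ev) Bv'.
  by exists v, w; split=> //; split=> // Bv; apply: nB; exists v, w.
have lcCZ : locally_closed (AZ `\` BZ).
  by rewrite -CZ; apply: segre_image_lc lcC (vset_lc Z).
have -> : prodv (Variety lcC) Z = Variety lcCZ.
  by rewrite /prodv /=; move: (segre_image_lc _ _) lcCZ; rewrite /= CZ => p q;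
    rewrite (Prop_irrelevance p q).
by apply/krelP/KrelScissor; apply: closed_in_segre lcA (vset_lc Z) cBA.
Qed.

Lemma fmulC_krel a b : fmul a b - fmul b a \in krel.
Proof.
apply: (@keq_ind2 (fmul^~ b) (fmul b)) => [c d|c d|X]; [exact: fmulBl|exact: fmulBr|].
apply: (@keq_ind2 (fmul (gen X)) (fmul^~ (gen X))) => [c d|c d|Y];
  [exact: fmulBr|exact: fmulBl|].
by rewrite !fmul_gen; apply/krelP/KrelIso; apply: isomorphic_prodC.
Qed.

Lemma fmul_krelr a b : b \in krel -> fmul a b \in krel.
Proof.
move=> kb; rewrite -[fmul a b](subrK (fmul b a)).
by apply: rpredD; [apply: fmulC_krel|apply: fmul_krell].
Qed.

Lemma kpiP a b :
  reflect (\pi_(Quotient.quot krel) a = \pi_(Quotient.quot krel) b)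
          (a - b \in krel).
Proof. by rewrite Quotient.idealrBE; apply: eqP. Qed.

Lemma kpiD a b :
  \pi_(Quotient.quot krel) (a + b) =
  \pi_(Quotient.quot krel) a + \pi_(Quotient.quot krel) b :> K0.
Proof. exact: Quotient.pi_add. Qed.

Lemma kmul_pi a b :
  kmul (\pi_(Quotient.quot krel) a) (\pi_(Quotient.quot krel) b)
  = \pi_(Quotient.quot krel) (fmul a b).
Proof.
have kr (c : fvar) : repr (\pi_(Quotient.quot krel) c) - c \in krel.
  by apply/kpiP; rewrite reprK.
apply/kpiP; set a' := repr _; set b' := repr _.
rewrite -[_ - _](subrKA (fmul a' b)) -fmulBr -fmulBl.
by apply: rpredD; [apply: fmul_krelr|apply: fmul_krell]; apply: kr.
Qed.

Fact kmulA : associative kmul.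
Proof.
elim/quotW => a; elim/quotW => b; elim/quotW => c.
rewrite (kmul_pi b c) (kmul_pi a b) (kmul_pi a) (kmul_pi _ c); apply/kpiP.
apply: (@keq_ind2 (fun a => fmul a (fmul b c)) (fun a => fmul (fmul a b) c) _ _ _ a).
- by move=> a1 a2; rewrite fmulBl.
- by move=> a1 a2; rewrite !fmulBl.
move=> X.
apply: (@keq_ind2 (fun b => fmul (gen X) (fmul b c))
                  (fun b => fmul (fmul (gen X) b) c) _ _ _ b).
- by move=> a1 a2; rewrite fmulBl fmulBr.
- by move=> a1 a2; rewrite fmulBr fmulBl.
move=> Y.
apply: (@keq_ind2 (fun c => fmul (gen X) (fmul (gen Y) c))
                  (fun c => fmul (fmul (gen X) (gen Y)) c) _ _ _ c).
- by move=> a1 a2; rewrite !fmulBr.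
- by move=> a1 a2; rewrite fmulBr.
by move=> Z; rewrite !fmul_gen; apply/krelP/KrelIso; apply: isomorphic_prodA.
Qed.

Fact kmulC : commutative kmul.
Proof.
elim/quotW => a; elim/quotW => b; rewrite (kmul_pi a) (kmul_pi b).
by apply/kpiP; apply: fmulC_krel.
Qed.

Fact kmul1 : left_id (class (pointv K)) kmul.
Proof.
elim/quotW => a; rewrite kmul_pi; apply/kpiP.
apply: (@keq_ind2 (fmul (gen (pointv K))) id) => [b c|//|X]; first exact: fmulBr.
by rewrite fmul_gen; apply/krelP/KrelIso; apply: isomorphic_prod1.
Qed.

Fact kmulDl : left_distributive kmul +%R.
Proof.
elim/quotW => a; elim/quotW => b; elim/quotW => c.
rewrite -kpiD !kmul_pi -kpiD; congr (\pi _).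
by rewrite -[in LHS](opprK b) fmulBl -[- b]sub0r fmulBl fmul0r sub0r opprK.
Qed.

HB.instance Definition _ :=
  GRing.Zmodule_isComPzRing.Build K0 kmulA kmulC kmul1 kmulDl.

Lemma classM X Y : class (prodv X Y) = class X * class Y.
Proof. by rewrite /class -fmul_gen -kmul_pi. Qed.

Lemma class_isomorphic X Y : isomorphic X Y -> class X = class Y.
Proof. by move=> XY; apply/kpiP/krelP/KrelIso. Qed.

Lemma class_scissor n (A B : set 'rV[K]_n) (lcA : locally_closed A)
    (lcB : locally_closed B) (lcC : locally_closed (A `\` B)) :
  closed_in B A ->
  class (Variety lcA) = class (Variety lcB) + class (Variety lcC).
Proof.
move=> BA; rewrite /class -kpiD; apply/kpiP/krelP.
exact: KrelScissor.
Qed.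

End GrothendieckGroup.

Section HilbertScheme.
Variable K : closedFieldType.
Local Notation Kxy := {mpoly K[2]}.

Definition xy (a b : nat) : Kxy := 'X_ord0 ^+ a * 'X_ord_max ^+ b.

Definition is_ideal (I : set Kxy) :=
  [/\ I 0, forall f g, I f -> I g -> I (f + g) & forall f g, I g -> I (f * g)].

(* [phi] induces an isomorphism from C[x,y]/I onto C^N; it exists if and only if
   dim C[x,y]/I = N. *)
Definition quotient_map (I : set Kxy) N (phi : {linear Kxy -> 'rV[K]_N}) :=
  (forall v, exists f, phi f = v) /\ (forall f, I f <-> phi f = 0).

(* The span of the monomials x^i y^j with (i, j) in S. *)
Definition monomial_span (S : set (nat * nat)) : set Kxy :=
  [set h | forall m : 'X_{1..2}, m \in msupp h -> S (m ord0, m ord_max)].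

(* The condition I + V = C[x,y]. *)
Definition spans_mod (I V : set Kxy) :=
  forall f, exists g h, [/\ I g, V h & f = g + h].

(* The Hilbert scheme of N points, with its reduced structure, is embedded in a
   projective space by sending an ideal I to the Pluecker coordinates of the
   quotient map to C[x,y]/I restricted to the span of the monomials x^a y^b with
   a, b <= N, that is, to the N x N minors of the matrix of the images of these
   monomials.  Minors are indexed by all N-tuples of monomials, with the obvious
   redundancy. *)
Definition mono_tuple N := {ffun 'I_N -> 'I_N.+1 * 'I_N.+1}.

Definition pluecker N (phi : {linear Kxy -> 'rV[K]_N}) :
    'rV[K]_#|{: mono_tuple N}| :=
  \row_e \det (\matrix_(i < N)
    let ab := (enum_val e : mono_tuple N) i in phi (xy ab.1 ab.2)).

(* The points of the Hilbert scheme of N points whose ideal satisfies P. *)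
Definition hilb_locus N (P : set (set Kxy)) : set 'rV[K]_#|{: mono_tuple N}| :=
  [set z | exists (I : set Kxy) (phi : {linear Kxy -> 'rV[K]_N}) (c : K),
    [/\ is_ideal I, quotient_map I phi, P I, c != 0 & z = c *: pluecker phi]].

Lemma mpolyX_xy (m : 'X_{1..2}) : 'X_[m] = xy (m ord0) (m ord_max).
Proof.
rewrite mpolyXE_id !big_ord_recl big_ord0 mulr1 /xy; congr (_ * 'X__ ^+ m _).
  exact/val_inj.
Qed.

Lemma xy_mpolyX a b : exists m : 'X_{1..2},
  [/\ m ord0 = a, m ord_max = b & xy a b = 'X_[m]].
Proof.
exists [multinom (if i == ord0 then a else b) | i < 2].
by rewrite mpolyX_xy !mnmE.
Qed.

Lemma linear_mpolyE (V : lmodType K) (phi : {linear Kxy -> V}) f :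
  phi f = \sum_(m <- msupp f) f@_m *: phi 'X_[m].
Proof.
by rewrite {1}[f]mpolyE linear_sum; apply: eq_bigr => m _; rewrite linearZ.
Qed.

Lemma linear_extension (V : lmodType K) (F : 'X_{1..2} -> V) :
  exists phi : {linear Kxy -> V}, forall m, phi 'X_[m] = F m.
Proof.
pose phi (f : Kxy) := \sum_(m <- msupp f) f@_m *: F m.
have phiE w f : (msize f <= w)%N ->
    phi f = \sum_(m : 'X_{1..2 < w}) f@_m *: F m.
  move=> le_w; pose I : subFinType _ := 'X_{1..2 < w}.
  rewrite /phi (ssrcomplements.big_mksub I) ?msupp_uniq //=; first last.
    by move=> x /msize_mdeg_lt /leq_trans; apply.
  rewrite big_rmcond //= => i.
  by move/memN_msupp_eq0 ->; rewrite scale0r.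
have lin : linear phi.
  move=> c f g; pose w := maxn (msize (c *: f + g)) (maxn (msize f) (msize g)).
  rewrite !(phiE w) ?leq_max ?leqnn ?orbT //.
  rewrite scaler_sumr -big_split; apply: eq_bigr => m _ /=.
  by rewrite mcoeffD mcoeffZ scalerDl scalerA.
pose phi' : {linear Kxy -> V} :=
  HB.pack phi (GRing.isLinear.Build K Kxy V _ phi lin).
exists phi' => m; rewrite [LHS]/= /phi msuppX big_seq1.
by rewrite mcoeffX eqxx scale1r.
Qed.

Lemma select_basis N (I : finType) (r : I -> 'rV[K]_N) :
  (forall i : 'I_N, exists c : I -> K, delta_mx 0 i = \sum_j c j *: r j) ->
  exists s : {ffun 'I_N -> I}, \det (\matrix_(i < N) r (s i)) != 0.
Proof.
move=> H; pose A := \matrix_(j < #|I|) r (enum_val j).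
have rA : row_full A.
  rewrite -sub1mx; apply/row_subP => i; have [c cE] := H i.
  rewrite row1 cE; apply: summx_sub => j _; apply: scalemx_sub.
  have -> : r j = row (enum_rank j) A by rewrite rowK enum_rankK.
  exact: row_sub.
exists [ffun i => enum_val (fullrankfun rA i)].
have := fullrowsub_full rA; rewrite row_full_unit unitmxE unitfE.
rewrite (_ : rowsub _ _ = \matrix_(i < N) r ([ffun i => enum_val (fullrankfun rA i)] i)) //.
by apply/matrixP => i j; rewrite !mxE ffunE.
Qed.

Section Quotient.
Variables (I : set Kxy) (N : nat) (phi : {linear Kxy -> 'rV[K]_N}).
Hypotheses (idI : is_ideal I) (qphi : quotient_map I phi).

Lemma quotient_mul g : exists X : 'M[K]_N, forall f, phi (g * f) = phi f *m X.
Proof.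
have [sphi kphi] := qphi; have [_ _ IM] := idI.
have /choice[r rE] := fun i : 'I_N => sphi (delta_mx 0 i).
exists (\matrix_(i < N) phi (g * r i)) => f.
pose f' := f - \sum_i phi f 0 i *: r i.
have /(IM g)/kphi : I f'.
  apply/kphi; rewrite /f' linearB linear_sum /=.
  under eq_bigr do rewrite linearZ /= rE.
  by rewrite -row_sum_delta subrr.
rewrite /f' mulrBr linearB /= => /eqP; rewrite subr_eq0 => /eqP ->.
rewrite mulr_sumr linear_sum mulmx_sum_row; apply: eq_bigr => i _.
by rewrite -scalerAr linearZ rowK.
Qed.

Lemma quotient_mulXn g X : (forall f, phi (g * f) = phi f *m X) ->
  forall a f, phi (g ^+ a * f) = phi f *m X ^+ a.
Proof.
move=> gX; elim=> [|a IH] f; first by rewrite !expr0 mul1r mulmx1.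
by rewrite exprS -mulrA gX IH exprSr mulmxA.
Qed.

End Quotient.

Lemma expmx_span n (A : 'M[K]_n.+1) a :
  exists c : 'I_n.+1 -> K, A ^+ a = \sum_i c i *: A ^+ i.
Proof.
pose p := char_poly A; pose q := 'X^a %% p.
have sq : (size q <= n.+1)%N.
  rewrite -ltnS -(size_char_poly A) ltn_modp monic_neq0 //.
  exact: char_poly_monic.
exists (fun i => q`_i).
have <- : horner_mx A q = A ^+ a.
  rewrite -{2}(horner_mx_X A) -rmorphXn [in RHS](divp_eq 'X^a p).
  by rewrite rmorphD rmorphM /= Cayley_Hamilton mulr0 add0r.
have qE : q = \sum_(i < n.+1) q`_i *: 'X^i.
  rewrite -poly_def; apply/polyP => i; rewrite coef_poly.
  by case: ltnP => // /(leq_trans sq) /leq_sizeP ->.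
rewrite [X in horner_mx _ X]qE rmorph_sum; apply: eq_bigr => i _ /=.
by rewrite horner_mxZ rmorphXn /= horner_mx_X.
Qed.

Definition lincomb N (I : finType) (r : I -> 'rV[K]_N) (v : 'rV[K]_N) :=
  exists c : I -> K, v = \sum_j c j *: r j.

Lemma lincomb_gen N (I : finType) (r : I -> 'rV[K]_N) j : lincomb r (r j).
Proof.
exists (fun i => (i == j)%:R); rewrite (bigD1 j) //= eqxx scale1r big1 ?addr0 //.
by move=> i /negbTE ->; rewrite scale0r.
Qed.

Lemma lincomb0 N (I : finType) (r : I -> 'rV[K]_N) : lincomb r 0.
Proof. by exists (fun _ => 0); rewrite big1 // => i _; rewrite scale0r. Qed.

Lemma lincombD N (I : finType) (r : I -> 'rV[K]_N) v w :
  lincomb r v -> lincomb r w -> lincomb r (v + w).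
Proof.
move=> [c ->] [d ->]; exists (fun i => c i + d i).
by rewrite -big_split; apply: eq_bigr => i _; rewrite scalerDl.
Qed.

Lemma lincombZ N (I : finType) (r : I -> 'rV[K]_N) a v :
  lincomb r v -> lincomb r (a *: v).
Proof.
move=> [c ->]; exists (fun i => a * c i).
by rewrite scaler_sumr; apply: eq_bigr => i _; rewrite scalerA.
Qed.

Lemma quotient_basis I N (phi : {linear Kxy -> 'rV[K]_N}) :
  is_ideal I -> quotient_map I phi -> exists u : {ffun 'I_N -> 'I_N * 'I_N},
  \det (\matrix_(i < N) phi (xy (u i).1 (u i).2)) != 0.
Proof.
case: N phi => [|N] phi idI qphi.
  by exists [ffun i => (i, i)]; rewrite det_mx00 oner_neq0.
have [X phiX] := quotient_mul idI qphi 'X_ord0.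
have [Y phiY] := quotient_mul idI qphi 'X_ord_max.
apply: (@select_basis _ _ (fun ab : 'I_N.+1 * 'I_N.+1 => phi (xy ab.1 ab.2))) => i.
have [f <-] := qphi.1 (delta_mx 0 i).
rewrite linear_mpolyE; apply: (big_ind (lincomb _)).
- exact: lincomb0.
- exact: lincombD.
move=> m _; apply: lincombZ; rewrite mpolyX_xy.
have phiE a b : phi (xy a b) = phi 1 *m Y ^+ b *m X ^+ a.
  by rewrite /xy (quotient_mulXn phiX) -[_ ^+ b]mulr1 (quotient_mulXn phiY).
rewrite phiE; have [c ->] := expmx_span X (m ord0).
have [d ->] := expmx_span Y (m ord_max).
rewrite mulmx_sumr; apply: (big_ind (lincomb _)) => [||a _].
- exact: lincomb0.
- exact: lincombD.
rewrite mulmx_sumr mulmx_suml; apply: (big_ind (lincomb _)) => [||b _].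
- exact: lincomb0.
- exact: lincombD.
rewrite -!scalemxAr -!scalemxAl; do 2!apply: lincombZ; rewrite -phiE.
exact: (@lincomb_gen _ _ (fun ab : 'I_N.+1 * 'I_N.+1 => phi (xy ab.1 ab.2)) (a, b)).
Qed.

Lemma row0_det N (A : 'M[K]_N) i : row i A = 0 -> \det A = 0.
Proof.
move=> A0; rewrite (expand_det_row A i) big1 // => j _.
by move/rowP/(_ j): A0; rewrite !mxE => ->; rewrite mul0r.
Qed.

Lemma spans_modP (S : set (nat * nat)) I N (phi : {linear Kxy -> 'rV[K]_N}) :
  is_ideal I -> quotient_map I phi ->
  spans_mod I (monomial_span S) <->
  exists w : 'I_N -> nat * nat, (forall i, S (w i)) /\
    \det (\matrix_(i < N) phi (xy (w i).1 (w i).2)) != 0.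
Proof.
move=> idI [sphi kphi]; split=> [SI|[w [Sw dw]] f].
  have /choice[h hP] (i : 'I_N) :
      exists h, monomial_span S h /\ phi h = delta_mx 0 i.
    have [f fE] := sphi (delta_mx 0 i); have [g [h [/kphi g0 Vh E]]] := SI f.
    by exists h; split=> //; rewrite -fE E linearD /= g0 add0r.
  pose d := \max_(i < N) msize (h i).
  pose r (m : 'X_{1..2 < d}) : 'rV_N :=
    if `[< S ((m : 'X_{1..2}) ord0, (m : 'X_{1..2}) ord_max) >]
    then phi 'X_[m] else 0.
  have [i|s ds] := @select_basis _ _ r.
    have [Sh <-] := hP i; rewrite linear_mpolyE big_seq.
    apply: (big_ind (lincomb r)); [exact: lincomb0|exact: lincombD|].
    move=> m mh; apply: lincombZ.
    have md : (mdeg m < d)%N.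
      by apply: leq_trans (msize_mdeg_lt mh) _; apply: leq_bigmax.
    have -> : phi 'X_[m] = r (BMultinom md).
      by rewrite /r /=; case: asboolP => // -[]; exact: Sh.
    exact: lincomb_gen.
  have sS i : S ((s i : 'X_{1..2}) ord0, (s i : 'X_{1..2}) ord_max).
    apply: contrapT => nS; move/eqP: ds; apply.
    apply: (@row0_det _ _ i); rewrite rowK /r.
    by case: asboolP.
  exists (fun i => ((s i : 'X_{1..2}) ord0, (s i : 'X_{1..2}) ord_max)).
  split=> //; rewrite (_ : \matrix_i _ = \matrix_(i < N) r (s i)) //.
  apply/row_matrixP => i; rewrite !rowK /r /= -mpolyX_xy.
  by case: asboolP => // -[].
set A := \matrix_i _ in dw.
have uA : A \in unitmx by rewrite unitmxE unitfE.
pose c := phi f *m invmx A.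
pose h : Kxy := \sum_i c 0 i *: xy (w i).1 (w i).2.
exists (f - h), h; split; last by rewrite subrK.
  apply/kphi; rewrite linearB linear_sum /= -[phi f](mulmxKV uA) -/c.
  rewrite mulmx_sum_row -sumrB big1 // => i _.
  by rewrite linearZ rowK subrr.
move=> m; rewrite mcoeff_msupp => hm; apply: contrapT => nS.
move/eqP: hm; apply; rewrite raddf_sum big1 //= => i _.
have [m' [m0 m1 ->]] := xy_mpolyX (w i).1 (w i).2.
rewrite mcoeffZ mcoeffX; case: eqP => [E|]; last by rewrite mulr0.
by case: nS; rewrite -E m0 m1 -surjective_pairing.
Qed.

Lemma normalize_quotient I N (phi : {linear Kxy -> 'rV[K]_N}) (w : 'I_N -> Kxy) :
  let A := \matrix_(i < N) phi (w i) in
  quotient_map I phi -> \det A != 0 ->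
  exists phi' : {linear Kxy -> 'rV[K]_N},
    [/\ quotient_map I phi', forall i, phi' (w i) = delta_mx 0 i &
        pluecker phi' = (\det A)^-1 *: pluecker phi].
Proof.
move=> A [sphi kphi] dA; have uA : A \in unitmx by rewrite unitmxE unitfE.
pose phi' : {linear Kxy -> 'rV[K]_N} := (mulmxr (invmx A) \o phi).
exists phi'; split.
- split=> [v|f].
    by have [f fE] := sphi (v *m A); exists f; rewrite /= fE mulmxK.
  rewrite kphi /=; split=> [->|E]; first by rewrite mul0mx.
  by rewrite -[phi f](mulmxKV uA) E mul0mx.
- move=> i /=; have -> : phi (w i) = row i A by rewrite rowK.
  by rewrite -row_mul mulmxV // row1.
apply/rowP => e; rewrite !mxE mulrC -det_inv -det_mulmx; congr (\det _).
by apply/row_matrixP => i; rewrite row_mul !rowK.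
Qed.

Definition set_mono N (t : mono_tuple N) i (m : 'I_N.+1 * 'I_N.+1) :
  mono_tuple N := [ffun j => if j == i then m else t j].

Lemma pluecker_set N (phi : {linear Kxy -> 'rV[K]_N}) (t : mono_tuple N) i m :
  (forall i, phi (xy (t i).1 (t i).2) = delta_mx 0 i) ->
  pluecker phi 0 (enum_rank (set_mono t i m)) = phi (xy m.1 m.2) 0 i.
Proof.
move=> tE; rewrite mxE enum_rankK; set A := \matrix_j _.
have AE j : row j A = if j == i then phi (xy m.1 m.2) else delta_mx 0 j.
  by rewrite rowK ffunE; case: eqP.
rewrite (expand_det_row A i) (bigD1 i) //=.
have cE j : cofactor A i j = (i == j)%:R.
  have -> : cofactor A i j = cofactor 1%:M i j.
    rewrite /cofactor; congr (_ * \det _); apply/matrixP => a b; rewrite !mxE.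
    have /rowP/(_ (fintype.lift j b)) := AE (fintype.lift i a).
    by rewrite eq_sym (negbTE (neq_lift _ _)) !mxE eqxx /= [_ == fintype.lift i a]eq_sym.
  have := congr1 (fun M : 'M[K]_N => M j i) (adj1 K N).
  by rewrite !mxE eq_sym.
rewrite big1 => [|j ji]; last by rewrite cE eq_sym (negbTE ji) mulr0.
rewrite cE eqxx mulr1 addr0; have /rowP/(_ i) := AE i.
by rewrite eqxx mxE.
Qed.

Lemma polyfun_mulmx n p q r (A : 'rV[K]_n -> 'M[K]_(p, q))
    (B : 'rV[K]_n -> 'M[K]_(q, r)) :
  (forall i j, polyfun (fun z => A z i j)) ->
  (forall i j, polyfun (fun z => B z i j)) ->
  forall i j, polyfun (fun z => (A z *m B z) i j).
Proof.
move=> pA pB i j.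
apply: (@polyfun_ext _ _ (fun z => \sum_k A z i k * B z k j)).
  by move=> z; rewrite mxE.
by apply: polyfun_sum => k; apply: polyfunM.
Qed.

Lemma polyfun_expmx n N (A : 'rV[K]_n -> 'M[K]_N) a :
  (forall i j, polyfun (fun z => A z i j)) ->
  forall i j, polyfun (fun z => (A z ^+ a) i j).
Proof.
move=> pA; elim: a => [|a IH] i j; first exact: polyfunC.
apply: (@polyfun_ext _ _ (fun z => (A z *m A z ^+ a) i j)).
  by move=> z; rewrite exprS.
exact: polyfun_mulmx.
Qed.

(* In the chart given by a tuple [t] of monomials with exponents smaller than N,
   the multiplication operators and the normalized quotient map are polynomial
   in the coordinates [z]. *)
Section Chart.
Variables (N : nat) (t : mono_tuple N).

Definition chart_row (z : 'rV[K]_#|{: mono_tuple N}|) m : 'rV[K]_N :=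
  \row_i z 0 (enum_rank (set_mono t i m)).

Definition chart_x z : 'M[K]_N :=
  \matrix_(i < N) chart_row z (inord (t i).1.+1, (t i).2).

Definition chart_y z : 'M[K]_N :=
  \matrix_(i < N) chart_row z ((t i).1, inord (t i).2.+1).

Definition chart_quotient z a b : 'rV[K]_N :=
  chart_row z (ord0, ord0) *m chart_y z ^+ b *m chart_x z ^+ a.

Lemma polyfun_chart_row m i j : polyfun (fun z => chart_row z m i j).
Proof.
apply: (@polyfun_ext _ _ (fun z => z 0 (enum_rank (set_mono t j m)))).
  by move=> z; rewrite mxE.
exact: polyfunX.
Qed.

Lemma polyfun_chart_x i j : polyfun (fun z => chart_x z i j).
Proof.
apply: (polyfun_ext _ (polyfun_chart_row (inord (t i).1.+1, (t i).2) 0 j)).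
by move=> z; rewrite /chart_x !mxE.
Qed.

Lemma polyfun_chart_y i j : polyfun (fun z => chart_y z i j).
Proof.
apply: (polyfun_ext _ (polyfun_chart_row ((t i).1, inord (t i).2.+1) 0 j)).
by move=> z; rewrite /chart_y !mxE.
Qed.

Lemma polyfun_chart_quotient a b i j :
  polyfun (fun z => chart_quotient z a b i j).
Proof.
apply: polyfun_mulmx; last exact: polyfun_expmx polyfun_chart_x.
apply: polyfun_mulmx; first exact: polyfun_chart_row.
exact: polyfun_expmx polyfun_chart_y.
Qed.

Hypothesis t_lt : forall i, ((t i).1 < N)%N && ((t i).2 < N)%N.

Lemma chart_pluecker I (phi : {linear Kxy -> 'rV[K]_N}) :
  is_ideal I -> quotient_map I phi ->
  (forall i, phi (xy (t i).1 (t i).2) = delta_mx 0 i) ->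
  let z := pluecker phi in
  [/\ forall f, phi ('X_ord0 * f) = phi f *m chart_x z,
      forall f, phi ('X_ord_max * f) = phi f *m chart_y z &
      forall a b, phi (xy a b) = chart_quotient z a b].
Proof.
move=> idI qphi tE z.
have rE m : chart_row z m = phi (xy m.1 m.2).
  by apply/rowP => i; rewrite mxE pluecker_set.
have phix f : phi ('X_ord0 * f) = phi f *m chart_x z.
  have [X phiX] := quotient_mul idI qphi 'X_ord0.
  rewrite phiX; congr (_ *m _); apply/row_matrixP => i.
  have /andP[t1 _] := t_lt i.
  rewrite rowK rE /= inordK // rowE -tE -phiX.
  by rewrite /xy exprS mulrA.
have phiy f : phi ('X_ord_max * f) = phi f *m chart_y z.
  have [Y phiY] := quotient_mul idI qphi 'X_ord_max.
  rewrite phiY; congr (_ *m _); apply/row_matrixP => i.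
  have /andP[_ t2] := t_lt i.
  rewrite rowK rE /= inordK // rowE -tE -phiY.
  by rewrite /xy exprS mulrCA.
split=> // a b; rewrite /xy (quotient_mulXn phix) -[_ ^+ b]mulr1.
by rewrite (quotient_mulXn phiy) /chart_quotient rE /= /xy !expr0 mulr1.
Qed.

Lemma hilb_locus_chart P z :
  hilb_locus P z -> z 0 (enum_rank t) = 1 ->
  exists (I : set Kxy) (phi : {linear Kxy -> 'rV[K]_N}),
    [/\ is_ideal I, quotient_map I phi, P I, z = pluecker phi &
        forall i, phi (xy (t i).1 (t i).2) = delta_mx 0 i].
Proof.
move=> [I [phi [c [idI qphi PI c0 ->]]]].
rewrite !mxE enum_rankK; set A := \matrix_i _ => cA.
have dA : \det A != 0.
  by apply: contra_eq_neq cA => ->; rewrite mulr0 eq_sym oner_neq0.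
have [phi' [qphi' tE pE]] :=
  @normalize_quotient I N phi (fun i => xy (t i).1 (t i).2) qphi dA.
exists I, phi'; split=> //; rewrite pE; congr (_ *: _).
by apply: (mulIf dA); rewrite cA mulVf.
Qed.

End Chart.

(* Distinct ideals have distinct images. *)
Lemma pluecker_inj N I J (phi psi : {linear Kxy -> 'rV[K]_N}) c :
  is_ideal I -> is_ideal J -> quotient_map I phi -> quotient_map J psi ->
  c != 0 -> pluecker psi = c *: pluecker phi -> I = J.
Proof.
move=> idI idJ qphi qpsi c0 E; have [u du] := quotient_basis idI qphi.
pose t : mono_tuple N := [ffun i => (inord (u i).1, inord (u i).2)].
have tE i : ((t i).1 = (u i).1 :> nat) * ((t i).2 = (u i).2 :> nat).
  by rewrite ffunE /= !inordK // ltnW // ltnS.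
have t_lt i : ((t i).1 < N)%N && ((t i).2 < N)%N by rewrite !tE !ltn_ord.
pose d := pluecker phi 0 (enum_rank t).
have d0 : d != 0.
  rewrite /d mxE enum_rankK; apply: contra_neq du => <-.
  by congr (\det _); apply/row_matrixP => i; rewrite !rowK /= !tE.
pose z := d^-1 *: pluecker phi.
have z1 : z 0 (enum_rank t) = 1 by rewrite mxE mulVf.
have zI : hilb_locus [set I] z.
  by exists I, phi, d^-1; split=> //; rewrite invr_eq0.
have zJ : hilb_locus [set J] z.
  exists J, psi, (d^-1 / c); split=> //.
    by rewrite mulf_neq0 ?invr_eq0.
  by rewrite E scalerA divfK.
have [I' [phi' [idI' qphi' /= EI zE tphi]]] := hilb_locus_chart zI z1.
have [J' [psi' [idJ' qpsi' /= EJ zE' tpsi]]] := hilb_locus_chart zJ z1.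
rewrite -EI -EJ.
have [_ _ phiE] := chart_pluecker t_lt idI' qphi' tphi.
have [_ _ psiE] := chart_pluecker t_lt idJ' qpsi' tpsi.
apply/seteqP; split=> f; rewrite qphi'.2 qpsi'.2 => <-;
  rewrite !linear_mpolyE; apply: eq_bigr => m _;
  by rewrite mpolyX_xy phiE psiE -zE -zE'.
Qed.

Lemma hilb_locus_lc N (S : set (nat * nat)) :
  locally_closed (@hilb_locus N (fun I => spans_mod I (monomial_span S))).
Proof.
set A := hilb_locus _.
pose J := [set e : 'I_#|{: mono_tuple N}| | forall i,
  (((enum_val e : mono_tuple N) i).1 < N)%N &&
  (((enum_val e : mono_tuple N) i).2 < N)%N].
have AJ z : A z -> exists2 e, J e & z 0 e != 0.
  move=> [I [phi [c [idI qphi _ c0 ->]]]].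
  have [u du] := quotient_basis idI qphi.
  pose t : mono_tuple N := [ffun i => (inord (u i).1, inord (u i).2)].
  have tE i : ((t i).1 = (u i).1 :> nat) * ((t i).2 = (u i).2 :> nat).
    by rewrite ffunE /= !inordK // ltnW // ltnS.
  exists (enum_rank t); first by move=> i; rewrite enum_rankK !tE !ltn_ord.
  rewrite !mxE enum_rankK mulf_neq0 //; apply: contra_neq du => <-.
  by congr (\det _); apply/row_matrixP => i; rewrite !rowK /= !tE.
apply: (@lc_chart _ _ A J) => //.
- move=> z /AJ[e _ ze]; apply/rV0Pn; by exists e.
- move=> _ a a0 [I [phi [c [idI qphi PI c0 ->]]]].
  by exists I, phi, (a * c); split=> //; rewrite ?mulf_neq0 ?scalerA.
move=> e Je; pose t : mono_tuple N := enum_val e.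
have et : e = enum_rank t by rewrite enum_valK.
have t_lt i : ((t i).1 < N)%N && ((t i).2 < N)%N := Je i.
exists [set f | polyfun f /\ forall z, A z -> z 0 e = 1 -> f z = 0].
exists [set f | exists w : 'I_N -> nat * nat, (forall i, S (w i)) /\
  f = fun z => \det (\matrix_(i < N) chart_quotient t z (w i).1 (w i).2)].
split.
  move=> f [[]//|[w [_ ->]]]; apply: polyfun_det => i j.
  apply: (polyfun_ext _ (polyfun_chart_quotient t (w i).1 (w i).2 0 j)).
  by move=> z; rewrite !mxE.
move=> z ze; split=> [Az|[Fz [_ [w [Sw ->]] dw]]].
  split=> [f [_ fA]|]; first exact: fA.
  rewrite et in ze; have [I [phi [idI qphi PI zE tE]]] := hilb_locus_chart Az ze.
  have [_ _ phiE] := chart_pluecker t_lt idI qphi tE.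
  have /(spans_modP S idI qphi)[w [Sw dw]] := PI.
  exists (fun z => \det (\matrix_(i < N) chart_quotient t z (w i).1 (w i).2)).
    by exists w.
  apply: contra_neq dw => <-; congr (\det _); apply/row_matrixP => i.
  by rewrite !rowK phiE -zE.
have zid f : polyfun f -> (forall I (phi : {linear Kxy -> 'rV[K]_N}),
    let z := pluecker phi in
    is_ideal I -> quotient_map I phi ->
    (forall i, phi (xy (t i).1 (t i).2) = delta_mx 0 i) ->
    (forall f, phi ('X_ord0 * f) = phi f *m chart_x t z) ->
    (forall f, phi ('X_ord_max * f) = phi f *m chart_y t z) ->
    (forall a b, phi (xy a b) = chart_quotient t z a b) -> f z = 0) -> f z = 0.
  move=> pf fA; apply: Fz; split=> // {ze dw} z Az ze; rewrite et in ze.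
  have [I [phi [idI qphi PI -> tE]]] := hilb_locus_chart Az ze.
  by have [? ? ?] := chart_pluecker t_lt idI qphi tE; apply: (fA I).
have quotE i : chart_quotient t z (t i).1 (t i).2 = delta_mx 0 i.
  apply/rowP => j; apply/eqP; rewrite -subr_eq0; apply/eqP.
  apply: (zid (fun z => chart_quotient t z (t i).1 (t i).2 0 j
                        - (delta_mx 0 i : 'rV[K]_N) 0 j)).
    by apply: polyfunB; [exact: polyfun_chart_quotient|exact: polyfunC].
  by move=> I phi z' _ _ tE _ _ phiE; rewrite -phiE tE subrr.
have pluE (e' : 'I_#|{: mono_tuple N}|) : z 0 e' = \det (\matrix_(i < N)
    chart_quotient t z ((enum_val e' : mono_tuple N) i).1
                       ((enum_val e' : mono_tuple N) i).2).
  apply/eqP; rewrite -subr_eq0; apply/eqP.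
  apply: (zid (fun z => z 0 e' - \det (\matrix_(i < N)
    chart_quotient t z ((enum_val e' : mono_tuple N) i).1
                       ((enum_val e' : mono_tuple N) i).2))).
    apply: polyfunB; first exact: polyfunX.
    apply: polyfun_det => i j; apply: (polyfun_ext _
      (polyfun_chart_quotient t ((enum_val e' : mono_tuple N) i).1
                              ((enum_val e' : mono_tuple N) i).2 0 j)).
    by move=> z'; rewrite !mxE.
  move=> I phi z' _ _ _ _ _ phiE; apply/eqP; rewrite subr_eq0 mxE.
  by apply/eqP; congr (\det _); apply/row_matrixP => i; rewrite !rowK /= phiE.
have xyC : chart_x t z *m chart_y t z = chart_y t z *m chart_x t z.
  apply/matrixP => i j; apply/eqP; rewrite -subr_eq0; apply/eqP.
  apply: (zid (fun z => (chart_x t z *m chart_y t z) i j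
                        - (chart_y t z *m chart_x t z) i j)).
    by apply: polyfunB; apply: polyfun_mulmx;
      by [exact: polyfun_chart_x|exact: polyfun_chart_y].
  move=> I phi z' _ _ tE phix phiy _; apply/eqP; rewrite subr_eq0; apply/eqP.
  suff : row i (chart_x t z' *m chart_y t z')
       = row i (chart_y t z' *m chart_x t z') by move/rowP/(_ j); rewrite !mxE.
  by rewrite !rowE !mulmxA -tE -!phix -!phiy -!phix mulrCA.
have [phi phiX] := linear_extension
  (fun m : 'X_{1..2} => chart_quotient t z (m ord0) (m ord_max)).
have phiE a b : phi (xy a b) = chart_quotient t z a b.
  by have [m [m0 m1 ->]] := xy_mpolyX a b; rewrite phiX m0 m1.
have commXY a b : chart_y t z ^+ b *m chart_x t z ^+ a
                  = chart_x t z ^+ a *m chart_y t z ^+ b.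
  have : GRing.comm (chart_x t z) (chart_y t z) by rewrite /GRing.comm; exact: xyC.
  move=> cxy; apply: esym; exact: (commrX b (commr_sym (commrX a (commr_sym cxy)))).
have ext (g : Kxy) (Z : 'M[K]_N) :
    (forall a b, phi (g * xy a b) = phi (xy a b) *m Z) ->
    forall f, phi (g * f) = phi f *m Z.
  move=> H f; rewrite {1}[f]mpolyE mulr_sumr linear_sum linear_mpolyE mulmx_suml.
  apply: eq_bigr => m _; rewrite /= -scalerAr linearZ /= -scalemxAl.
  by rewrite mpolyX_xy H.
have phix : forall f, phi ('X_ord0 * f) = phi f *m chart_x t z.
  apply: ext => a b; have -> : 'X_ord0 * xy a b = xy a.+1 b.
    by rewrite /xy exprS mulrA.
  by rewrite !phiE /chart_quotient exprSr mulmxA.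
have phiy : forall f, phi ('X_ord_max * f) = phi f *m chart_y t z.
  apply: ext => a b; have -> : 'X_ord_max * xy a b = xy a b.+1.
    by rewrite /xy exprS mulrCA.
  rewrite !phiE /chart_quotient exprSr mulmxA -!mulmxA; congr (_ *m (_ *m _)).
  by have := commXY a 1%N; rewrite !expr1.
have gen (Q : Kxy -> Prop) : Q 1 -> (forall f, Q f -> Q ('X_ord0 * f)) ->
    (forall f, Q f -> Q ('X_ord_max * f)) ->
    (forall f g, Q f -> Q g -> Q (f + g)) -> (forall c f, Q f -> Q (c *: f)) ->
    forall f, Q f.
  move=> Q1 Qx Qy QD QZ f; rewrite [f]mpolyE; apply: big_ind => //.
    by rewrite -(scale0r 1); apply: QZ.
  move=> m _; apply: QZ; rewrite mpolyX_xy /xy.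
  elim: (m ord0) => [|a IH]; last by rewrite exprS -mulrA; apply: Qx.
  rewrite mul1r; elim: (m ord_max) => [|b IH]; first by rewrite expr0.
  by rewrite exprS; apply: Qy.
pose I : set Kxy := [set f | phi f = 0].
have idI : is_ideal I.
  split=> [|f g If Ig|f g Ig]; rewrite /I /=.
  - exact: linear0.
  - by rewrite linearD If Ig addr0.
  elim/gen: f => [|f If|f If|f f' If If'|c f If].
  - by rewrite mul1r.
  - by rewrite -mulrA phix If mul0mx.
  - by rewrite -mulrA phiy If mul0mx.
  - by rewrite mulrDl linearD /= If If' addr0.
  - by rewrite -scalerAl linearZ /= If scaler0.
have qphi : quotient_map I phi.
  split=> // v; exists (\sum_i v 0 i *: xy (t i).1 (t i).2).
  rewrite linear_sum [RHS]row_sum_delta; apply: eq_bigr => i _.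
  by rewrite linearZ /= phiE quotE.
exists I, phi, 1; split=> //; first 1 last.
- exact: oner_neq0.
- rewrite scale1r; apply/rowP => e'; rewrite pluE mxE; congr (\det _).
  by apply/row_matrixP => i; rewrite !rowK /= phiE.
apply/(spans_modP S idI qphi); exists w; split=> //.
by apply: contra_neq dw => <-; congr (\det _); apply/row_matrixP => i;
  rewrite !rowK /= phiE.
Qed.

End HilbertScheme.

Section AffineLine.
Variable K : closedFieldType.

Fact affine_line_lc : locally_closed [set v : 'rV[K]_2 | v 0 0 != 0].
Proof.
exists set0, [set 'X_0]; split=> [p [//|->]|v].
  by exists 1%N; rewrite dhomogX /= mdeg1.
split=> [v0|[_ _ [_ -> ]]]; last by rewrite mevalXU.
split=> //; first by apply/rV0Pn; exists 0.
by exists 'X_0 => //; rewrite mevalXU.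
Qed.

(* A^1, as the complement of a point in P^1. *)
Definition affine_line := Variety affine_line_lc.

Definition LL : K0 K := class affine_line.

End AffineLine.

(* The inequality is i + k j <= k n - k - 1 over the integers. *)
Definition Vkn_monomials k n : set (nat * nat) :=
  [set ij | (ij.1 + k * ij.2 + k + 1 <= k * n)%N].

Definition hilb_kn (K : closedFieldType) k n N : variety K :=
  Variety (@hilb_locus_lc K N (Vkn_monomials k n)).

Local Open Scope nat_scope.

Section DyckPaths.
Variables k n : nat.

(* Lattice paths from (0,0) with kn + n steps: [true] is the step (0,1) and
   [false] is the step (1,0); [xpos pi m] and [ypos pi m] are the coordinates of
   the point reached after m steps. *)
Implicit Types pi : (k * n + n).-tuple bool.

Definition xpos pi m := count_mem false (take m pi).
Definition ypos pi m := count_mem true (take m pi).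

Definition dyck_paths : {set (k * n + n).-tuple bool} :=
  [set pi | [&& xpos pi (k * n + n) == k * n, ypos pi (k * n + n) == n &
             [forall m : 'I_(k * n + n).+1, xpos pi m <= k * ypos pi m]]].

(* (i, j) stands for the unit square [i, i+1] x [j, j+1]; it lies above (below)
   [pi] if the horizontal step of [pi] from x = i to x = i + 1 has height at most j
   (at least j + 1). *)
Definition sq_above pi i j :=
  [exists m : 'I_(k * n + n),
     [&& ~~ tnth pi m, xpos pi m == i & ypos pi m <= j]].
Definition sq_below pi i j :=
  [exists m : 'I_(k * n + n),
     [&& ~~ tnth pi m, xpos pi m == i & j.+1 <= ypos pi m]].

(* The reflection of D'_pi in a horizontal line; (c, r) is the box in column c and
   row r, rows being numbered from the bottom. *)
Definition dyck_diagram pi : {set 'I_(k * n) * 'I_n} :=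
  [set s : 'I_(k * n) * 'I_n | sq_above pi s.1 (rev_ord s.2)].

Definition arm (D : {set 'I_(k * n) * 'I_n}) (s : 'I_(k * n) * 'I_n) :=
  #|[set u in D | (u.1 == s.1) && (s.2 < u.2)]|.
Definition leg (D : {set 'I_(k * n) * 'I_n}) (s : 'I_(k * n) * 'I_n) :=
  #|[set u in D | (u.2 == s.2) && (s.1 < u.1)]|.

Definition bstat pi :=
  let D := dyck_diagram pi in
  #|[set s in D | k * arm D s <= leg D s <= k * (arm D s + 1)]|.

(* The square (i, j) lies above the line x = k y iff its bottom right corner does. *)
Definition area pi :=
  #|[set s : 'I_(k * n) * 'I_n | sq_below pi s.1 s.2 && (s.1.+1 <= k * s.2)]|.

End DyckPaths.

Local Open Scope ring_scope.

(* Power series in t with coefficients in K_0 are represented by their sequences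
   of coefficients; this is the series (L t)^m. *)
Definition Lt_pow (K : closedFieldType) (m : nat) : nat -> K0 K :=
  fun N => if N == m then LL K ^+ m else 0.

(* (L t)^(kn(n-1)/2) C_n^(k)(L, L^-1 t^-1) after cancelling powers of L t.  The
   subtraction is exact, because area pi <= kn(n-1)/2. *)
Definition catalan_series (K : closedFieldType) k n : nat -> K0 K :=
  fun N => \sum_(pi in dyck_paths k n)
    LL K ^+ bstat pi * Lt_pow K ((k * n * (n - 1)) %/ 2 - area pi) N.

(* Main.v *)
From HB Require Import structures.
Require Import Defs.
From mathcomp Require Import all_boot all_order all_algebra.
From mathcomp Require Import perm mpoly boolp classical_sets.
From mathcomp Require Import zify ring.

(* Order the monomials x^i y^j by i + kj, then by j.  The span V_(k,n) is an initial
   segment of this order, so I + V_(k,n) = C[x,y] holds iff the standard monomials of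
   I, which form a Young diagram D, all lie in V_(k,n).  Hence the open set is the
   disjoint union of the Groebner strata of the diagrams D in V_(k,n), and these are
   the diagrams of k-Dyck paths; the union is filtered by the total weight of D, each
   stratum being the nonvanishing locus of one Pluecker coordinate in what remains.

   The stratum of D is an affine space.  In the basis of monomials of D, an ideal is
   a pair of multiplication matrices X, Y that differ from those of the monomial
   ideal by entries of positive degree, subject to [X, Y] = 0.  The equation is
   relaxed to [X, Y] + j 1 = 0 with an extra covector j, which is forced to vanish by
   a trace argument in characteristic zero.  The relaxed system has a surjective
   linear part, so it is solved degree by degree and its solutions form an affine
   space whose dimension is the number of unknowns minus the number of equations.
   That number telescopes along the rows of D to |D| + b_k. *)

Set Implicit Arguments.
Unset Strict Implicit.
Unset Printing Implicit Defensive.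
Import GRing.Theory Num.Theory.
Local Open Scope ring_scope.
Local Open Scope classical_set_scope.

(** * Varieties contained in an affine chart *)

Section AffineSpace.
Variable K : closedFieldType.

(** The obstacle is a redundancy in [X, Y] = 0. The trace of a commutator is identically 0, so for N
    > 0 the diagonal equations are dependent, the linear part is not onto, and elimination by degree
    cannot start. The extra term is the one in the ADHM equation, with the class of 1 as cyclic
    vector: it supplies the missing directions, and cyclicity turns the vanishing of all words v Y^b
    X^a w into w = 0. The N entries of this covector are also the origin of the summand |D| in the
    dimension. Monomials get numerical weights and not only an order, because the same numbers have
    to grade the unknowns and equations of the elimination and to sort the diagrams in the
    filtration. The Hilbert scheme is given by its points, as a reduced variety. An isomorphism with
    affine space therefore amounts to polynomial maps that are mutually inverse on points; this is
    why multiplication matrices are read off Pluecker coordinates and Pluecker coordinates are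
    written as minors in the matrices. *)

Lemma eq_class_vset n (A B : set 'rV[K]_n) (lcA : locally_closed A)
    (lcB : locally_closed B) :
  A = B -> class (Variety lcA) = class (Variety lcB).
Proof.
by move=> E; subst B; rewrite (Prop_irrelevance lcA lcB).
Qed.

(** The scissor relation for the empty set inside itself reads c = c + c. *)
Lemma class_set0 n (lc0 : locally_closed (set0 : set 'rV[K]_n)) :
  class (Variety lc0) = 0.
Proof.
have lc0' : locally_closed (set0 `\` (set0 : set 'rV[K]_n)) by rewrite setDv.
have := @class_scissor K n set0 set0 lc0 lc0 lc0'.
rewrite (@eq_class_vset _ _ set0 lc0' lc0) ?setDv // => H.
have /H/eqP : closed_in (set0 : set 'rV[K]_n) set0.
  by exists set0; split=> // v; split=> // -[].
by rewrite -subr_eq0 opprD addrA subrr add0r oppr_eq0 => /eqP.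
Qed.

(** Inside one affine chart the maps need not be homogeneous: rescaling a representative to
    [v 0 e = 1] before applying [F] makes any polynomial map well defined on projective points. *)
Lemma isomorphic_chart (X Y : variety K) (e : 'I_(vdim X)) (e' : 'I_(vdim Y))
    (F : 'rV[K]_(vdim X) -> 'rV[K]_(vdim Y))
    (G : 'rV[K]_(vdim Y) -> 'rV[K]_(vdim X)) :
  (forall v, vset v -> v 0 e != 0) -> (forall w, vset w -> w 0 e' != 0) ->
  (forall i, polyfun (fun v => F v 0 i)) ->
  (forall i, polyfun (fun w => G w 0 i)) ->
  (forall v, vset v -> v 0 e = 1 -> [/\ vset (F v), F v 0 e' = 1 & G (F v) = v]) ->
  (forall w, vset w -> w 0 e' = 1 -> [/\ vset (G w), G w 0 e = 1 & F (G w) = w]) ->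
  isomorphic X Y.
Proof.
have reg (X1 Y1 : variety K) (e1 : 'I_(vdim X1)) (F1 : 'rV_(vdim X1) -> 'rV_(vdim Y1)) :
    (forall v, vset v -> v 0 e1 != 0) -> (forall i, polyfun (fun v => F1 v 0 i)) ->
    (forall v, vset v -> v 0 e1 = 1 -> vset (F1 v)) ->
    regular (@vset _ X1) (@vset _ Y1) (fun v => F1 ((v 0 e1)^-1 *: v)).
  move=> e10 pF F1B; apply: regular_chart; [exact: vset_lc|exact: vset_lc|].
  move=> v Xv; exists e1, (fun=> 1), (fun i v => F1 v 0 i); split => //.
  - exact: polyfunC.
  - exact: e10.
  - exact: oner_neq0.
  move=> w Xw w0 w' _; rewrite {}/w'.
  have -> : \row_i F1 ((w 0 e1)^-1 *: w) 0 i = F1 ((w 0 e1)^-1 *: w).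
    by apply/rowP => i; rewrite mxE.
  split; last exact: proj_eq_refl.
  apply: F1B; last by rewrite mxE mulVf.
  by apply: lc_scale (vset_lc X1) _ Xw; rewrite invr_eq0.
move=> Xe Ye pF pG FP GP.
exists (fun v : 'rV_(vdim X) => F ((v 0 e)^-1 *: v)),
  (fun w : 'rV_(vdim Y) => G ((w 0 e')^-1 *: w)).
split.
- by apply: reg => // v Xv v1; case: (FP v Xv v1).
- by apply: reg => // v Xv v1; case: (GP v Xv v1).
- move=> v Xv; have v0 := Xe v Xv.
  have [||_ E1 E2] := FP ((v 0 e)^-1 *: v); last first.
  + by rewrite E1 invr1 scale1r E2; apply: proj_eqZ; rewrite invr_eq0.
  + by rewrite mxE mulVf.
  + by apply: lc_scale (vset_lc X) _ Xv; rewrite invr_eq0.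
- move=> v Xv; have v0 := Ye v Xv.
  have [||_ E1 E2] := GP ((v 0 e')^-1 *: v); last first.
  + by rewrite E1 invr1 scale1r E2; apply: proj_eqZ; rewrite invr_eq0.
  + by rewrite mxE mulVf.
  + by apply: lc_scale (vset_lc Y) _ Xv; rewrite invr_eq0.
Qed.

Fact affine_space_lc d : locally_closed [set v : 'rV[K]_d.+1 | v 0 0 != 0].
Proof.
exists set0, [set 'X_0]; split=> [p [//|->]|v].
  by exists 1%N; rewrite dhomogX /= mdeg1.
split=> [v0|[_ _ [_ -> ]]]; last by rewrite mevalXU.
split=> //; first by apply/rV0Pn; exists 0.
by exists 'X_0 => //; rewrite mevalXU.
Qed.

Definition affine_space d := Variety (affine_space_lc d).

Lemma class_affine_space d : class (affine_space d) = LL K ^+ d.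
Proof.
elim: d => [|d IH].
  rewrite expr0 [RHS](_ : _ = class (pointv K)) //; apply: eq_class_vset.
  apply/seteqP; split=> v /=; last by move=> /rV0Pn[i]; rewrite ord1.
  by move=> v0; apply/rV0Pn; exists 0.
rewrite exprSr -IH /LL -classM; apply: class_isomorphic.
apply: isomorphic_sym.
(* On the slice v_0 w_0 = 1 the product has affine coordinates v_i w_0 and v_0 w_1, which are
   entries of the Segre matrix: its column 0 and its entry (0, 1). *)
pose F (z : 'rV[K]_(d.+1 * 2)) : 'rV[K]_d.+2 := \row_i
  if unlift ord_max i is Some j then z 0 (mxvec_index j 0)
  else z 0 (mxvec_index 0 1).
pose V (v : 'rV[K]_d.+2) : 'rV[K]_d.+1 := \row_i v 0 (fintype.lift ord_max i).
pose W (v : 'rV[K]_d.+2) : 'rV[K]_2 := \row_i if i == 0 then v 0 0 else v 0 ord_max.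
pose G v := segre (V v) (W v).
have u0 : unlift ord_max (0 : 'I_d.+2) = Some (0 : 'I_d.+1).
  have -> : (0 : 'I_d.+2) = fintype.lift ord_max (0 : 'I_d.+1) by apply: val_inj.
  exact: liftK.
have l0 : fintype.lift ord_max (0 : 'I_d.+1) = 0 :> 'I_d.+2 by apply: val_inj.
apply: (@isomorphic_chart (prodv (affine_space d) (affine_line K))
  (affine_space d.+1) (mxvec_index 0 0) 0 F G).
- by move=> _ [v [w [v0 w0 ->]]]; rewrite segreE mulf_neq0.
- by [].
- move=> i; rewrite /F; case E: (unlift ord_max i) => [j|].
    apply: (@polyfun_ext _ _ (fun z => z 0 (mxvec_index j 0))); last exact: polyfunX.
    by move=> z; rewrite mxE E.
  apply: (@polyfun_ext _ _ (fun z => z 0 (mxvec_index 0 1))); last exact: polyfunX.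
  by move=> z; rewrite mxE E.
- move=> i; case/mxvec_indexP: i => i j.
  apply: (@polyfun_ext _ _ (fun v => v 0 (fintype.lift ord_max i) *
     v 0 (if j == 0 then 0 else ord_max))).
    by move=> v; rewrite segreE !mxE; case: eqP.
  by apply: polyfunM; apply: polyfunX.
- move=> _ [v [w [v0 w0 ->]]]; rewrite segreE => vw1.
  have F0 : F (segre v w) 0 0 = 1 by rewrite mxE u0 segreE.
  split=> //; first by rewrite /= F0 oner_neq0.
  apply/rowP => k; case/mxvec_indexP: k => i j.
  rewrite segreE !mxE liftK unlift_none u0 !segreE.
  have -> : (if j == 0 then v 0 0 * w 0 0 else v 0 0 * w 0 1) = v 0 0 * w 0 j.
    have [->//|j0] := eqVneq j 0.
    by congr (_ * w _ _); apply: val_inj; case: j j0 => -[|[|m]].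
  by rewrite -[RHS]mul1r -vw1 mulrACA [RHS]mulrACA [v 0 i * _]mulrC.
- move=> v v0 v1; split.
  + exists (V v), (W v); split=> //; rewrite /= ?mxE ?l0 ?v1 ?oner_neq0 //.
  + by rewrite /G segreE !mxE l0 v1 mul1r.
  + apply/rowP => i; rewrite mxE; case: unliftP => [j ->|->].
      by rewrite segreE !mxE v1 mulr1.
    by rewrite segreE !mxE l0 v1 mul1r.
Qed.

Lemma class_affine_chart n (A : set 'rV[K]_n) (lcA : locally_closed A)
    (e : 'I_n) d (f : 'rV[K]_n -> 'rV[K]_d) (g : 'rV[K]_d -> 'rV[K]_n) :
  (forall v, A v -> v 0 e != 0) ->
  (forall i, polyfun (fun v => f v 0 i)) ->
  (forall i, polyfun (fun w => g w 0 i)) ->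
  (forall v, A v -> v 0 e = 1 -> g (f v) = v) ->
  (forall w, [/\ A (g w), g w 0 e = 1 & f (g w) = w]) ->
  class (Variety lcA) = LL K ^+ d.
Proof.
move=> Ae pf pg gf fg; rewrite -class_affine_space; apply: class_isomorphic.
pose F v : 'rV[K]_d.+1 := \row_i if unlift 0 i is Some j then f v 0 j else 1.
pose V (v : 'rV[K]_d.+1) : 'rV[K]_d := \row_i v 0 (fintype.lift 0 i).
have VF v : V (F v) = f v by apply/rowP => i; rewrite !mxE liftK.
have F0 v : F v 0 0 = 1 by rewrite mxE unlift_none.
apply: (@isomorphic_chart (Variety lcA) (affine_space d) e 0 F (fun v => g (V v))).
- exact: Ae.
- by [].
- move=> i; case: (unliftP 0 i) => [j ->|->].
    by apply: polyfun_ext (pf j) => v; rewrite mxE liftK.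
  by apply: polyfun_ext (polyfunC _ 1) => v; rewrite F0.
- move=> i; have [p hp] := pg i.
  apply: (@polyfun_ext _ _ (fun v => p.@[fun j => v 0 (fintype.lift 0 j)])).
    by move=> v; rewrite -hp; apply: meval_eq => j; rewrite mxE.
  by apply: polyfun_comp => j; apply: polyfunX.
- by move=> v Av v1; split; rewrite /= ?F0 ?oner_neq0 // VF gf.
- move=> w w0 w1; have [Ag ge fge] := fg (V w); split=> //.
  by apply/rowP => i; rewrite mxE; case: unliftP => [j ->|->]; rewrite ?fge ?mxE.
Qed.

End AffineSpace.

(** * Graded systems of polynomial equations *)

Section GradedElimination.
Variable K : closedFieldType.

Lemma polyfun_subst n m (phi : 'rV[K]_m -> K) (F : 'rV[K]_n -> 'rV[K]_m) :
  polyfun phi -> (forall i, polyfun (fun v => F v 0 i)) ->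
  polyfun (fun v => phi (F v)).
Proof.
move=> [p hp] pF; apply: polyfun_ext (polyfun_comp p pF) => v.
by rewrite -hp; apply: meval_eq.
Qed.

Lemma polyfun_mulmxr n m r (F : 'rV[K]_n -> 'rV[K]_m) (A : 'M[K]_(m, r)) :
  (forall i, polyfun (fun v => F v 0 i)) ->
  forall i, polyfun (fun v => (F v *m A) 0 i).
Proof.
move=> pF i; apply: (polyfun_mulmx (A := F) (B := fun=> A)) => [a b|a b].
  by rewrite ord1.
exact: polyfunC.
Qed.

Lemma row_full_injr n m (L : 'M[K]_(n, m)) :
  (forall c : 'cV_m, L *m c = 0 -> c = 0) -> row_full L.
Proof.
move=> Linj; rewrite /row_full -mxrank_tr -/(row_free _) -kermx_eq0.
apply/eqP/row_matrixP => i; rewrite row0.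
apply: trmx_inj; rewrite trmx0; apply: Linj; apply: trmx_inj.
by rewrite trmx0 trmx_mul trmxK -row_mul mulmx_ker row0.
Qed.

Lemma kernel_coordinates n m (L : 'M[K]_(n, m)) :
  row_full L ->
  exists (B : 'M[K]_(n - m, n)) (B' : 'M[K]_(n, n - m)),
    [/\ B *m L = 0, B *m B' = 1%:M &
        forall u : 'rV_n, u *m L = 0 -> u *m B' *m B = u].
Proof.
move=> fL; have -> : (n - m)%N = \rank (kermx L) by rewrite mxrank_ker (eqP fL).
exists (row_base (kermx L)), (pinvmx (row_base (kermx L))); split.
- by apply/sub_kermxP; rewrite eq_row_base.
- by rewrite mulmxVp ?row_base_free.
- move=> u uL; rewrite mulmxKpV // eq_row_base; exact/sub_kermxP.
Qed.

(* The system is [u L + Q u = 0] where [L] is the part of lowest order.  With a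
   graded right inverse [R] of [L], the map [T u = u + Q u R] is triangular, hence
   bijective with polynomial inverse, and it carries the solutions onto the
   kernel of [L]. *)
Lemma graded_elimination n m (du : 'I_n -> nat) (de : 'I_m -> nat)
    (L : 'M[K]_(n, m)) (Q : 'rV[K]_n -> 'rV[K]_m) :
  (forall i j, L i j != 0 -> du i = de j) ->
  (forall c : 'cV_m, L *m c = 0 -> c = 0) ->
  (forall j, polyfun (fun u => Q u 0 j)) ->
  (forall j (u u' : 'rV_n), (forall i, (du i < de j)%N -> u 0 i = u' 0 i) ->
     Q u 0 j = Q u' 0 j) ->
  exists (f : 'rV[K]_n -> 'rV[K]_(n - m)) (g : 'rV[K]_(n - m) -> 'rV[K]_n),
    [/\ forall i, polyfun (fun u => f u 0 i), forall i, polyfun (fun w => g w 0 i),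
        forall w, g w *m L + Q (g w) = 0, forall w, f (g w) = w &
        forall u, u *m L + Q u = 0 -> g (f u) = u].
Proof.
move=> Lgr /row_full_injr fL pQ Qlow.
have [B [B' [BL BB' B'B]]] := kernel_coordinates fL.
(* Only the degree-preserving entries of the pseudo-inverse are kept. The product with [L] is still
   1: between equal degrees the dropped entries meet zeros of [L], and between different degrees no
   term survives. *)
pose R : 'M[K]_(m, n) :=
  \matrix_(j, i) if du i == de j then pinvmx L j i else 0.
have RL : R *m L = 1%:M.
  have RL0 : pinvmx L *m L = 1%:M by rewrite mulVpmx.
  apply/matrixP => j j'; have [dj|dj] := eqVneq (de j) (de j').
    rewrite -RL0 !mxE; apply: eq_bigr => i _; rewrite mxE; case: eqP => // di.
    have [->|/Lgr E] := eqVneq (L i j') 0; first by rewrite !mulr0.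
    by case: di; rewrite E dj.
  have [jj'|_] := eqVneq j j'; first by rewrite jj' eqxx in dj.
  rewrite !mxE big1 => [|i _]; first by case: eqVneq => // jj'; rewrite jj' eqxx in dj.
  rewrite mxE; case: eqP => [di|]; last by rewrite mul0r.
  have [->|/Lgr E] := eqVneq (L i j') 0; first by rewrite !mulr0.
  by rewrite -di -E eqxx in dj.
pose T u := u + Q u *m R.
have TL u : T u *m L = u *m L + Q u by rewrite mulmxDl -mulmxA RL mulmx1.
have QR k (u u' : 'rV_n) : (forall i, (du i < k)%N -> u 0 i = u' 0 i) ->
    forall i, (du i < k.+1)%N -> (Q u *m R) 0 i = (Q u' *m R) 0 i.
  move=> uu' i di; rewrite !mxE; apply: eq_bigr => j _; rewrite mxE.
  case: eqP => [E|]; last by rewrite !mulr0.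
  congr (_ * _); apply: Qlow => i' di'; apply: uu'.
  by rewrite -E in di'; apply: leq_trans di' _; rewrite -ltnS.
(* Fixed-point iteration for T u = t. The k-th iterate is final in degrees below k, so iterating
   past the largest degree inverts [T], and every iterate is polynomial in t. *)
pose S k t := iter k (fun u => t - Q u *m R) 0.
have SS t k i : (du i < k)%N -> S k.+1 t 0 i = S k t 0 i.
  elim: k i => [//|k IH] i di; rewrite /S !iterS -/(S k t) -/(S k.+1 t).
  by rewrite !mxE; congr (_ - _); have := QR k _ _ IH i di; rewrite !mxE.
pose k := (\max_i du i).+1; have dk i : (du i < k)%N.
  by rewrite ltnS; apply: (leq_bigmax i).
have ST t : T (S k t) = t.
  have E : S k.+1 t = S k t by apply/rowP => i; apply: SS.
  by rewrite /T -{1}E /S iterS -/(S k t) subrK.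
have Tinj u u' : T u = T u' -> u = u'.
  move=> E; suff H d : forall i, (du i < d)%N -> u 0 i = u' 0 i.
    by apply/rowP => i; apply: (H k).
  elim: d => [//|d IH] i di; have := congr1 (fun v : 'rV_n => v 0 i) E.
  by rewrite !mxE; have := QR d _ _ IH i di; rewrite !mxE => -> /addIr.
have pS j : forall i, polyfun (fun t => S j t 0 i).
  elim: j => [|j IH] i; first by apply: polyfun_ext (polyfunC _ 0) => t; rewrite mxE.
  apply: (@polyfun_ext _ _ (fun t => t 0 i - (Q (S j t) *m R) 0 i)).
    by move=> t; rewrite /S iterS !mxE.
  apply: polyfunB; first exact: polyfunX.
  by apply: polyfun_mulmxr => i'; apply: (polyfun_subst (pQ i') IH).
exists (fun u => T u *m B'), (fun w => S k (w *m B)); split.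
- apply: polyfun_mulmxr => i.
  apply: (@polyfun_ext _ _ (fun u => u 0 i + (Q u *m R) 0 i)).
    by move=> u; rewrite !mxE.
  by apply: polyfunD; [exact: polyfunX|apply: polyfun_mulmxr].
- move=> i; apply: (polyfun_subst (pS k i)); apply: polyfun_mulmxr => j.
  exact: polyfunX.
- by move=> w; rewrite -TL ST -mulmxA BL mulmx0.
- by move=> w; rewrite ST -mulmxA BB' mulmx1.
- by move=> u uL; apply: Tinj; rewrite ST B'B // TL.
Qed.

End GradedElimination.

(** * Two linear algebra lemmas *)

Section DiagramRelations.
Local Open Scope nat_scope.
Variables (V : nmodType) (D : rel nat) (N : nat).
Hypothesis D_down : forall i j i' j',
  D i j -> (i' <= i) -> (j' <= j) -> D i' j'.
Hypothesis D_bound : forall i j, D i j -> (i < N) && (j < N).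

Lemma diagram_row_end i j : D i j -> exists2 r, D (i + r) j & ~~ D (i + r).+1 j.
Proof.
move=> Dij; have exD : exists r, ~~ D (i + r).+1 j.
  exists N; apply/negP => /D_bound/andP[]; rewrite ltnNge => /negP[].
  exact: leq_trans (leq_addl i N) (leqnSn _).
case: (ex_minnP exD) => -[|r] nD r_min; first by rewrite addn0 in nD; exists 0; rewrite addn0.
exists r.+1 => //; rewrite addnS; apply: contraT => /r_min.
by rewrite ltnn.
Qed.

Lemma diagram_col_end j : D 0 j -> exists2 r, D 0 (j + r) & ~~ D 0 (j + r).+1.
Proof.
move=> Dij; have exD : exists r, ~~ D 0 (j + r).+1.
  exists N; apply/negP => /D_bound/andP[_]; rewrite ltnNge => /negP[].
  exact: leq_trans (leq_addl j N) (leqnSn _).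
case: (ex_minnP exD) => -[|r] nD r_min; first by rewrite addn0 in nD; exists 0; rewrite addn0.
exists r.+1 => //; rewrite addnS; apply: contraT => /r_min.
by rewrite ltnn.
Qed.

Variable C : nat -> nat -> nat -> nat -> V.
Hypothesis C_x : forall i j b c, D i.+1 j -> C i j b c = C i.+1 j b.+1 c.
Hypothesis C_y : forall i j b c, D i j.+1 -> ~~ D i.+1 j.+1 ->
  C i j b c = C i j.+1 b c.+1.
Hypothesis C_bottom : forall i b c, D i 0 -> ~~ D i.+1 0 -> C i 0 b c.+1 = 0%R.
Hypothesis C_left : forall j b c, D 0 j -> ~~ D 0 j.+1 -> C 0 j b.+1 c = 0%R.
Hypothesis C_origin : forall i j, D i j -> C i j 0 0 = 0%R.

(* Each value is constant along diagonal translations inside the diagram, and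
   every diagonal orbit meets one of the vanishing conditions. *)
Lemma diagram_relations_eq0 i j b c : D i j -> C i j b c = 0%R.
Proof.
have slide_x r i1 j1 b1 c1 : D (i1 + r) j1 ->
    C i1 j1 b1 c1 = C (i1 + r) j1 (b1 + r) c1.
  elim: r => [|r IH] Dr; first by rewrite !addn0.
  rewrite !addnS in Dr *; rewrite -C_x // -IH //.
  exact: D_down Dr (leqnSn _) (leqnn _).
have step_y i1 j1 b1 c1 : D i1 j1.+1 -> C i1 j1 b1 c1 = C i1 j1.+1 b1 c1.+1.
  move=> D1; have [r Dr nDr] := diagram_row_end D1.
  rewrite (slide_x r) ?(D_down Dr) // C_y // -slide_x //.
have slide_y r i1 j1 b1 c1 : D i1 (j1 + r) ->
    C i1 j1 b1 c1 = C i1 (j1 + r) b1 (c1 + r).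
  elim: r => [|r IH] Dr; first by rewrite !addn0.
  rewrite !addnS in Dr *; rewrite -step_y // -IH //.
  exact: D_down Dr (leqnn _) (leqnSn _).
have bottom i1 b1 c1 : D i1 0 -> C i1 0 b1 c1.+1 = 0%R.
  by move=> D1; have [r Dr nDr] := diagram_row_end D1; rewrite (slide_x r) ?C_bottom.
move=> Dij; have [bi|ib] := leqP b i.
  have {Dij} Dij : D (i - b + b) j by rewrite subnK.
  rewrite -(subnK bi) -[b in X in C _ _ X]add0n -slide_x //.
  have {Dij} Dij : D (i - b) j by apply: D_down Dij (leq_addr _ _) (leqnn _).
  have [cj|jc] := leqP c j.
    have Dj : D (i - b) (j - c + c) by rewrite subnK.
    rewrite -(subnK cj) -[c in X in C _ _ _ X]add0n -slide_y // C_origin //.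
    exact: D_down Dj (leqnn _) (leq_addr _ _).
  rewrite -[j]add0n -(subnK (ltnW jc)) -slide_y ?add0n //.
  move: jc; rewrite -subn_gt0; case: (c - j) => // c' _.
  by apply: bottom; apply: D_down Dij (leqnn _) (leq0n _).
rewrite -[i in X in C X]add0n -(subnK (ltnW ib)) -slide_x ?add0n //.
move: ib; rewrite -subn_gt0; case: (b - i) => // b' _.
have D0 : D 0 j by apply: D_down Dij (leq0n _) (leqnn _).
by have [r Dr nDr] := diagram_col_end D0; rewrite (slide_y r) // C_left.
Qed.

End DiagramRelations.

(** * The trace argument that kills the covector *)

Section TraceIdentity.
Variable F : fieldType.
Hypothesis char0 : forall n, n.+1%:R != 0 :> F.
Variables (N : nat) (X Y : 'M[F]_N) (v : 'rV[F]_N) (w : 'cV[F]_N).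
Hypothesis comm_rank1 : Y *m X - X *m Y + w *m v = 0.

Let XYE : X *m Y = Y *m X + w *m v.
Proof. by apply/eqP; rewrite eq_sym -subr_eq0 addrAC comm_rank1. Qed.

Let expmxSr (A : 'M[F]_N) a : A ^+ a *m A = A ^+ a.+1.
Proof. by rewrite exprSr. Qed.

Let expmxS (A : 'M[F]_N) a : A *m A ^+ a = A ^+ a.+1.
Proof. by rewrite exprS. Qed.

Let XYn b : X *m Y ^+ b =
  Y ^+ b *m X + \sum_(c < b) Y ^+ c *m w *m (v *m Y ^+ (b - c.+1)).
Proof.
elim: b => [|b IH]; first by rewrite big_ord0 addr0 !expr0 mulmx1 mul1mx.
rewrite [in LHS]exprSr mulmxA IH mulmxDl -[Y ^+ b *m X *m Y]mulmxA XYE mulmxDr.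
rewrite !mulmxA expmxSr -addrA; congr (_ + _).
rewrite big_ord_recr /= subnn expr0 mulmx1 addrC mulmx_suml; congr (_ + _).
by apply: eq_bigr => c _; rewrite -!mulmxA expmxSr subSS subnSK.
Qed.

Let XnY a : X ^+ a *m Y =
  Y *m X ^+ a + \sum_(c < a) X ^+ c *m w *m (v *m X ^+ (a - c.+1)).
Proof.
elim: a => [|a IH]; first by rewrite big_ord0 addr0 !expr0 mulmx1 mul1mx.
rewrite exprSr -mulmxA XYE mulmxDr [X ^+ a *m (Y *m X)]mulmxA IH mulmxDl.
rewrite !mulmxA -addrA -[_ *m X ^+ a *m X]mulmxA expmxSr; congr (_ + _).
rewrite big_ord_recr /= subnn expr0 mulmx1 mulmx_suml; congr (_ + _).
by apply: eq_bigr => c _; rewrite -!mulmxA expmxSr subSS subnSK.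
Qed.

(* By induction on a + b.  Up to products of shorter terms, which vanish, all words
   with b letters Y and a letters X have the same value s of v _ w; multiplying the
   hypothesis by Y^b X^a and taking the trace then gives (b + 1) s = 0. *)
Lemma comm_rank1_eq0 a b : v *m Y ^+ b *m X ^+ a *m w = 0.
Proof.
suff H l : forall a b, (a + b = l)%N -> v *m Y ^+ b *m X ^+ a *m w = 0 by exact: H.
elim/ltn_ind: l => l IH {}a {}b abl.
have swap c : (c <= b)%N ->
    v *m Y ^+ (b - c) *m X ^+ a *m Y ^+ c *m w = v *m Y ^+ b *m X ^+ a *m w.
  elim: c => [|c IHc] cb; first by rewrite subn0 expr0 mulmx1.
  rewrite -IHc; last exact: ltnW.
  rewrite exprS mulmxA -[_ *m X ^+ a *m Y]mulmxA XnY mulmxDr !mulmxDl.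
  rewrite [X in _ + X](_ : _ = 0) ?addr0.
    by rewrite !mulmxA -(mulmxA v _ Y) expmxSr subnSK.
  rewrite mulmx_sumr !mulmx_suml big1 // => i _.
  rewrite !mulmxA (IH (i + (b - c.+1))%N _ _ _ erefl) ?mul0mx //.
  rewrite -abl; apply: leq_ltn_trans (leq_add (leqnn i) (leq_subr _ _)) _.
  by rewrite ltn_add2r.
set s := v *m _ *m _ *m w in swap *.
have trP : \tr (Y ^+ b *m X ^+ a *m (Y *m X - X *m Y)) = b%:R * \tr s.
  rewrite mulmxBr raddfB /= !mulmxA mxtrace_mulC mulmxA !mulmxA XYn.
  rewrite mulmxDl mulmxDl raddfD /=.
  have -> : \tr (Y ^+ b *m X *m X ^+ a *m Y) = \tr (Y ^+ b *m X ^+ a *m X *m Y).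
    by rewrite -(mulmxA _ X) -(mulmxA _ _ X) expmxSr expmxS.
  rewrite addrC addKr mulmx_suml mulmx_suml raddf_sum /=.
  rewrite (eq_bigr (fun=> \tr s)); first by rewrite sumr_const card_ord mulr_natl.
  move=> c _; rewrite -!mulmxA mxtrace_mulC -!mulmxA.
  by rewrite -(swap c.+1) // mxtrace_mulC expmxS !mulmxA.
have : \tr (Y ^+ b *m X ^+ a *m (Y *m X - X *m Y + w *m v)) = b.+1%:R * \tr s.
  rewrite mulmxDr raddfD /= trP mulmxA [X in _ + X]mxtrace_mulC !mulmxA -/s.
  by rewrite -[b.+1]addn1 natrD mulrDl mul1r.
rewrite comm_rank1 mulmx0 raddf0 => /esym/eqP.
rewrite mulf_eq0 (negbTE (char0 b)) /= => /eqP s0.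
by apply/matrixP => i j; rewrite !ord1 [RHS]mxE -s0 /mxtrace big_ord1.
Qed.

End TraceIdentity.

(** * Groebner strata *)

Section CommutingMatrices.
Variable K : closedFieldType.
Local Notation Kxy := {mpoly K[2]}.

Lemma xyM a b c d : xy K a b * xy K c d = xy K (a + c) (b + d).
Proof. by rewrite /xy !exprD mulrACA. Qed.

(** A commuting pair makes K^N a module over K[x, y] with cyclic vector [v]. The ideal is the
    annihilator of [v], and the monomials of [t] show that the quotient is all of K^N. *)
Lemma commuting_quotient N (X Y : 'M[K]_N) (v : 'rV[K]_N) (t : 'I_N -> nat * nat) :
  X *m Y = Y *m X ->
  (forall i, v *m Y ^+ (t i).2 *m X ^+ (t i).1 = delta_mx 0 i) ->
  exists (I : set Kxy) (phi : {linear Kxy -> 'rV[K]_N}),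
    [/\ is_ideal I, quotient_map I phi,
        forall a b, phi (xy K a b) = v *m Y ^+ b *m X ^+ a,
        forall f, phi ('X_ord0 * f) = phi f *m X &
        forall f, phi ('X_ord_max * f) = phi f *m Y].
Proof.
move=> XY vt; have cXY a b : X ^+ a *m Y ^+ b = Y ^+ b *m X ^+ a.
  exact: (commrX b (commr_sym (commrX a (commr_sym XY)))).
have mulD (Z : 'M[K]_N) a b : Z ^+ a *m Z ^+ b = Z ^+ (a + b) by rewrite exprD.
have [phi phiX] := @linear_extension K _
  (fun m : 'X_{1..2} => v *m Y ^+ (m ord_max) *m X ^+ (m ord0)).
have phiE a b : phi (xy K a b) = v *m Y ^+ b *m X ^+ a.
  by have [m [m0 m1 ->]] := xy_mpolyX K a b; rewrite phiX m0 m1.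
have phiM a b f : phi (xy K a b * f) = phi f *m (Y ^+ b *m X ^+ a).
  rewrite {1}[f]mpolyE mulr_sumr linear_sum linear_mpolyE mulmx_suml.
  apply: eq_bigr => m _; rewrite /= -scalerAr linearZ /= -scalemxAl.
  rewrite mpolyX_xy xyM !phiE [(a + _)%N]addnC [(b + _)%N]addnC -!mulD.
  by rewrite !mulmxA -(mulmxA _ (X ^+ m ord0) (Y ^+ b)) cXY !mulmxA.
have phix f : phi ('X_ord0 * f) = phi f *m X.
  by have := phiM 1%N 0%N f; rewrite /xy expr0 expr1 mulr1 mul1mx.
have phiy f : phi ('X_ord_max * f) = phi f *m Y.
  by have := phiM 0%N 1%N f; rewrite /xy expr0 expr1 mul1r mulmx1.
exists [set f | phi f = 0], phi; split=> //.
- split=> [|f g If Ig|f g Ig]; rewrite /=.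
  + exact: linear0.
  + by rewrite linearD If Ig addr0.
  rewrite {1}[f]mpolyE mulr_suml linear_sum big1 // => m _ /=.
  by rewrite -scalerAl linearZ /= mpolyX_xy phiM Ig mul0mx scaler0.
- split=> // u; exists (\sum_i u 0 i *: xy K (t i).1 (t i).2).
  rewrite linear_sum [RHS]row_sum_delta; apply: eq_bigr => i _.
  by rewrite linearZ /= phiE vt.
Qed.

End CommutingMatrices.

(** * Vectors indexed by a subset of a finite type *)

Section SubCoordinates.
Variables (R : pzRingType) (T : finType) (P : pred T).
Local Notation sub := {x : T | P x}.

(** Extension by zero: positions outside [P] read 0, so that a vector of unknowns can be spread out
    into full N x N matrices. *)
Definition coord_sub (u : 'rV[R]_#|{: sub}|) (x : T) : R :=
  if insub x is Some s then u 0 (enum_rank (s : sub)) else 0.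

Definition row_sub_of (f : T -> R) : 'rV[R]_#|{: sub}| :=
  \row_i f (val (enum_val i : sub)).

Lemma coord_subN u x : ~~ P x -> coord_sub u x = 0.
Proof. by move=> Px; rewrite /coord_sub insubN. Qed.

Lemma coord_sub_of f x : coord_sub (row_sub_of f) x = if P x then f x else 0.
Proof.
rewrite /coord_sub; case: insubP => [s _ <-|/negbTE -> //].
by rewrite (valP s) mxE enum_rankK.
Qed.

Lemma coord_sub_val u i : coord_sub u (val (enum_val i : sub)) = u 0 i.
Proof. by rewrite /coord_sub valK enum_valK. Qed.

Lemma coord_subZ a u x : coord_sub (a *: u) x = a * coord_sub u x.
Proof. by rewrite /coord_sub; case: insub => [s|]; rewrite ?mxE ?mulr0. Qed.

Lemma coord_subD u v x : coord_sub (u + v) x = coord_sub u x + coord_sub v x.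
Proof. by rewrite /coord_sub; case: insub => [s|]; rewrite ?mxE ?addr0. Qed.

Lemma sum_coord_sub (f : T -> R) (u : 'rV[R]_#|{: sub}|) :
  \sum_i f (val (enum_val i : sub)) * u 0 i = \sum_x f x * coord_sub u x.
Proof.
rewrite (reindex (fun s : sub => enum_rank s)) /=; last first.
  by exists enum_val => s _; rewrite ?enum_rankK ?enum_valK.
rewrite (bigID P) /= [X in _ + X]big1 ?addr0; last first.
  by move=> x Px; rewrite coord_subN ?mulr0.
rewrite [RHS](reindex_omap (val : sub -> T) insub) /=; last first.
  by move=> x Px; rewrite insubT.
apply: eq_big => [s|s _]; first by rewrite valK eqxx (valP s).
by rewrite enum_rankK /coord_sub valK.
Qed.

End SubCoordinates.

(** * The stratum of one diagram is an affine space *)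

Section Stratum.
Variable K : closedFieldType.
Variables (N : nat) (t : mono_tuple N) (p q : nat).
Local Notation Kxy := {mpoly K[2]}.

Definition box (i : 'I_N) : nat * nat := ((t i).1 : nat, (t i).2 : nat).
Definition in_diagram (a b : nat) := [exists i, box i == (a, b)].
Definition weight (m : nat * nat) := (p * m.1 + q * m.2)%N.

Definition normal_map (phi : {linear Kxy -> 'rV[K]_N}) :=
  forall i, phi (xy K (t i).1 (t i).2) = delta_mx 0 i.

(** Meant for [r] the class of the monomial [m]: it is a combination of standard monomials of
    strictly smaller weight, and of [m] itself. Other monomials of the weight of [m] are
    excluded. *)
Definition lowers (m : nat * nat) (r : 'rV[K]_N) :=
  forall j, r 0 j != 0 -> (box j == m) || (weight (box j) < weight m)%N.

Definition lowering_map (phi : {linear Kxy -> 'rV[K]_N}) :=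
  forall a b, lowers (a, b) (phi (xy K a b)).

(* The ideals whose initial ideal, for the weights [p], [q] of x, y, is spanned by
   the monomials outside the diagram [t]. *)
Definition stratum : set 'rV[K]_#|{: mono_tuple N}| :=
  [set z | exists (I : set Kxy) (phi : {linear Kxy -> 'rV[K]_N}) (c : K),
    [/\ is_ideal I, quotient_map I phi, normal_map phi /\ lowering_map phi,
        c != 0 & z = c *: pluecker phi]].

Lemma pluecker_normal (phi : {linear Kxy -> 'rV[K]_N}) :
  normal_map phi -> pluecker phi 0 (enum_rank t) = 1.
Proof.
move=> tE; rewrite mxE enum_rankK -[RHS](det1 _ N); congr (\det _).
by apply/row_matrixP => i; rewrite rowK /= tE row1.
Qed.

(* A row vector is the image of a polynomial in the quotient, so x and y act by right
   multiplication by X and Y.  The basis vector of x^a y^b is 1 Y^b X^a: this fixes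
   every row of X except those of the last box of each row of the diagram, but the
   rows of Y only in the first column.  A matrix entry from box i to box j of X (of Y)
   is unknown when its degree [weight i + p - weight j] (with [q] for Y) is positive. *)
Definition x_unknown (i j : 'I_N) :=
  ~~ in_diagram (box i).1.+1 (box i).2 && (weight (box j) < weight (box i) + p)%N.
Definition y_unknown (i j : 'I_N) :=
  ((0 < (box i).1)%N || ~~ in_diagram (box i).1 (box i).2.+1)
  && (weight (box j) < weight (box i) + q)%N.
Definition equation (e : 'I_N * 'I_N) :=
  (weight (box e.2) < weight (box e.1) + (p + q))%N.

Local Notation index := ('I_N * 'I_N + 'I_N * 'I_N + 'I_N)%type.

Definition unknown (s : index) :=
  match s with
  | inl (inl e) => x_unknown e.1 e.2
  | inl (inr e) => y_unknown e.1 e.2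
  | inr _ => true
  end.

Hypothesis p_gt0 : (0 < p)%N.
Hypothesis q_gt0 : (0 < q)%N.
Hypothesis t_inj : injective t.
Hypothesis t_down : forall i a b, (a <= (t i).1)%N -> (b <= (t i).2)%N ->
  in_diagram a b.

Lemma box_inj : injective box.
Proof.
move=> i j [e1 e2]; apply: t_inj; move: e1 e2.
by case: (t i) (t j) => [a b] [c d] /= /val_inj -> /val_inj ->.
Qed.

Lemma in_diagramP a b : reflect (exists i, box i = (a, b)) (in_diagram a b).
Proof. by apply: (iffP existsP) => [[i /eqP E]|[i E]]; exists i => //; apply/eqP. Qed.

Lemma in_diagram_down i j i' j' :
  in_diagram i j -> (i' <= i)%N -> (j' <= j)%N -> in_diagram i' j'.
Proof.
move=> /in_diagramP[k kE] i'i j'j; apply: (@t_down k).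
  by rewrite (congr1 fst kE : (t k).1 = i :> nat).
by rewrite (congr1 snd kE : (t k).2 = j :> nat).
Qed.

(** A box (i, j) brings with it i + 1 boxes of its row and j + 1 of its column, and there are only N
    indices. The charts of the Hilbert scheme ask for this bound on [t]. *)
Lemma in_diagram_lt i j : in_diagram i j -> (i < N)%N && (j < N)%N.
Proof.
move=> Dij; have Dlt r (f : 'I_r.+1 -> nat * nat) :
    injective f -> (forall k, in_diagram (f k).1 (f k).2) -> (r < N)%N.
  move=> f_inj fD; have /choice[g gE] : forall k, exists i, box i = f k.
    by move=> k; have /in_diagramP[i' E] := fD k; exists i'; rewrite E -surjective_pairing.
  have g_inj : injective g by move=> k k' E; apply: f_inj; rewrite -!gE E.
  by have := leq_card g g_inj; rewrite !card_ord.
apply/andP; split.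
  apply: (Dlt _ (fun k : 'I_i.+1 => (k : nat, j))) => [k k' [/val_inj //]|k].
  by apply: in_diagram_down Dij _ _; rewrite //= -ltnS.
apply: (Dlt _ (fun k : 'I_j.+1 => (i, k : nat))) => [k k' [/val_inj //]|k].
by apply: in_diagram_down Dij _ _; rewrite //= -ltnS.
Qed.

Lemma in_diagram_box i : in_diagram (box i).1 (box i).2.
Proof. by apply/in_diagramP; exists i. Qed.

Lemma t_lt i : ((t i).1 < N)%N && ((t i).2 < N)%N.
Proof. exact: (in_diagram_lt (in_diagram_box i)). Qed.

(** Multiplication by x and by y, and the class of 1, for the monomial ideal of the diagram. *)
Definition X0 : 'M[K]_N := \matrix_(i, j) (box j == ((box i).1.+1, (box i).2))%:R.
Definition Y0 : 'M[K]_N := \matrix_(i, j) (box j == ((box i).1, (box i).2.+1))%:R.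
Definition v0 : 'rV[K]_N := \row_j (box j == (0%N, 0%N))%:R.

Lemma sum_box j (f : 'I_N -> K) : \sum_i (box i == box j)%:R * f i = f j.
Proof.
rewrite (bigD1 j) //= eqxx mul1r big1 ?addr0 // => i ij.
by rewrite (inj_eq box_inj) (negbTE ij) mul0r.
Qed.

Lemma sum_boxN m (f : 'I_N -> K) : ~~ in_diagram m.1 m.2 ->
  \sum_i (box i == m)%:R * f i = 0.
Proof.
move=> Dm; rewrite big1 // => i _; case: eqP => [E|]; last by rewrite mul0r.
by case/in_diagramP: Dm; exists i; rewrite E -surjective_pairing.
Qed.

Lemma X0Y0C : Y0 *m X0 = X0 *m Y0.
Proof.
apply/matrixP => i j; rewrite !mxE.
under eq_bigr => k _ do rewrite !mxE.
under [in RHS]eq_bigr => k _ do rewrite !mxE.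
pose d := (box j == ((box i).1.+1, (box i).2.+1))%:R : K.
transitivity d; [|symmetry].
  have [/in_diagramP[k kE]|D] := boolP (in_diagram (box i).1 (box i).2.+1).
    by rewrite -kE sum_box kE.
  rewrite sum_boxN // /d; case: eqP => // E; case/negP: D.
  by apply: (in_diagram_down (in_diagram_box j)); rewrite E.
have [/in_diagramP[k kE]|D] := boolP (in_diagram (box i).1.+1 (box i).2).
  by rewrite -kE sum_box kE.
rewrite sum_boxN // /d; case: eqP => // E; case/negP: D.
by apply: (in_diagram_down (in_diagram_box j)); rewrite E.
Qed.

Local Notation unknowns := {s : index | unknown s}.
Local Notation equations := {e : 'I_N * 'I_N | equation e}.
Local Notation nU := #|{: unknowns}|.
Local Notation nE := #|{: equations}|.

Definition mat_x (u : 'rV[K]_nU) : 'M[K]_N := \matrix_(i, j) coord_sub u (inl (inl (i, j))).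
Definition mat_y (u : 'rV[K]_nU) : 'M[K]_N := \matrix_(i, j) coord_sub u (inl (inr (i, j))).
Definition col_j (u : 'rV[K]_nU) : 'cV[K]_N := \col_i coord_sub u (inr i).

(** The differential of Y X - X Y + w [v0] at ([X0], [Y0], 0). *)
Definition linear_part (x y : 'M[K]_N) (w : 'cV[K]_N) : 'M[K]_N :=
  Y0 *m x + y *m X0 - (X0 *m y + x *m Y0) + w *m v0.

Definition linear_row (u : 'rV[K]_nU) : 'rV[K]_nE :=
  row_sub_of equation (fun e => linear_part (mat_x u) (mat_y u) (col_j u) e.1 e.2).

Definition quadratic_row (u : 'rV[K]_nU) : 'rV[K]_nE :=
  row_sub_of equation (fun e => (mat_y u *m mat_x u - mat_x u *m mat_y u) e.1 e.2).

(** Degrees for the scaling of x with weight p and of y with weight q; the truncated subtraction is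
    exact on unknowns. A covector entry gets the degree that makes w [v0] homogeneous, since [v0] is
    supported on the box of weight 0. *)
Definition degree_u (s : index) : nat :=
  match s with
  | inl (inl e) => weight (box e.1) + p - weight (box e.2)
  | inl (inr e) => weight (box e.1) + q - weight (box e.2)
  | inr i => weight (box i) + (p + q)
  end.

Definition degree_e (e : 'I_N * 'I_N) : nat :=
  weight (box e.1) + (p + q) - weight (box e.2).

Lemma X0_weight i j : X0 i j != 0 -> weight (box j) = (weight (box i) + p)%N.
Proof.
rewrite mxE; case: (box j =P _) => [-> _|]; last by rewrite eqxx.
by rewrite /weight /=; lia.
Qed.

Lemma Y0_weight i j : Y0 i j != 0 -> weight (box j) = (weight (box i) + q)%N.
Proof.
rewrite mxE; case: (box j =P _) => [-> _|]; last by rewrite eqxx.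
by rewrite /weight /=; lia.
Qed.

Lemma v0_weight j : v0 0 j != 0 -> weight (box j) = 0%N.
Proof.
rewrite mxE; case: (box j =P _) => [-> _|]; last by rewrite eqxx.
by rewrite /weight /=; lia.
Qed.

Lemma linear_part_linear a u v i j :
  linear_part (mat_x (a *: u + v)) (mat_y (a *: u + v)) (col_j (a *: u + v)) i j
  = a * linear_part (mat_x u) (mat_y u) (col_j u) i j
    + linear_part (mat_x v) (mat_y v) (col_j v) i j.
Proof.
have -> : mat_x (a *: u + v) = a *: mat_x u + mat_x v.
  by apply/matrixP => k l; rewrite !mxE coord_subD coord_subZ.
have -> : mat_y (a *: u + v) = a *: mat_y u + mat_y v.
  by apply/matrixP => k l; rewrite !mxE coord_subD coord_subZ.
have -> : col_j (a *: u + v) = a *: col_j u + col_j v.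
  by apply/matrixP => k l; rewrite !mxE coord_subD coord_subZ.
set x := mat_x u; set x' := mat_x v; set y := mat_y u; set y' := mat_y v.
set w := col_j u; set w' := col_j v; clearbody x x' y y' w w'.
rewrite /linear_part !mulmxDl !mulmxDr -!scalemxAl -!scalemxAr.
move: (Y0 *m x) (Y0 *m x') (y *m X0) (y' *m X0) (X0 *m y) (X0 *m y') (x *m Y0)
  (x' *m Y0) (w *m v0) (w' *m v0) => *; rewrite !mxE; ring.
Qed.

Lemma linear_rowE u e (ij := val (enum_val e : equations)) :
  linear_row u 0 e = linear_part (mat_x u) (mat_y u) (col_j u) ij.1 ij.2.
Proof. by rewrite [LHS]mxE. Qed.

Lemma linear_row_linear : linear linear_row.
Proof.
move=> a u v; apply/rowP => e; rewrite linear_rowE linear_part_linear.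
by rewrite -!linear_rowE [RHS]mxE [in RHS]mxE.
Qed.

HB.instance Definition _ :=
  GRing.isLinear.Build K 'rV[K]_nU 'rV[K]_nE _ linear_row linear_row_linear.

Definition system_mx : 'M[K]_(nU, nE) := lin1_mx linear_row.

Lemma system_mxE u : u *m system_mx = linear_row u.
Proof. exact: mul_rV_lin1. Qed.

Lemma coord_sub_delta s x :
  coord_sub (delta_mx 0 s : 'rV[K]_nU) x = (val (enum_val s : unknowns) == x)%:R.
Proof.
rewrite /coord_sub; case: insubP => [s' _ <-|Px]; last first.
  by case: eqP => // E; rewrite -E (valP (enum_val s)) in Px.
by rewrite mxE eqxx -(inj_eq enum_val_inj) enum_rankK (inj_eq val_inj) eq_sym.
Qed.

(** [X0], [Y0] and [v0] are homogeneous, so entry (i, j) involves only unknowns of its own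
    degree. *)
Lemma linear_part_graded u i j :
  (forall s, degree_u s = degree_e (i, j) -> coord_sub u s = 0) ->
  linear_part (mat_x u) (mat_y u) (col_j u) i j = 0.
Proof.
move=> u0.
have H1 : (Y0 *m mat_x u) i j = 0.
  rewrite mxE big1 // => k _; have [->|/Y0_weight E] := eqVneq (Y0 i k) 0.
    by rewrite mul0r.
  by rewrite [mat_x u k j]mxE u0 ?mulr0 //= /degree_e /= E; lia.
have H2 : (mat_y u *m X0) i j = 0.
  rewrite mxE big1 // => k _; have [->|/X0_weight E] := eqVneq (X0 k j) 0.
    by rewrite mulr0.
  by rewrite [mat_y u i k]mxE u0 ?mul0r //= /degree_e /= E; lia.
have H3 : (X0 *m mat_y u) i j = 0.
  rewrite mxE big1 // => k _; have [->|/X0_weight E] := eqVneq (X0 i k) 0.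
    by rewrite mul0r.
  by rewrite [mat_y u k j]mxE u0 ?mulr0 //= /degree_e /= E; lia.
have H4 : (mat_x u *m Y0) i j = 0.
  rewrite mxE big1 // => k _; have [->|/Y0_weight E] := eqVneq (Y0 k j) 0.
    by rewrite mulr0.
  by rewrite [mat_x u i k]mxE u0 ?mul0r //= /degree_e /= E; lia.
have H5 : (col_j u *m v0) i j = 0.
  rewrite mxE big1 // => k _; rewrite ord1.
  have [->|/v0_weight E] := eqVneq (v0 0 j) 0; first by rewrite mulr0.
  by rewrite [col_j u i 0]mxE u0 ?mul0r //= /degree_e /= E subn0.
rewrite /linear_part; move: H1 H2 H3 H4 H5.
move: (Y0 *m _) (_ *m X0) (X0 *m _) (_ *m Y0) (_ *m v0) => A1 A2 A3 A4 A5.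
by move=> H1 H2 H3 H4 H5; rewrite !mxE H1 H2 H3 H4 H5 !addr0 subr0.
Qed.

Lemma system_mx_graded s e : system_mx s e != 0 ->
  degree_u (val (enum_val s : unknowns)) = degree_e (val (enum_val e : equations)).
Proof.
apply: contra_neq_eq => ds; rewrite /system_mx mxE linear_rowE.
case: (val (enum_val e)) ds => i j ds; apply: linear_part_graded => s' ds'.
by rewrite coord_sub_delta; case: eqP => // E; rewrite E ds' eqxx in ds.
Qed.

Lemma mat_x0 u i j : ~~ x_unknown i j -> mat_x u i j = 0.
Proof. by move=> xij; rewrite mxE coord_subN. Qed.

Lemma mat_y0 u i j : ~~ y_unknown i j -> mat_y u i j = 0.
Proof. by move=> yij; rewrite mxE coord_subN. Qed.

(** The two factors of a term have positive degrees that add up to the degree of the equation, so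
    each is strictly smaller. *)
Lemma quadratic_row_low e (u u' : 'rV[K]_nU) :
  (forall s, (degree_u (val (enum_val s : unknowns)) <
     degree_e (val (enum_val e : equations)))%N -> u 0 s = u' 0 s) ->
  quadratic_row u 0 e = quadratic_row u' 0 e.
Proof.
rewrite ![_ 0 e]mxE; case: (val (enum_val e)) => i j /= uu'.
have coordE s : unknown s -> (degree_u s < degree_e (i, j))%N ->
    coord_sub u s = coord_sub u' s.
  move=> us ds; rewrite /coord_sub insubT /=; apply: uu'.
  by rewrite enum_rankK.
have mulE (x y : 'I_N * 'I_N -> index) k l m n :
    (unknown (x (k, l)) -> unknown (y (m, n)) ->
      degree_u (x (k, l)) < degree_e (i, j) /\
      degree_u (y (m, n)) < degree_e (i, j))%N ->
    coord_sub u (x (k, l)) * coord_sub u (y (m, n)) =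
    coord_sub u' (x (k, l)) * coord_sub u' (y (m, n)).
  case: (boolP (unknown (x (k, l)))) => [ux|ux _]; last first.
    by rewrite !(coord_subN _ ux) !mul0r.
  case: (boolP (unknown (y (m, n)))) => [uy|uy _]; last first.
    by rewrite !(coord_subN _ uy) !mulr0.
  by move=> /(_ isT isT)[dx dy]; rewrite !coordE.
rewrite !mxE; congr (_ - _); apply: eq_bigr => k _; rewrite !mxE.
  apply: (mulE (fun e => inl (inr e)) (fun e => inl (inl e))) => /=.
  by rewrite /degree_e /= => /andP[_ ?] /andP[_ ?] /=; split; lia.
apply: (mulE (fun e => inl (inl e)) (fun e => inl (inr e))) => /=.
by rewrite /degree_e /= => /andP[_ ?] /andP[_ ?] /=; split; lia.
Qed.

Lemma system_solution u :
  u *m system_mx + quadratic_row u = 0 <->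
  (Y0 + mat_y u) *m (X0 + mat_x u) - (X0 + mat_x u) *m (Y0 + mat_y u)
    + col_j u *m v0 = 0.
Proof.
set x := mat_x u; set y := mat_y u; set w := col_j u.
have -> : (Y0 + y) *m (X0 + x) - (X0 + x) *m (Y0 + y) + w *m v0
    = linear_part x y w + (y *m x - x *m y).
  rewrite !mulmxDl !mulmxDr X0Y0C /linear_part.
  apply/matrixP => i j.
  move: (X0 *m Y0) (Y0 *m x) (y *m X0) (y *m x) (X0 *m y) (x *m Y0) (x *m y) (w *m v0).
  by move=> *; rewrite !mxE; ring.
rewrite system_mxE; split=> [E|E]; last first.
  apply/rowP => e; have /matrixP := E.
  move=> /(_ (val (enum_val e : equations)).1 (val (enum_val e : equations)).2).
  by rewrite !mxE.
apply/matrixP => i j; rewrite [RHS]mxE.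
have [eij|neq] := boolP (equation (i, j)).
  have /rowP/(_ (enum_rank (Sub (i, j) eij : equations))) := E.
  rewrite mxE linear_rowE [quadratic_row _ _ _]mxE enum_rankK SubK [RHS]mxE => E'.
  by rewrite mxE.
(* Outside [equation] the truncated degree is 0, whereas unknowns have positive degree: the linear
   part vanishes, and a product of two unknowns cannot occur there either. *)
rewrite mxE linear_part_graded ?add0r => [|s ds]; last first.
  rewrite coord_subN //; apply: contra neq; rewrite /equation /=.
  move: ds; rewrite /degree_e /=.
  by case: s => [[[k l]|[k l]]|k] /= + => [? /andP[_ ?]|? /andP[_ ?]|?]; lia.
rewrite mxE [X in X + _]mxE [X in _ + X]mxE [X in - X]mxE.
rewrite !big1 ?subr0 // => k _.
  have [xik|/mat_x0->] := boolP (x_unknown i k); last by rewrite mul0r.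
  have [ykj|/mat_y0->] := boolP (y_unknown k j); last by rewrite mulr0.
  by case/negP: neq; move/andP: xik ykj => [_ ?] /andP[_ ?]; rewrite /equation /=; lia.
have [yik|/mat_y0->] := boolP (y_unknown i k); last by rewrite mul0r.
have [xkj|/mat_x0->] := boolP (x_unknown k j); last by rewrite mulr0.
by case/negP: neq; move/andP: yik xkj => [_ ?] /andP[_ ?]; rewrite /equation /=; lia.
Qed.

(* Surjectivity of the linear part, as injectivity of its transpose: the unknowns of
   x, y and j give the relations of [diagram_relations_eq0] for the entries of C. *)
Lemma linear_part_dual (C : 'M[K]_N) :
  (forall e, ~~ equation e -> C e.1 e.2 = 0) ->
  (forall u, \sum_i \sum_j
     linear_part (mat_x u) (mat_y u) (col_j u) i j * C i j = 0) ->
  C = 0.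
Proof.
move=> Csupp H.
pose delta s (us : unknown s) : 'rV[K]_nU := delta_mx 0 (enum_rank (Sub s us : unknowns)).
have deltaE s us x : coord_sub (delta s us) x = (s == x)%:R.
  by rewrite coord_sub_delta enum_rankK SubK.
(* [C] indexed by pairs of monomials and extended by zero, so that a shift by x or y may leave the
   diagram. *)
pose E (m m' : nat * nat) : K :=
  \sum_i (box i == m)%:R * \sum_j (box j == m')%:R * C i j.
have EE i j : E (box i) (box j) = C i j by rewrite /E !sum_box.
have EN m m' : ~~ in_diagram m'.1 m'.2 -> E m m' = 0.
  by move=> Dm'; rewrite /E big1 // => i _; rewrite sum_boxN // mulr0.
have row_sum i m : \sum_j (box j == m)%:R * C i j = E (box i) m.
  by rewrite /E sum_box.
have row_sumX i l : E (box i) ((box l).1.+1, (box l).2) = \sum_j X0 l j * C i j.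
  by rewrite -row_sum; apply: eq_bigr => j _; rewrite [X0 l j]mxE.
have row_sumY i l : E (box i) ((box l).1, (box l).2.+1) = \sum_j Y0 l j * C i j.
  by rewrite -row_sum; apply: eq_bigr => j _; rewrite [Y0 l j]mxE.
have col_sum m j : \sum_i (box i == m)%:R * C i j = E m (box j).
  by rewrite /E; apply: eq_bigr => i _; rewrite sum_box.
have mul_delta (A : 'M[K]_N) k l :
    \sum_i \sum_j (A *m delta_mx k l) i j * C i j = \sum_i A i k * C i l.
  apply: eq_bigr => i _; rewrite (bigD1 l) //= [X in _ + X]big1 ?addr0 => [|j jl].
    rewrite mxE (bigD1 k) //= big1 ?addr0 ?mxE ?eqxx ?mulr1 // => m mk.
    by rewrite mxE (negbTE mk) mulr0.
  rewrite mxE big1 ?mul0r // => m _.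
  by rewrite mxE (negbTE jl) andbF mulr0.
have delta_mul (A : 'M[K]_N) k l :
    \sum_i \sum_j (delta_mx k l *m A) i j * C i j = \sum_j A l j * C k j.
  rewrite (bigD1 k) //= [X in _ + X]big1 ?addr0 => [|i ik].
    apply: eq_bigr => j _; rewrite mxE (bigD1 l) //= big1 ?addr0 ?mxE ?eqxx ?mul1r //.
    by move=> m ml; rewrite mxE (negbTE ml) andbF mul0r.
  apply: big1 => j _; rewrite mxE big1 ?mul0r // => m _.
  by rewrite mxE (negbTE ik) mul0r.
have Hx k l : x_unknown k l ->
    \sum_i Y0 i k * C i l = E (box k) ((box l).1, (box l).2.+1).
  move=> us; have := H (delta (inl (inl (k, l))) us).
  have -> : mat_x (delta (inl (inl (k, l))) us) = delta_mx k l.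
    by apply/matrixP => i j; rewrite !mxE deltaE (inj_eq inl_inj) (inj_eq inl_inj) eq_sym.
  have -> : mat_y (delta (inl (inl (k, l))) us) = 0.
    by apply/matrixP => i j; rewrite !mxE deltaE.
  have -> : col_j (delta (inl (inl (k, l))) us) = 0.
    by apply/matrixP => i j; rewrite !mxE deltaE.
  rewrite /linear_part !mul0mx mulmx0 addr0 add0r addr0 => HH.
  rewrite row_sumY -mul_delta -delta_mul; apply/eqP; rewrite -subr_eq0 -sumrB -[X in _ == X]HH.
  apply/eqP; apply: eq_bigr => i _; rewrite -sumrB; apply: eq_bigr => j _.
  by rewrite -mulrBl; move: (Y0 *m _) (_ *m Y0) => A B; rewrite !mxE.
have Hy k l : y_unknown k l ->
    E (box k) ((box l).1.+1, (box l).2) = \sum_i X0 i k * C i l.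
  move=> us; have := H (delta (inl (inr (k, l))) us).
  have -> : mat_y (delta (inl (inr (k, l))) us) = delta_mx k l.
    by apply/matrixP => i j; rewrite !mxE deltaE (inj_eq inl_inj) (inj_eq inr_inj) eq_sym.
  have -> : mat_x (delta (inl (inr (k, l))) us) = 0.
    by apply/matrixP => i j; rewrite !mxE deltaE.
  have -> : col_j (delta (inl (inr (k, l))) us) = 0.
    by apply/matrixP => i j; rewrite !mxE deltaE.
  rewrite /linear_part !mul0mx mulmx0 addr0 add0r addr0 => HH.
  rewrite row_sumX -mul_delta -delta_mul; apply/eqP; rewrite -subr_eq0 -sumrB -[X in _ == X]HH.
  apply/eqP; apply: eq_bigr => i _; rewrite -sumrB; apply: eq_bigr => j _.
  by rewrite -mulrBl; move: (X0 *m _) (_ *m X0) => A B; rewrite !mxE.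
have Hj k : E (box k) (0, 0)%N = 0.
  have := H (delta (inr k) isT).
  have -> : mat_x (delta (inr k) isT) = 0.
    by apply/matrixP => i j; rewrite !mxE deltaE.
  have -> : mat_y (delta (inr k) isT) = 0.
    by apply/matrixP => i j; rewrite !mxE deltaE.
  have -> : col_j (delta (inr k) isT) = delta_mx k 0.
    by apply/matrixP => i j; rewrite !mxE deltaE (inj_eq inr_inj) eq_sym ord1 eqxx andbT.
  rewrite /linear_part !mul0mx !mulmx0 !addr0 subr0 add0r => E0.
  rewrite -[RHS]E0 -row_sum [RHS](bigD1 k) //= [X in _ = _ + X]big1 ?addr0 => [|i ik].
    by apply: eq_bigr => j _; rewrite mxE big_ord1 mxE !eqxx mul1r mxE.
  apply: big1 => j _; rewrite mxE big_ord1 mxE (negbTE ik) mul0r.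
  by rewrite mul0r.
apply/matrixP => i0 j0; rewrite -EE [RHS]mxE.
move: (in_diagram_box i0) (in_diagram_box j0).
rewrite [X in E X]surjective_pairing [X in E _ X]surjective_pairing.
move: (box i0).1 (box i0).2 (box j0).1 (box j0).2 => a b c d Dab _.
apply: (@diagram_relations_eq0 K in_diagram N in_diagram_down in_diagram_lt
  (fun a b c d => E (a, b) (c, d)) _ _ _ _ _ a b c d Dab) => {a b c d Dab}.
- move=> a b c d Dab; have [Dcd|Dcd] := boolP (in_diagram c d); last first.
    rewrite !EN //=; apply: contra Dcd => Dcd.
    exact: in_diagram_down Dcd (leqnSn _) (leqnn _).
  have Dab' : in_diagram a b := in_diagram_down Dab (leqnSn _) (leqnn _).
  case/in_diagramP: Dab => g gE; case/in_diagramP: Dcd => l lE.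
  case/in_diagramP: Dab' => g' gE'.
  rewrite -gE -lE -gE'; have [us|nus] := boolP (y_unknown g l).
    have := Hy _ _ us; rewrite lE /= => ->; rewrite -lE -col_sum.
    apply: eq_bigr => i _; rewrite mxE gE gE' (eq_sym (box i)) /=.
    by congr (_%:R * _); rewrite -!pair_eqE /= /pair_eq /= eqSS.
  (* Since g is off the first column, y_(g,l) can fail to be an unknown only by having no positive
     degree. Both sides then lie outside [equation], or outside the diagram, and are 0. The next
     three relations are treated in the same way. *)
  rewrite EE (Csupp (g', l)) /=; last first.
    apply: contra nus; rewrite /equation /y_unknown gE /=.
    by rewrite gE' lE /weight /= => ?; lia.
  have [/in_diagramP[l' lE']|Dl'] := boolP (in_diagram c.+1 d); last by rewrite EN.
  rewrite -lE' EE (Csupp (g, l')) //; apply: contra nus.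
  rewrite /equation /y_unknown gE lE' lE /weight /=; lia.
- move=> a b c d Dab nD; have [Dcd|Dcd] := boolP (in_diagram c d); last first.
    rewrite !EN //=; apply: contra Dcd => Dcd.
    exact: in_diagram_down Dcd (leqnn _) (leqnSn _).
  have Dab' : in_diagram a b := in_diagram_down Dab (leqnn _) (leqnSn _).
  case/in_diagramP: Dab => g gE; case/in_diagramP: Dcd => l lE.
  case/in_diagramP: Dab' => g' gE'.
  rewrite -gE -lE -gE'; have [us|nus] := boolP (x_unknown g l).
    have := Hx _ _ us; rewrite lE /= => <-; rewrite -lE -col_sum.
    apply: eq_bigr => i _; rewrite mxE gE gE' (eq_sym (box i)) /=.
    by congr (_%:R * _); rewrite -!pair_eqE /= /pair_eq /= eqSS.
  rewrite EE (Csupp (g', l)) /=; last first.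
    apply: contra nus; rewrite /equation /x_unknown gE nD /=.
    by rewrite gE' lE /weight /= => ?; lia.
  have [/in_diagramP[l' lE']|Dl'] := boolP (in_diagram c d.+1); last by rewrite EN.
  rewrite -lE' EE (Csupp (g, l')) //; apply: contra nus.
  rewrite /equation /x_unknown gE nD lE' lE /weight /=; lia.
- move=> a c d Da nD; have [Dcd|Dcd] := boolP (in_diagram c d); last first.
    rewrite EN //=; apply: contra Dcd => Dcd.
    exact: in_diagram_down Dcd (leqnn _) (leqnSn _).
  case/in_diagramP: Da => g gE; case/in_diagramP: Dcd => l lE.
  rewrite -gE; have [us|nus] := boolP (x_unknown g l).
    have := Hx _ _ us; rewrite lE /= => <-; apply: big1 => i _.
    by rewrite mxE gE -pair_eqE /pair_eq /= andbF mul0r.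
  have [/in_diagramP[l' lE']|Dl'] := boolP (in_diagram c d.+1); last by rewrite EN.
  rewrite -lE' EE (Csupp (g, l')) //; apply: contra nus.
  rewrite /equation /x_unknown gE nD lE' lE /weight /=; lia.
- move=> b c d Db nD; have [Dcd|Dcd] := boolP (in_diagram c d); last first.
    rewrite EN //=; apply: contra Dcd => Dcd.
    exact: in_diagram_down Dcd (leqnSn _) (leqnn _).
  case/in_diagramP: Db => g gE; case/in_diagramP: Dcd => l lE.
  rewrite -gE; have [us|nus] := boolP (y_unknown g l).
    have := Hy _ _ us; rewrite lE /= => ->; apply: big1 => i _.
    by rewrite mxE gE -pair_eqE /pair_eq /= mul0r.
  have [/in_diagramP[l' lE']|Dl'] := boolP (in_diagram c.+1 d); last by rewrite EN.
  rewrite -lE' EE (Csupp (g, l')) //; apply: contra nus.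
  rewrite /equation /y_unknown gE nD lE' lE /weight /=; lia.
- by move=> a b /in_diagramP[g <-]; rewrite Hj.
Qed.

Lemma system_mx_inj (c : 'cV[K]_nE) : system_mx *m c = 0 -> c = 0.
Proof.
move=> Lc; pose C : 'M[K]_N := \matrix_(i, j) coord_sub c^T (i, j).
have cE e : c e 0 = c^T 0 e by rewrite mxE.
have C0 : C = 0.
  apply: linear_part_dual => [[i j] neq|u]; first by rewrite mxE coord_subN.
  have : (u *m system_mx *m c) 0 0 = 0 by rewrite -mulmxA Lc mulmx0 mxE.
  rewrite mxE system_mxE pair_bigA /= => E0; rewrite -[RHS]E0.
  under [RHS]eq_bigr => e _ do rewrite linear_rowE cE.
  rewrite (sum_coord_sub (fun e => linear_part (mat_x u) (mat_y u) (col_j u) e.1 e.2)).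
  by apply: eq_bigr => -[i j] _; congr (_ * _); rewrite mxE.
apply/matrixP => e z; rewrite ord1 cE -coord_sub_val.
case: (val _) => i j.
by have := congr1 (fun A : 'M_N => A i j) C0; rewrite !mxE.
Qed.

(** The Pluecker vector of the ideal with multiplication matrices X and Y, written without the
    ideal: it is visibly polynomial in the entries and makes sense for any pair of matrices. *)
Definition minors (X Y : 'M[K]_N) : 'rV[K]_#|{: mono_tuple N}| :=
  \row_e \det (\matrix_(i < N) let ab := (enum_val e : mono_tuple N) i in
    v0 *m Y ^+ ab.2 *m X ^+ ab.1).

Lemma row_delta m (A : 'M[K]_(N, m)) i : (delta_mx 0 i : 'rV[K]_N) *m A = row i A.
Proof. by rewrite rowE. Qed.

Lemma v0_delta i : box i = (0, 0)%N -> v0 = delta_mx 0 i.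
Proof.
move=> E; apply/rowP => j; rewrite !mxE eqxx /= -E.
by rewrite (inj_eq box_inj).
Qed.

Lemma delta_mulX u i k : box k = ((box i).1.+1, (box i).2) ->
  delta_mx 0 i *m (X0 + mat_x u) = delta_mx 0 k :> 'rV[K]_N.
Proof.
move=> E; apply/rowP => j; rewrite row_delta mxE mxE mat_x0 ?addr0; last first.
  by rewrite /x_unknown negb_and negbK; apply/orP; left; apply/in_diagramP; exists k.
by rewrite !mxE eqxx /= -E (inj_eq box_inj).
Qed.

Lemma delta_mulY u i k : (box i).1 = 0%N -> box k = ((box i).1, (box i).2.+1) ->
  delta_mx 0 i *m (Y0 + mat_y u) = delta_mx 0 k :> 'rV[K]_N.
Proof.
move=> i0 E; apply/rowP => j; rewrite row_delta mxE mxE mat_y0 ?addr0; last first.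
  rewrite /y_unknown negb_and {1}i0 /= negbK; apply/orP; left.
  by apply/in_diagramP; exists k.
by rewrite !mxE eqxx /= -E (inj_eq box_inj).
Qed.

Lemma expmxSr (A : 'M[K]_N) a : A ^+ a.+1 = A ^+ a *m A.
Proof. by rewrite exprSr. Qed.

(** The box is reached from the origin by going up the first column and then along its row. The rows
    of the matrices met on this walk are those that contain no unknowns. *)
Lemma standard_basis u i :
  v0 *m (Y0 + mat_y u) ^+ (box i).2 *m (X0 + mat_x u) ^+ (box i).1 = delta_mx 0 i.
Proof.
have colE b j : box j = (0%N, b) -> v0 *m (Y0 + mat_y u) ^+ b = delta_mx 0 j.
  elim: b j => [|b IH] j jE; first by rewrite expr0 mulmx1 (v0_delta jE).
  have /in_diagramP[k kE] : in_diagram 0 b.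
    by apply: (in_diagram_down (in_diagram_box j)); rewrite jE.
  by rewrite expmxSr mulmxA (IH k kE) (@delta_mulY u k j) ?kE.
case iE: (box i) => [a b] /=; elim: a i iE => [|a IH] i iE.
  by rewrite expr0 mulmx1 (colE b i).
have /in_diagramP[k kE] : in_diagram a b.
  by apply: (in_diagram_down (in_diagram_box i)); rewrite iE.
by rewrite expmxSr mulmxA (IH k kE) (@delta_mulX u k i) ?kE.
Qed.

Lemma mulmx_neq0 (r : 'rV[K]_N) (A : 'M[K]_N) j :
  (r *m A) 0 j != 0 -> exists2 k, r 0 k != 0 & A k j != 0.
Proof.
rewrite mxE => H; apply: contrapT => no; case/eqP: H; apply: big1 => k _.
have [->|rk] := eqVneq (r 0 k) 0; first by rewrite mul0r.
have [->|Ak] := eqVneq (A k j) 0; first by rewrite mulr0.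
by case: no; exists k.
Qed.

Lemma lowers_mulX u a b r :
  lowers (a, b) r -> lowers (a.+1, b) (r *m (X0 + mat_x u)).
Proof.
move=> lr j /mulmx_neq0[k /lr rk]; rewrite mxE.
have [/mat_x0->|] := boolP (~~ x_unknown k j).
  rewrite addr0 mxE; case: (box j =P _) => [jE _|_]; last by rewrite eqxx.
  case/orP: rk => [/eqP kE|kw]; first by rewrite jE kE eqxx.
  by apply/orP; right; move: kw; rewrite jE /weight /=; lia.
rewrite negbK => /andP[_ jk] _; apply/orP; right; case/orP: rk => [/eqP kE|kw].
  by move: jk; rewrite kE /weight /=; lia.
by move: jk kw; rewrite /weight /=; lia.
Qed.

Lemma lowers_mulY u a b r :
  lowers (a, b) r -> lowers (a, b.+1) (r *m (Y0 + mat_y u)).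
Proof.
move=> lr j /mulmx_neq0[k /lr rk]; rewrite mxE.
have [/mat_y0->|] := boolP (~~ y_unknown k j).
  rewrite addr0 mxE; case: (box j =P _) => [jE _|_]; last by rewrite eqxx.
  case/orP: rk => [/eqP kE|kw]; first by rewrite jE kE eqxx.
  by apply/orP; right; move: kw; rewrite jE /weight /=; lia.
rewrite negbK => /andP[_ jk] _; apply/orP; right; case/orP: rk => [/eqP kE|kw].
  by move: jk; rewrite kE /weight /=; lia.
by move: jk kw; rewrite /weight /=; lia.
Qed.

Lemma lowers_monomial u a b :
  lowers (a, b) (v0 *m (Y0 + mat_y u) ^+ b *m (X0 + mat_x u) ^+ a).
Proof.
elim: a => [|a IH]; last by rewrite expmxSr mulmxA; apply: lowers_mulX.
rewrite expr0 mulmx1; elim: b => [|b IH].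
  rewrite expr0 mulmx1 => j; rewrite mxE; case: (box j =P _) => [->//|_].
  by rewrite eqxx.
by rewrite expmxSr mulmxA; apply: lowers_mulY.
Qed.

Hypothesis char0 : forall n, n.+1%:R != 0 :> K.

Lemma solution_ideal u : u *m system_mx + quadratic_row u = 0 ->
  exists (I : set Kxy) (phi : {linear Kxy -> 'rV[K]_N}),
    [/\ is_ideal I, quotient_map I phi, normal_map phi /\ lowering_map phi,
        pluecker phi = minors (X0 + mat_x u) (Y0 + mat_y u) &
        [/\ col_j u = 0, forall f, phi ('X_ord0 * f) = phi f *m (X0 + mat_x u) &
            forall f, phi ('X_ord_max * f) = phi f *m (Y0 + mat_y u)]].
Proof.
(* At box i the row v0 Y^b X^a is the i-th basis vector, so the trace identity reads off the i-th
   entry of the covector. *)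
move=> /system_solution E; have w0 : col_j u = 0.
  apply/matrixP => i z; rewrite ord1 [RHS]mxE.
  have := comm_rank1_eq0 char0 E (box i).1 (box i).2.
  by rewrite standard_basis row_delta => /matrixP/(_ 0 0); rewrite !mxE.
move: E; rewrite w0 mul0mx addr0 => /eqP; rewrite subr_eq0 => /eqP/esym XY.
have [I [phi [idI qphi phiE phix phiy]]] :=
  commuting_quotient XY (standard_basis u).
exists I, phi; split=> //; last 1 first.
- apply/rowP => e; rewrite !mxE; congr (\det _).
  by apply/row_matrixP => i; rewrite !rowK /= phiE.
split; first by move=> i; rewrite phiE (standard_basis u i).
by move=> a b; rewrite phiE; apply: lowers_monomial.
Qed.

Definition coordinates (z : 'rV[K]_#|{: mono_tuple N}|) : 'rV[K]_nU :=
  row_sub_of unknown (fun s => match s with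
    | inl (inl (i, j)) => chart_x t z i j - X0 i j
    | inl (inr (i, j)) => chart_y t z i j - Y0 i j
    | inr _ => 0
    end).

Lemma normal_origin phi : normal_map phi -> phi (xy K 0 0) = v0.
Proof.
move=> tE; apply/rowP => j; have /in_diagramP[i iE] : in_diagram 0 0.
  exact: in_diagram_down (in_diagram_box j) (leq0n _) (leq0n _).
have := tE i; rewrite -[nat_of_ord (t i).1]/(box i).1 -[nat_of_ord (t i).2]/(box i).2.
by rewrite iE => ->; rewrite (v0_delta iE).
Qed.

Lemma normal_in_diagram phi i a b : normal_map phi -> box i = (a, b) ->
  phi (xy K a b) = delta_mx 0 i.
Proof.
move=> /(_ i); rewrite -[nat_of_ord (t i).1]/(box i).1 -[nat_of_ord (t i).2]/(box i).2.
by move=> <- ->.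
Qed.

(** The multiplication matrices of an ideal in the stratum differ from [X0] and [Y0] only at
    unknowns: [normal_map] fixes the rows that lead to another basis monomial, and [lowering_map]
    excludes entries of degree at most 0 other than those of the monomial ideal. *)
Lemma ideal_coordinates (I : set Kxy) (phi : {linear Kxy -> 'rV[K]_N}) :
  is_ideal I -> quotient_map I phi -> normal_map phi -> lowering_map phi ->
  let u := coordinates (pluecker phi) in
  u *m system_mx + quadratic_row u = 0 /\
  minors (X0 + mat_x u) (Y0 + mat_y u) = pluecker phi.
Proof.
move=> idI qphi tE low u; set z := pluecker phi in u *.
have [phix phiy phiE] := chart_pluecker t_lt idI qphi tE; rewrite -/z in phix phiy phiE.
have rowx i : row i (chart_x t z) = phi (xy K (box i).1.+1 (box i).2).
  rewrite -row_delta -(tE i) -phix; congr (phi _).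
  by rewrite /xy exprS mulrA.
have rowy i : row i (chart_y t z) = phi (xy K (box i).1 (box i).2.+1).
  rewrite -row_delta -(tE i) -phiy; congr (phi _).
  by rewrite /xy exprS mulrCA.
have XE : X0 + mat_x u = chart_x t z.
  apply/matrixP => i j; rewrite mxE [mat_x u i j]mxE coord_sub_of.
  case: ifPn => [_|/=]; first by rewrite addrC subrK.
  have -> : chart_x t z i j = phi (xy K (box i).1.+1 (box i).2) 0 j.
    by rewrite -rowx [RHS]mxE.
  rewrite /x_unknown addr0 negb_and negbK => /orP[/in_diagramP[k kE]|nw].
    by rewrite (normal_in_diagram tE kE) !mxE eqxx -kE (inj_eq box_inj).
  rewrite mxE; have [jE|jE] := eqVneq (box j) ((box i).1.+1, (box i).2).
    by rewrite (normal_in_diagram tE jE) mxE !eqxx.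
  apply/esym/eqP; apply: contraNT nw => /low; rewrite (negbTE jE) /=.
  by rewrite /weight /=; lia.
have YE : Y0 + mat_y u = chart_y t z.
  apply/matrixP => i j; rewrite mxE [mat_y u i j]mxE coord_sub_of.
  case: ifPn => [_|/=]; first by rewrite addrC subrK.
  have -> : chart_y t z i j = phi (xy K (box i).1 (box i).2.+1) 0 j.
    by rewrite -rowy [RHS]mxE.
  rewrite /y_unknown addr0 negb_and negb_or negbK => /orP[/andP[_ /in_diagramP[k kE]]|nw].
    by rewrite (normal_in_diagram tE kE) !mxE eqxx -kE (inj_eq box_inj).
  rewrite mxE; have [jE|jE] := eqVneq (box j) ((box i).1, (box i).2.+1).
    by rewrite (normal_in_diagram tE jE) mxE !eqxx.
  apply/esym/eqP; apply: contraNT nw => /low; rewrite (negbTE jE) /=.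
  by rewrite /weight /=; lia.
have w0 : col_j u = 0.
  by apply/matrixP => i j; rewrite !mxE coord_sub_of.
split.
  apply/system_solution; rewrite w0 mul0mx addr0 XE YE; apply/eqP.
  rewrite subr_eq0; apply/eqP/row_matrixP => i.
  by rewrite -!row_delta !mulmxA -(tE i) -!phiy -!phix -!phiy mulrCA.
rewrite XE YE; apply/rowP => e; rewrite !mxE; congr (\det _).
apply/row_matrixP => i; rewrite !rowK /= phiE /chart_quotient; congr (_ *m _ *m _).
by rewrite -(normal_origin tE) phiE /chart_quotient !expr0 !mulmx1.
Qed.

Lemma polyfun_coord_sub n (F : 'rV[K]_n -> 'rV[K]_nU) s :
  (forall i, polyfun (fun v => F v 0 i)) -> polyfun (fun v => coord_sub (F v) s).
Proof.
move=> pF; rewrite /coord_sub; case: insub => [s'|]; first exact: pF.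
exact: polyfunC.
Qed.

Theorem class_stratum (lc : locally_closed stratum) :
  class (Variety lc) = LL K ^+ (nU - nE).
Proof.
have [||||f [g [pf pg gsol fg gf]]] := @graded_elimination K nU nE
  (fun s => degree_u (val (enum_val s : unknowns)))
  (fun e => degree_e (val (enum_val e : equations))) system_mx quadratic_row.
- exact: system_mx_graded.
- exact: system_mx_inj.
- move=> e.
  pose ij := val (enum_val e : equations).
  apply: (@polyfun_ext _ _ (fun u => (mat_y u *m mat_x u) ij.1 ij.2 -
      (mat_x u *m mat_y u) ij.1 ij.2)).
    move=> u; rewrite [RHS]mxE; move: (_ *m _) (mat_x u *m _) => A B.
    by rewrite !mxE.
  have pX i j : polyfun (fun u => mat_x u i j).
    apply: (@polyfun_ext _ _ (fun u => coord_sub u (inl (inl (i, j))))).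
      by move=> u; rewrite mxE.
    by apply: (polyfun_coord_sub (F := id)) => k; apply: polyfunX.
  have pY i j : polyfun (fun u => mat_y u i j).
    apply: (@polyfun_ext _ _ (fun u => coord_sub u (inl (inr (i, j))))).
      by move=> u; rewrite mxE.
    by apply: (polyfun_coord_sub (F := id)) => k; apply: polyfunX.
  by apply: polyfunB; apply: polyfun_mulmx.
- exact: quadratic_row_low.
apply: (@class_affine_chart K _ stratum lc (enum_rank t) _
  (fun z => f (coordinates z))
  (fun w => minors (X0 + mat_x (g w)) (Y0 + mat_y (g w)))).
- move=> _ [I [phi [c [_ _ [tE _] c0 ->]]]].
  by rewrite mxE (pluecker_normal tE) mulr1.
- move=> i; apply: (polyfun_subst (pf i)) => s.
  case E: (val (enum_val s : unknowns)) => [[[k l]|[k l]]|k].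
  + apply: (@polyfun_ext _ _ (fun z => chart_x t z k l - X0 k l)).
      by move=> z; rewrite [RHS]mxE E.
    by apply: polyfunB; [exact: polyfun_chart_x|exact: polyfunC].
  + apply: (@polyfun_ext _ _ (fun z => chart_y t z k l - Y0 k l)).
      by move=> z; rewrite [RHS]mxE E.
    by apply: polyfunB; [exact: polyfun_chart_y|exact: polyfunC].
  + apply: (@polyfun_ext _ _ (fun z => 0)); last exact: polyfunC.
    by move=> z; rewrite [RHS]mxE E.
- move=> e; have pX i j : polyfun (fun w => (X0 + mat_x (g w)) i j).
    apply: (@polyfun_ext _ _ (fun w => X0 i j + coord_sub (g w) (inl (inl (i, j))))).
      by move=> w; rewrite [RHS]mxE [mat_x _ _ _]mxE.
    by apply: polyfunD; [exact: polyfunC|exact: polyfun_coord_sub].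
  have pY i j : polyfun (fun w => (Y0 + mat_y (g w)) i j).
    apply: (@polyfun_ext _ _ (fun w => Y0 i j + coord_sub (g w) (inl (inr (i, j))))).
      by move=> w; rewrite [RHS]mxE [mat_y _ _ _]mxE.
    by apply: polyfunD; [exact: polyfunC|exact: polyfun_coord_sub].
  apply: (polyfun_ext _ (polyfun_det _)) => [w|i j]; first by rewrite mxE.
  pose ab := (enum_val e : mono_tuple N) i.
  apply: (@polyfun_ext _ _ (fun w => (v0 *m (Y0 + mat_y (g w)) ^+ ab.2
     *m (X0 + mat_x (g w)) ^+ ab.1) 0 j)).
    by move=> w; rewrite [RHS]mxE.
  apply: polyfun_mulmx; last exact: polyfun_expmx pX.
  by apply: polyfun_mulmx; [move=> *; exact: polyfunC|exact: polyfun_expmx pY].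
- move=> _ [I [phi [c [idI qphi [tE low] c0 ->]]]].
  rewrite mxE (pluecker_normal tE) mulr1 => ->; rewrite scale1r.
  by have [sol mE] := ideal_coordinates idI qphi tE low; rewrite (gf _ sol).
move=> w; have [I [phi [idI qphi [tE low] zE [w0 phix phiy]]]] := solution_ideal (gsol w).
rewrite -zE; split.
- by exists I, phi, 1; rewrite oner_neq0 scale1r.
- exact: pluecker_normal.
rewrite -[RHS]fg; congr f; apply/rowP => s; rewrite mxE -coord_sub_val.
(* The chart matrices of the ideal built from [g w] are the matrices it was built from, because both
   multiply the basis rows alike; [coordinates] therefore returns [g w], whose covector part is
   0. *)
have [cx cy _] := chart_pluecker t_lt idI qphi tE.
have deltaP (A B : 'M[K]_N) : (forall f, phi f *m A = phi f *m B) -> A = B.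
  by move=> H; apply/row_matrixP => i; rewrite -!row_delta -(tE i) H.
have <- : X0 + mat_x (g w) = chart_x t (pluecker phi).
  by apply: deltaP => h; rewrite -phix cx.
have <- : Y0 + mat_y (g w) = chart_y t (pluecker phi).
  by apply: deltaP => h; rewrite -phiy cy.
case: (val _) => [[[k l]|[k l]]|k].
- by rewrite [(X0 + _) k l]mxE addrAC subrr add0r mxE.
- by rewrite [(Y0 + _) k l]mxE addrAC subrr add0r mxE.
by have /matrixP/(_ k 0) := w0; rewrite !mxE.
Qed.

End Stratum.

(** * Decomposition into strata *)

Lemma det_neq0_perm (R : comNzRingType) N (A : 'M[R]_N) :
  \det A != 0 -> exists s : 'S_N, forall i, A i (s i) != 0.
Proof.
move=> dA; apply: contrapT => no; case/negP: dA; apply/eqP.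
rewrite /determinant big1 // => s _.
suff [i Ai] : exists i, A i (s i) = 0 by rewrite (bigD1 i) //= Ai mul0r mulr0.
apply: contrapT => noi; apply: no; exists s => i; apply/negP => /eqP Ai.
by apply: noi; exists i.
Qed.

(** * Standard monomials of an ideal *)

Section MonomialOrder.
Variable k : nat.
Hypothesis k_gt0 : (0 < k)%N.

Definition level (m : nat * nat) := (m.1 + k * m.2)%N.

(* An injective numbering of the monomials that is compatible with
   multiplication; it compares levels first, then exponents of y. *)
Definition mono_rank (m : nat * nat) := (level m * (level m).+1 + m.2)%N.

Lemma mono_rank_lt m m' : (mono_rank m < mono_rank m')%N =
  (level m < level m')%N || (level m == level m') && (m.2 < m'.2)%N.
Proof.
rewrite /mono_rank; have : (m.2 <= level m)%N by rewrite /level; nia.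
have : (m'.2 <= level m')%N by rewrite /level; nia.
move: (level m) (level m') => a b; have [ab|ab|->] := ltngtP a b => /=.
- by move=> *; apply/idP; nia.
- by move=> *; apply/negbTE; rewrite -leqNgt; nia.
- by rewrite ltn_add2l.
Qed.

Lemma mono_rank_inj m m' : mono_rank m = mono_rank m' -> m = m'.
Proof.
move=> E; have := mono_rank_lt m m'; have := mono_rank_lt m' m.
rewrite E ltnn; case: ltngtP => //= EL; case: ltngtP => //= E2 _ _.
case: m m' E EL E2 => [a b] [c d] /= _ + bd; rewrite /level /= bd.
by move=> /addIn ->.
Qed.

Lemma mono_rank_mulx m m' : (mono_rank m < mono_rank m')%N ->
  (mono_rank (m.1.+1, m.2) < mono_rank (m'.1.+1, m'.2))%N.
Proof. by rewrite !mono_rank_lt /level /=; lia. Qed.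

Lemma mono_rank_muly m m' : (mono_rank m < mono_rank m')%N ->
  (mono_rank (m.1, m.2.+1) < mono_rank (m'.1, m'.2.+1))%N.
Proof. by rewrite !mono_rank_lt /level /=; lia. Qed.

Lemma mono_rank_le_level m m' :
  (mono_rank m <= mono_rank m')%N -> (level m <= level m')%N.
Proof. by rewrite leqNgt mono_rank_lt negb_or -leqNgt => /andP[]. Qed.

Section StandardMonomials.
Variables (K : closedFieldType) (N : nat).
Local Notation Kxy := {mpoly K[2]}.
Variables (I : set Kxy) (phi : {linear Kxy -> 'rV[K]_N}).
Hypotheses (idI : is_ideal I) (qphi : quotient_map I phi).

Local Notation values w :=
  (\matrix_(i < N) phi (xy K (w i : nat * nat).1 (w i : nat * nat).2)).

(** The standard monomials for the order of [mono_rank], characterized as the monomial basis of the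
    quotient of least total rank. This gives their existence without a division algorithm. *)
Definition minimal_basis (w : 'I_N -> nat * nat) :=
  \det (values w) != 0 /\ forall w', \det (values w') != 0 ->
    (\sum_i mono_rank (w i) <= \sum_i mono_rank (w' i))%N.

Lemma minimal_basis_exists : exists w, minimal_basis w.
Proof.
have [u du] := quotient_basis idI qphi.
pose P s := `[< exists2 w : 'I_N -> nat * nat, \det (values w) != 0 &
                  (\sum_i mono_rank (w i))%N = s >].
have exP : exists s, P s.
  by eexists; apply/asboolP; exists (fun i => ((u i).1 : nat, (u i).2 : nat)).
case: (ex_minnP exP) => s /asboolP[w dw <-] w_min.
by exists w; split=> // w' dw'; apply: w_min; apply/asboolP; exists w'.
Qed.

Variable w : 'I_N -> nat * nat.
Hypothesis w_min : minimal_basis w.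
Hypothesis w_normal : forall i, phi (xy K (w i).1 (w i).2) = delta_mx 0 i.

(* Exchange: otherwise replacing [w j] by the monomial gives a smaller basis. *)
Lemma minimal_basis_rank m j :
  phi (xy K m.1 m.2) 0 j != 0 -> (mono_rank (w j) <= mono_rank m)%N.
Proof.
move=> mj; pose w' i := if i == j then m else w i.
have : \det (values w') != 0.
  apply/det0P => -[v v0 vM]; case/negP: v0; apply/eqP.
  have vE l : v 0 j * phi (xy K m.1 m.2) 0 l + (l != j)%:R * v 0 l = 0.
    have := congr1 (fun r : 'rV_N => r 0 l) vM; rewrite !mxE (bigD1 j) //= => <-.
    rewrite mxE /w' eqxx; congr (_ + _); have [->|lj] := eqVneq l j.
      rewrite mul0r big1 // => i ij; rewrite mxE (negbTE ij) w_normal mxE /=.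
      by rewrite eq_sym (negbTE ij) mulr0.
    rewrite mul1r (bigD1 l) //= big1 ?addr0 => [|i /andP[ij il]].
      by rewrite mxE (negbTE lj) w_normal mxE !eqxx mulr1.
    by rewrite mxE (negbTE ij) w_normal mxE eq_sym (negbTE il) andbF mulr0.
  have vj : v 0 j = 0.
    have /eqP := vE j; rewrite eqxx mul0r addr0 mulf_eq0 (negbTE mj) orbF.
    by move/eqP.
  apply/rowP => l; rewrite [RHS]mxE; have [->//|lj] := eqVneq l j.
  by have := vE l; rewrite vj mul0r add0r lj mul1r.
move=> /(w_min.2 w'); rewrite (bigD1 j) //= [leqRHS](bigD1 j) //= /w' eqxx.
rewrite [X in (_ <= _ + X)%N](eq_bigr (fun i => mono_rank (w i))) ?leq_add2r // => i ij.
by rewrite (negbTE ij).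
Qed.

Lemma minimal_basis_inj : injective w.
Proof.
move=> i j E; have /rowP/(_ j) := w_normal i.
rewrite E w_normal !mxE !eqxx /=; case: eqP => [->//|_] /esym/eqP.
by rewrite eq_sym oner_eq0.
Qed.

(** If m were not standard, its class would be a combination of standard monomials of smaller rank.
    Multiplication by g keeps the ranks strictly below that of g m = w j, and expanding again never
    produces w j, although the coefficient of w j in itself is 1. *)
Lemma minimal_basis_pred (g : Kxy) (s : nat * nat -> nat * nat) m j :
  (forall m, g * xy K m.1 m.2 = xy K (s m).1 (s m).2) ->
  (forall m m', (mono_rank m < mono_rank m')%N ->
     (mono_rank (s m) < mono_rank (s m'))%N) ->
  w j = s m -> exists i, w i = m.
Proof.
move=> gs s_mono wj; apply: contrapT => no.
have [X phiX] := quotient_mul idI qphi g.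
have /rowP/(_ j) := w_normal j; rewrite mxE !eqxx wj -gs phiX mxE big1 => [|l _].
  by move/eqP; rewrite eq_sym oner_eq0.
have [->|ml] := eqVneq (phi (xy K m.1 m.2) 0 l) 0; first by rewrite mul0r.
have -> : X l j = phi (xy K (s (w l)).1 (s (w l)).2) 0 j.
  by rewrite -gs phiX w_normal -rowE mxE.
have [->|lj] := eqVneq (phi (xy K (s (w l)).1 (s (w l)).2) 0 j) 0.
  by rewrite mulr0.
have := minimal_basis_rank lj; rewrite wj leqNgt s_mono //.
have := minimal_basis_rank ml; rewrite leq_eqVlt => /orP[/eqP E|//].
by case: no; exists l; apply: mono_rank_inj.
Qed.

Lemma minimal_basis_down j a b :
  (a <= (w j).1)%N -> (b <= (w j).2)%N -> exists i, w i = (a, b).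
Proof.
have px i m : w i = (m.1.+1, m.2) -> exists i, w i = m.
  apply: (@minimal_basis_pred 'X_ord0 (fun m => (m.1.+1, m.2))).
    by move=> m'; rewrite /xy exprS mulrA.
  exact: mono_rank_mulx.
have py i m : w i = (m.1, m.2.+1) -> exists i, w i = m.
  apply: (@minimal_basis_pred 'X_ord_max (fun m => (m.1, m.2.+1))).
    by move=> m'; rewrite /xy exprS mulrCA.
  exact: mono_rank_muly.
move=> aj bj; have [r ra] : exists r, ((w j).1 = a + r)%N.
  by exists ((w j).1 - a)%N; rewrite subnKC.
have [s sb] : exists s, ((w j).2 = b + s)%N.
  by exists ((w j).2 - b)%N; rewrite subnKC.
have {aj bj ra sb} : w j = ((a + r)%N, (b + s)%N).
  by rewrite -ra -sb -surjective_pairing.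
elim: r j => [|r IHr] j; last first.
  by rewrite addnS => /(px j (_, _))[i /IHr].
rewrite addn0; elim: s j => [|s IHs] j; first by rewrite addn0; exists j.
by rewrite addnS => /(py j (_, _))[i /IHs].
Qed.

(** A nonzero Leibniz term of a minor with monomials in S matches each [w i] with a monomial of S
    whose class involves [w i], hence of at least its rank and level. *)
Lemma minimal_basis_spans (S : set (nat * nat)) :
  (forall m m', S m' -> (level m <= level m')%N -> S m) ->
  spans_mod I (monomial_span S) -> forall i, S (w i).
Proof.
move=> Slow /(spans_modP S idI qphi)[u [Su du]] i.
have [s us] := det_neq0_perm du.
have := us ((s^-1)%g i); rewrite mxE permKV => /minimal_basis_rank/mono_rank_le_level.
by apply: Slow; apply: Su.
Qed.

End StandardMonomials.
End MonomialOrder.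

Section Normalization.
Variables (K : closedFieldType) (N k : nat).
Local Notation Kxy := {mpoly K[2]}.
Local Notation values phi w :=
  (\matrix_(i < N) phi (xy K (w i : nat * nat).1 (w i : nat * nat).2)).

Lemma quotient_map_change (I : set Kxy) (phi psi : {linear Kxy -> 'rV[K]_N}) :
  quotient_map I phi -> quotient_map I psi ->
  exists B : 'M[K]_N, forall f, psi f = phi f *m B.
Proof.
move=> [sphi kphi] [_ kpsi].
have /choice[r rE] := fun i : 'I_N => sphi (delta_mx 0 i).
exists (\matrix_i psi (r i)) => f.
have /kphi/kpsi : phi (f - \sum_i phi f 0 i *: r i) = 0.
  rewrite linearB linear_sum /=; under eq_bigr do rewrite linearZ /= rE.
  by rewrite -row_sum_delta subrr.
rewrite linearB /= => /eqP; rewrite subr_eq0 => /eqP ->.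
rewrite linear_sum mulmx_sum_row; apply: eq_bigr => i _.
by rewrite linearZ rowK.
Qed.

Lemma values_change (phi psi : {linear Kxy -> 'rV[K]_N}) (B : 'M[K]_N) w :
  (forall f, psi f = phi f *m B) -> values psi w = values phi w *m B.
Proof. by move=> E; apply/row_matrixP => i; rewrite row_mul !rowK E. Qed.

(** Two quotient maps of one ideal differ by a matrix on the right, so a monomial tuple that is a
    basis for [psi] is one for [phi], and minimality carries over. *)
Lemma minimal_normalize (I : set Kxy) (phi : {linear Kxy -> 'rV[K]_N}) w :
  quotient_map I phi -> minimal_basis k phi w ->
  exists psi : {linear Kxy -> 'rV[K]_N},
    [/\ quotient_map I psi, forall i, psi (xy K (w i).1 (w i).2) = delta_mx 0 i,
        minimal_basis k psi w &
        exists2 d : K, d != 0 & pluecker phi = d *: pluecker psi].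
Proof.
move=> qphi [dw w_min].
have [psi [qpsi psiE pE]] :=
  @normalize_quotient K I N phi (fun i => xy K (w i).1 (w i).2) qphi dw.
have [B BE] := quotient_map_change qphi qpsi.
have detE w' : \det (values psi w') != 0 -> \det (values phi w') != 0.
  by rewrite (values_change _ BE) det_mulmx mulf_eq0 negb_or => /andP[].
exists psi; split=> //; last first.
  by eexists; [exact: dw|rewrite pE scalerA divff // scale1r].
split=> [|w' /detE]; last exact: w_min.
rewrite (_ : values psi w = 1%:M) ?det1 ?oner_neq0 //.
by apply/row_matrixP => i; rewrite rowK psiE row1.
Qed.

End Normalization.

(** * The filtration of the open set by total weight *)

Section Strata.
Variables (K : closedFieldType) (k n N : nat).
Hypothesis (k_gt0 : (0 < k)%N) (n_gt0 : (0 < n)%N).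
Hypothesis char0 : forall m, m.+1%:R != 0 :> K.
Local Notation grid := ('I_(k * n) * 'I_n)%type.
Local Notation Kxy := {mpoly K[2]}.

(** Besides being closed downwards, the boxes must be exponents of monomials of V_(k,n); these are
    the diagrams that Dyck paths produce. *)
Definition young_diagram (D : {set grid}) :=
  [forall s in D, (s.1 + k * s.2 + k + 1 <= k * n)%N &&
    [forall u : grid, (u.1 <= s.1)%N && (u.2 <= s.2)%N ==> (u \in D)]].

Definition grid_pair (s : grid) : nat * nat := (s.1 : nat, s.2 : nat).

(** Boxes are listed in the order of [enum]. For a diagram with N boxes the default (0, 0) is never
    read, and [inord] is exact by [young_lt]. *)
Definition diagram_tuple (D : {set grid}) : mono_tuple N :=
  [ffun i : 'I_N => let m := nth (0, 0)%N [seq grid_pair s | s <- enum D] i in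
     (inord m.1, inord m.2)].

Lemma grid_pair_inj : injective grid_pair.
Proof. by move=> [a b] [c d] [/val_inj -> /val_inj ->]. Qed.

(* Weights refining the order of [mono_rank] on the monomials with y-degree at
   most n. *)
Definition px : nat := n.+1.
Definition py : nat := (k * n.+1).+1.

Lemma weight_level m : weight px py m = (px * level k m + m.2)%N.
Proof. by clear; rewrite /weight /level /px /py; nia. Qed.

Lemma mono_rank_weight m m' : (m.2 <= n)%N ->
  (mono_rank k m < mono_rank k m')%N -> (weight px py m < weight px py m')%N.
Proof.
rewrite mono_rank_lt // !weight_level /px => mn.
by move=> /orP[|/andP[/eqP -> ?]]; [nia|lia].
Qed.

Section YoungDiagram.
Variable D : {set grid}.
Hypothesis D_young : young_diagram D.
Hypothesis D_card : #|D| = N.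

Lemma young_V (s : grid) : s \in D -> (s.1 + k * s.2 + k + 1 <= k * n)%N.
Proof. by move/forallP/(_ s): D_young => /implyP H /H /andP[]. Qed.

Lemma young_down (s u : grid) : s \in D -> (u.1 <= s.1)%N -> (u.2 <= s.2)%N -> u \in D.
Proof.
move/forallP/(_ s): D_young => /implyP H /H /andP[_ /forallP/(_ u)/implyP {}H].
by move=> u1 u2; apply: H; rewrite u1.
Qed.

Lemma young_lt (s : grid) : s \in D -> (s.1 < N)%N && (s.2 < N)%N.
Proof.
case: s => a b sD; rewrite -D_card /=; apply/andP; split.
  pose f (i : 'I_a.+1) : grid := (widen_ord (ltn_ord a) i, b).
  have f_inj : injective f by move=> i j [/val_inj].
  rewrite -(card_ord a.+1) -cardsT -(card_imset _ f_inj).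
  apply/subset_leq_card/fintype.subsetP => _ /imsetP[i _ ->].
  by apply: young_down sD _ _; rewrite //= -ltnS.
pose f (i : 'I_b.+1) : grid := (a, widen_ord (ltn_ord b) i).
have f_inj : injective f by move=> i j [/val_inj].
rewrite -(card_ord b.+1) -cardsT -(card_imset _ f_inj).
apply/subset_leq_card/fintype.subsetP => _ /imsetP[i _ ->].
by apply: young_down sD _ _; rewrite //= -ltnS.
Qed.

Lemma diagram_boxE s0 (i : 'I_N) :
  box (diagram_tuple D) i = grid_pair (nth s0 (enum D) i) /\ nth s0 (enum D) i \in D.
Proof.
have iD : (i < size (enum D))%N by rewrite -cardE D_card.
have sD : nth s0 (enum D) i \in D by rewrite -mem_enum mem_nth.
have /andP[l1 l2] := young_lt sD; split=> //.
by rewrite /box ffunE (nth_map s0) //= !inordK // ltnW // ltnS.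
Qed.

Lemma diagram_box i : exists2 s, s \in D & box (diagram_tuple D) i = grid_pair s.
Proof.
have [s0 _] : exists s, s \in D.
  by apply/set0Pn; rewrite -card_gt0 D_card; apply: leq_ltn_trans (ltn_ord i).
by have [iE iD] := diagram_boxE s0 i; exists (nth s0 (enum D) i).
Qed.

Lemma diagram_box_ex s : s \in D -> exists i, box (diagram_tuple D) i = grid_pair s.
Proof.
move=> sD; have iD : (index s (enum D) < N)%N by rewrite -D_card cardE index_mem mem_enum.
by exists (Ordinal iD); rewrite (diagram_boxE s _).1 nth_index ?mem_enum.
Qed.

Lemma diagram_tuple_inj : injective (diagram_tuple D).
Proof.
move=> i j E; have [s0 _ _] := diagram_box i.
have {E} : box (diagram_tuple D) i = box (diagram_tuple D) j by rewrite /box E.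
rewrite !(diagram_boxE s0 _).1 => /grid_pair_inj/eqP.
by rewrite nth_uniq ?enum_uniq -?cardE ?D_card // => /eqP/val_inj.
Qed.

Lemma in_diagram_grid (s : grid) : in_diagram (diagram_tuple D) s.1 s.2 = (s \in D).
Proof.
apply/idP/idP => [/in_diagramP[i]|/diagram_box_ex[i iE]].
  by have [u uD ->] := diagram_box i; rewrite -/(grid_pair s) => /grid_pair_inj <-.
by apply/in_diagramP; exists i.
Qed.

Lemma diagram_tuple_down i a b :
  (a <= (diagram_tuple D i).1)%N -> (b <= (diagram_tuple D i).2)%N ->
  in_diagram (diagram_tuple D) a b.
Proof.
have [s sD [-> ->]] := diagram_box i => a_le b_le.
pose u : grid := (Ordinal (leq_ltn_trans a_le (ltn_ord s.1)),
                  Ordinal (leq_ltn_trans b_le (ltn_ord s.2))).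
by rewrite -[a]/(val u.1) -[b]/(val u.2) in_diagram_grid; apply: young_down sD _ _.
Qed.

End YoungDiagram.
Definition diagrams : {set {set grid}} := [set D | young_diagram D & #|D| == N].

Local Notation stratum_of D := (@stratum K N (diagram_tuple D) px py).

Definition total_weight (D : {set grid}) :=
  (\sum_i weight px py (box (diagram_tuple D) i))%N.

(* A nonzero Leibniz term of the minor matches each box of [D] with a box of [D']
   that is equal or of smaller weight. *)
Lemma stratum_compare D D' z : D \in diagrams -> D' \in diagrams ->
  stratum_of D' z -> z 0 (enum_rank (diagram_tuple D)) != 0 ->
  (total_weight D' < total_weight D)%N \/ D = D'.
Proof.
rewrite !inE => /andP[yD /eqP cD] /andP[yD' /eqP cD'].
move=> [I [phi [c [idI qphi [tE low] c0 ->]]]].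
rewrite !mxE enum_rankK mulf_eq0 (negbTE c0) /= => dz.
have [s us'] := det_neq0_perm dz.
have us i : phi (xy K (diagram_tuple D i).1 (diagram_tuple D i).2) 0 (s i) != 0.
  by have := us' i; rewrite mxE.
have wle i : (weight px py (box (diagram_tuple D') (s i))
    <= weight px py (box (diagram_tuple D) i) ?= iff
    (box (diagram_tuple D') (s i) == box (diagram_tuple D) i))%N.
  have /orP[/eqP ->|lt] := low _ _ _ (us i); first by rewrite /leqif leqnn !eqxx.
  rewrite /leqif ltnW // ltn_eqF //; split=> //; apply/esym/negbTE.
  by apply: contraTneq lt => ->; rewrite ltnn.
have := leqif_sum (fun i _ => wle i) (P := xpredT).
have -> : (\sum_i weight px py (box (diagram_tuple D') (s i)))%N = total_weight D'.
  by rewrite /total_weight [RHS](reindex_inj (@perm_inj _ s)).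
rewrite -/(total_weight D).
move=> [le eqE]; have [|ltW] := leqP (total_weight D) (total_weight D'); last by left.
move=> ge; right; move: eqE; rewrite eqn_leq le ge /= => /esym/forallP sE.
apply/eqP; rewrite eqEcard cD cD' leqnn andbT; apply/fintype.subsetP => u uD.
have [i iE] := diagram_box_ex yD cD uD.
have [v vD'] := diagram_box yD' cD' (s i).
by have /eqP -> := sE i; rewrite iE => /grid_pair_inj ->.
Qed.

Lemma stratum_neq0 D z : stratum_of D z -> z 0 (enum_rank (diagram_tuple D)) != 0.
Proof.
by move=> [I [phi [c [_ _ [tE _] c0 ->]]]]; rewrite mxE (pluecker_normal tE) mulr1.
Qed.

Definition strata (s : seq {set grid}) : set 'rV[K]_#|{: mono_tuple N}| :=
  [set z | exists2 D, D \in s & stratum_of D z].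

(** The head of the sorted list has least total weight, so by [stratum_compare] its Pluecker
    coordinate vanishes on all later strata and nowhere on its own. The later strata are thus closed
    in the union, and the scissor relation peels off the head. *)
Lemma class_strata (s : seq {set grid}) (lc : locally_closed (strata s)) :
  {subset s <= diagrams} -> uniq s ->
  sorted (fun D D' => total_weight D <= total_weight D')%N s ->
  class (Variety lc) = \sum_(D <- s) LL K ^+
    (#|{: {x | unknown (diagram_tuple D) px py x}}| -
     #|{: {e | equation (diagram_tuple D) px py e}}|).
Proof.
elim: s lc => [|D s IH] lc sD us ss.
  rewrite big_nil; suff E : strata [::] = set0.
    have lc0 : locally_closed (set0 : set 'rV[K]_#|{: mono_tuple N}|) by rewrite -E.
    by rewrite (eq_class_vset lc lc0) // class_set0.
  by apply/seteqP; split=> z // -[].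
have DD : D \in diagrams by apply: sD; rewrite mem_head.
have D_min D' : D' \in s -> (total_weight D <= total_weight D')%N.
  move: ss; rewrite /= path_sortedE => [/andP[/allP H _]|D1 D2 D3]; first exact: H.
  exact: leq_trans.
have Dz D' z : D' \in s -> stratum_of D' z -> z 0 (enum_rank (diagram_tuple D)) = 0.
  move=> D's z'; apply/eqP; apply: contraT => zD.
  have D'D : D' \in diagrams by apply: sD; rewrite in_cons D's orbT.
  have [|E] := stratum_compare DD D'D z' zD; first by rewrite ltnNge D_min.
  by move: us; rewrite /= E D's.
have clB : closed_in (strata s) (strata (D :: s)).
  exists [set 'X_(enum_rank (diagram_tuple D))]; split=> [_ ->|z].
    by exists 1%N; rewrite dhomogX /= mdeg1.
  split=> [[D' D's z']|[[D']]].
    split; first by exists D' => //; rewrite in_cons D's orbT.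
    by move=> _ ->; rewrite mevalXU (Dz D').
  rewrite in_cons => /orP[/eqP ->|D's] z' /(_ _ erefl); last by exists D'.
  by rewrite mevalXU => /eqP; rewrite (negbTE (stratum_neq0 z')).
have lcB := lc_closed_in lc clB.
have lcC := lc_setD lc clB.
rewrite (class_scissor lc lcB lcC clB) big_cons addrC; congr (_ + _); last first.
  apply: IH => //; first by move=> D' D's; apply: sD; rewrite in_cons D's orbT.
    by case/andP: us.
  by move: ss => /= /path_sorted.
have CE : strata (D :: s) `\` strata s = stratum_of D.
  apply/seteqP; split=> z.
    move=> [[D']]; rewrite in_cons => /orP[/eqP ->//|D's] z' nz.
    by case: nz; exists D'.
  move=> zD; split; first by exists D; rewrite ?mem_head.
  by move=> [D' D's /(Dz _ _ D's)/eqP]; rewrite (negbTE (stratum_neq0 zD)).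
have lcD : locally_closed (stratum_of D) by rewrite -CE.
have /andP[yD /eqP cD] : young_diagram D && (#|D| == N) by move: DD; rewrite inE.
rewrite (eq_class_vset lcC lcD) // class_stratum //.
- exact: diagram_tuple_inj yD cD.
- exact: diagram_tuple_down yD cD.
Qed.

Lemma hilb_kn_strata :
  hilb_locus (fun I => spans_mod I (monomial_span (Vkn_monomials k n))) =
  strata (enum diagrams).
Proof.
apply/seteqP; split=> z; last first.
  move=> [D]; rewrite mem_enum inE => /andP[yD /eqP cD].
  move=> [I [phi [c [idI qphi [tE _] c0 ->]]]].
  exists I, phi, c; split=> //; apply/(spans_modP _ idI qphi).
  exists (box (diagram_tuple D)); split=> [i|].
    have [s sD ->] := diagram_box yD cD i.
    have H := young_V yD sD; exact: H.
  rewrite (_ : \matrix_i _ = 1%:M) ?det1 ?oner_neq0 //.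
  by apply/row_matrixP => i; rewrite rowK row1 -tE.
move=> [I [phi [c [idI qphi PI c0 ->]]]].
have [w w_min] := minimal_basis_exists k idI qphi.
have [psi [qpsi psiE psi_min [d d0 dE]]] := minimal_normalize qphi w_min.
have w_inj := minimal_basis_inj psiE.
have w_down := minimal_basis_down k_gt0 idI qpsi psi_min psiE.
have w_V i : Vkn_monomials k n (w i).
  apply: (minimal_basis_spans k_gt0 idI qpsi psi_min psiE _ PI).
  by move=> m m'; rewrite /Vkn_monomials /level /=; lia.
have w_lt i : ((w i).1 < k * n)%N && ((w i).2 < n)%N.
  by have := w_V i; rewrite /Vkn_monomials /= => wi; apply/andP; split; nia.
have /choice[g gE] i : exists s : grid, grid_pair s = w i.
  have /andP[l1 l2] := w_lt i; exists (Ordinal l1, Ordinal l2).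
  by rewrite [RHS]surjective_pairing.
have g_inj : injective g by move=> i j E; apply: w_inj; rewrite -!gE E.
pose D := [set g i | i : 'I_N].
have cD : #|D| = N by rewrite card_imset // card_ord.
have yD : young_diagram D.
  apply/forallP => s; apply/implyP => /imsetP[i _ sE].
  apply/andP; split; first by have := w_V i; rewrite -gE -sE.
  apply/forallP => u; apply/implyP => /andP[u1 u2].
  have [||j jE] := w_down i u.1 u.2; rewrite -?gE -?sE //.
  apply/imsetP; exists j => //; apply: grid_pair_inj.
  by rewrite gE jE.
have DD : D \in diagrams by rewrite inE yD cD eqxx.
exists D; first by rewrite mem_enum.
(* [diagram_tuple] lists the boxes in the order of [enum], the minimal basis in an order of its own.
   The permutation [s] matches them, and the quotient map is normalized again for the new order. *)
have /choice[s sE] i : exists j, box (diagram_tuple D) i = w j.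
  have [u /imsetP[j _ ->] ->] := diagram_box yD cD i; by exists j.
have s_inj : injective s.
  by move=> i j E; apply: (box_inj (diagram_tuple_inj yD cD)); rewrite !sE E.
have ws_min : minimal_basis k psi (w \o s).
  split.
    apply/det0P => -[v v0 /rowP vM]; case/negP: v0; apply/eqP/rowP => i.
    have := vM (s i); rewrite !mxE (bigD1 i) //= big1 ?addr0 => [|j ji].
      by rewrite mxE psiE mxE !eqxx mulr1.
    by rewrite mxE psiE mxE (inj_eq s_inj) eq_sym (negbTE ji) andbF mulr0.
  move=> w' /psi_min.2; rewrite [X in (X <= _)%N](reindex_inj s_inj); exact.
have [chi [qchi chiE chi_min [d' d0' dE']]] := minimal_normalize qpsi ws_min.
exists I, chi, (c * (d * d')); split=> //; last 1 first.
- by rewrite dE dE' !scalerA mulrA.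
- split=> [i|a b j chij].
    by rewrite -chiE /= -sE.
  (* Equal rank means that the box is the monomial itself; smaller rank gives smaller weight because
     the y-degree of a standard monomial stays below n. *)
  have := minimal_basis_rank chi_min chiE (m := (a, b)) chij.
  rewrite leq_eqVlt => /orP[/eqP/mono_rank_inj E|/mono_rank_weight lt].
    by rewrite sE -E // eqxx.
  rewrite sE lt ?orbT //=; have /andP[_] := w_lt (s j); exact: ltnW.
by rewrite !mulf_neq0.
Qed.

End Strata.

(** * Dimension of the strata *)

Section Counting.
Local Open Scope nat_scope.

Lemma initial_count (P : pred nat) n b :
  (forall c, P c.+1 -> P c) -> (forall c, P c -> c < n) ->
  P b = (b < \sum_(0 <= c < n) P c).
Proof.
move=> P_down P_lt; have down c c' : c <= c' -> P c' -> P c.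
  by move=> cc'; rewrite -(subnK cc'); elim: (c' - c) => // r IH /P_down/IH.
apply/idP/idP => [Pb|].
  rewrite (big_cat_nat (n := b.+1)) //=; last exact: P_lt.
  rewrite (eq_big_nat _ _ (F2 := fun=> 1)) => [|c /andP[_ cb]].
    by rewrite sum_nat_const_nat muln1 subn0 leq_addr.
  by rewrite (down c b).
apply: contraTT => nPb; rewrite -leqNgt; have [bn|nb] := leqP b n.
  rewrite (big_cat_nat (n := b)) //= [X in _ + X](_ : _ = 0) ?addn0; last first.
    rewrite big_nat_cond big1 // => c /andP[/andP[bc _] _].
    by rewrite (negbTE (contra (down b c bc) nPb)).
  apply: leq_trans (leq_sum _ (fun c _ => leq_b1 (P c))) _.
  by rewrite sum_nat_const_nat muln1 subn0.
apply: leq_trans (leq_sum _ (fun c _ => leq_b1 (P c))) _.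
by rewrite sum_nat_const_nat muln1 subn0 ltnW.
Qed.

(** A monotone sequence passes the level w at most once, and does so between u and v exactly when f
    u <= w < f v. *)
Lemma sum_crossing (f : nat -> nat) w u v : u <= v ->
  (forall a, f a <= f a.+1) ->
  \sum_(u <= a < v) ((f a <= w) && (w < f a.+1)) + (w < f u) = (w < f v).
Proof.
move=> uv f_mono; elim: v uv => [|v IH].
  by rewrite leqn0 => /eqP ->; rewrite big_geq.
rewrite leq_eqVlt => /orP[/eqP ->|uv]; first by rewrite big_geq.
rewrite big_nat_recr //= addnAC IH //.
by have := f_mono v; case: (ltnP w (f v)); case: (ltnP w (f v.+1)) => //=; lia.
Qed.

Lemma sum_eq_const n c : \sum_(0 <= x < n) (x == c) = (c < n).
Proof.
have [cn|nc] := ltnP c n; last first.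
  rewrite big_nat_cond big1 // => x /andP[/andP[_ xn] _].
  by case: eqP => // E; move: xn; rewrite E ltnNge nc.
rewrite big_mkord (bigD1 (Ordinal cn)) //= eqxx big1 // => i.
by rewrite -val_eqE /= => /negbTE ->.
Qed.

Lemma sum_nat_from m n (f : nat -> nat) : m <= n ->
  \sum_(m <= b < n) f b = \sum_(0 <= b < n) (m <= b) * f b.
Proof.
move=> mn; rewrite [RHS](big_cat_nat (n := m)) //= [X in X + _](_ : _ = 0) ?add0n.
  by apply: eq_big_nat => b /andP[-> _]; rewrite mul1n.
by rewrite big_nat_cond big1 // => b /andP[/andP[_ bm] _]; rewrite leqNgt bm.
Qed.

Variables (k n A : nat) (D : rel nat).
Hypothesis k_gt0 : 0 < k.
Hypothesis D_down : forall i j i' j', D i j -> i' <= i -> j' <= j -> D i' j'.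
Hypothesis D_lt : forall i j, D i j -> (i < A) && (j < n).

Definition row_length b := \sum_(0 <= a < A) D a b.
Definition column_height a := \sum_(0 <= b < n) D a b.
Local Notation la := row_length.
Local Notation ht := column_height.

Lemma row_lengthP a b : D a b = (a < la b).
Proof.
by apply: initial_count => c Dc; [apply: D_down Dc _ _|case/andP: (D_lt Dc)].
Qed.

Lemma column_heightP a b : D a b = (b < ht a).
Proof.
by apply: initial_count => c Dc; [apply: D_down Dc _ _|case/andP: (D_lt Dc)].
Qed.

Lemma row_length_mono b b' : b <= b' -> la b' <= la b.
Proof.
move=> bb'; rewrite leqNgt -row_lengthP; apply/negP => Db.
by have := D_down Db (leqnn _) bb'; rewrite row_lengthP ltnn.
Qed.

Lemma row_length0 b : n <= b -> la b = 0.
Proof.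
move=> nb; apply/eqP; rewrite -leqn0 leqNgt -row_lengthP.
by apply/negP => /D_lt/andP[_]; rewrite ltnNge nb.
Qed.

Lemma column_height_le a : ht a <= n.
Proof.
rewrite leqNgt -column_heightP.
by apply/negP => /D_lt/andP[_]; rewrite ltnn.
Qed.

Local Notation w a b := (weight (px n) (py k n) (a, b)).

Let w_lt a b c d : b <= n -> d <= n ->
  (w a b < w c d) = (a + k * b < c + k * d) || (a + k * b == c + k * d) && (b < d).
Proof.
move=> bn dn; rewrite !weight_level /level /px /=.
move: (a + k * b) (c + k * d) => x y.
have [xy|yx|->] := ltngtP x y => /=.
- by apply/idP; nia.
- by apply/negbTE; rewrite -leqNgt; nia.
- by rewrite ltn_add2l.
Qed.

Let w_mono b a : w a b <= w a.+1 b.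
Proof. by rewrite /weight /=; lia. Qed.

Let w_monoy a b : w a b <= w a b.+1.
Proof. by rewrite /weight /=; lia. Qed.

Definition count_row r x y := \sum_(0 <= a < la r) (w a r < w x y).
(** The boxes of row r whose weight is passed by the vertical boundary step from (la b, b) to (la b,
    b + 1). *)
Definition crossings r b :=
  \sum_(0 <= a < la r) ((w (la b) b <= w a r) && (w a r < w (la b) b.+1)).

Lemma count_row_crossings r b :
  count_row r (la b) b + crossings r b = count_row r (la b) b.+1.
Proof.
rewrite -big_split; apply: eq_bigr => a _ /=.
have := w_monoy (la b) b; case: (ltnP (w a r) (w (la b) b)) => /=; last by rewrite add0n.
by move=> lt le; rewrite (leq_trans lt le).
Qed.

(* The boundary of the diagram is followed from the top of the y-axis down to row
   [b]; the column steps are the second sum on the left. *)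
Lemma boundary_crossings v b : b <= n ->
  (v < w 0 n) + \sum_(0 <= a < la b) ((w a (ht a) <= v) && (v < w a.+1 (ht a)))
  = (v < w (la b) b)
    + \sum_(b <= c < n) ((w (la c) c <= v) && (v < w (la c) c.+1)).
Proof.
move=> bn; have [r] : exists r, n = b + r by exists (n - b); rewrite subnKC.
elim: r b {bn} => [|r IH] b nE.
  by rewrite row_length0 ?nE ?addn0 // !big_geq // ?nE ?addn0.
have bn : b < n by rewrite nE -ltn_psubLR ?subnn.
have {IH} := IH b.+1; rewrite addSnnS => /(_ nE) IH.
have le_la : la b.+1 <= la b by apply: row_length_mono.
rewrite (big_ltn bn) (big_cat_nat (n := la b.+1)) //=.
have htE a : la b.+1 <= a < la b -> ht a = b.+1.
  rewrite leqNgt -!row_lengthP !column_heightP -ltnNge ltnS.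
  by move=> /andP[h1 h2]; apply/eqP; rewrite eqn_leq h1 h2.
have S : \sum_(la b.+1 <= a < la b) ((w a (ht a) <= v) && (v < w a.+1 (ht a)))
    + (v < w (la b.+1) b.+1) = (v < w (la b) b.+1).
  rewrite -(sum_crossing v le_la (w_mono b.+1)).
  by congr (_ + _); apply: eq_big_nat => a /htE ->.
have d : (v < w (la b) b) + ((w (la b) b <= v) && (v < w (la b) b.+1))
    = (v < w (la b) b.+1).
  by have := w_monoy (la b) b; case: ltnP => //= lt le; rewrite (leq_trans lt le).
by lia.
Qed.

Definition box_arm a r := ht a - r.+1.
Definition box_leg a r := la r - a.+1.

(** [boundary_crossings] is summed over the boxes (x, r). The horizontal step on top of column a
    passes only the weight of x = a + 1 + k (ht a - r), and this x lies in row r exactly when k (arm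
    + 1) < leg. *)
Lemma count_row_arm_leg r : r < n ->
  count_row r 0 n + \sum_(0 <= a < la r) (k * (box_arm a r + 1) < box_leg a r)
  = la r + \sum_(r <= b < n) crossings r b.
Proof.
move=> rn; transitivity (\sum_(0 <= x < la r) ((w x r < w 0 n) +
    \sum_(0 <= a < la r) ((w a (ht a) <= w x r) && (w x r < w a.+1 (ht a))))).
  rewrite big_split /=; congr (_ + _); rewrite exchange_big_nat /=.
  apply: eq_big_nat => a /andP[_ ar].
  rewrite -[LHS](_ : (a.+1 + k * (ht a - r) < la r) = _ :> nat); last first.
    congr nat_of_bool; rewrite /box_arm /box_leg.
    by move: ar; rewrite -row_lengthP column_heightP => ?; apply/idP/idP; nia.
  rewrite -sum_eq_const; apply: eq_big_nat => x /andP[_ xr]; congr nat_of_bool.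
  have hn := column_height_le a.
  move: ar; rewrite -row_lengthP column_heightP => rh.
  rewrite [w a _ <= _]leqNgt !w_lt //; [|exact: ltnW|exact: ltnW].
  by apply/idP/idP; nia.
rewrite (eq_bigr _ (fun x _ => boundary_crossings (w x r) (ltnW rn))).
rewrite big_split /= exchange_big_nat; congr (_ + _).
rewrite (eq_big_nat _ _ (F2 := fun=> 1)) ?sum_nat_const_nat ?muln1 ?subn0 //.
by move=> x /andP[_ xr]; rewrite !w_lt ?(ltnW rn) //; apply/eqP; rewrite eqb1; lia.
Qed.

(** Up column a the levels grow by k, and the step at the end of row r covers exactly k consecutive
    levels. It passes one box above row r if the top of the column reaches its lowest level, that is
    if leg < k arm, and none otherwise. *)
Lemma crossings_below_arm_leg r : r < n ->
  \sum_(r.+1 <= r' < n) crossings r' r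
  = \sum_(0 <= a < la r) (box_leg a r < k * box_arm a r).
Proof.
move=> rn.
transitivity (\sum_(r.+1 <= r' < n) \sum_(0 <= a < la r)
    (D a r' && ((w (la r) r <= w a r') && (w a r' < w (la r) r.+1)))).
  apply: eq_big_nat => r' /andP[rr' _]; have lr : la r' <= la r.
    exact/row_length_mono/ltnW.
  rewrite [RHS](big_cat_nat (n := la r')) //= [X in _ + X](_ : _ = 0) ?addn0.
    by apply: eq_big_nat => a /andP[_ ar']; rewrite row_lengthP ar'.
  rewrite big_nat_cond big1 // => a /andP[/andP[ra _] _].
  by rewrite row_lengthP ltnNge ra.
rewrite exchange_big_nat /=; apply: eq_big_nat => a /andP[_ ar].
have hn := column_height_le a.
move: (ar); rewrite -row_lengthP column_heightP => rh.
rewrite (big_cat_nat (n := ht a)) //= [X in _ + X](_ : _ = 0) ?addn0; last first.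
  rewrite big_nat_cond big1 // => r' /andP[/andP[hr' _] _].
  by rewrite column_heightP ltnNge hr'.
(* The predecessors turn the condition level >= la r + k r into a strict crossing of the level
   below. *)
have := @sum_crossing (fun r' => a + k * r'.-1) (la r + k * r).-1 r.+1 (ht a) rh.
rewrite (_ : ((la r + k * r).-1 < a + k * r.+1.-1) = false) ?addn0; last first.
  by apply/negbTE; rewrite -leqNgt /=; lia.
have -> : ((la r + k * r).-1 < a + k * (ht a).-1) = (box_leg a r < k * box_arm a r).
  by rewrite /box_leg /box_arm; apply/idP/idP; nia.
move=> <- => [|r']; last by rewrite leq_add2l leq_pmul2l //; lia.
apply: eq_big_nat => r' /andP[rr' r'h]; congr nat_of_bool.
have r'n : r' <= n by apply: leq_trans (ltnW r'h) hn.
rewrite column_heightP r'h /= [w _ r <= _]leqNgt !w_lt ?(ltnW rn) //.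
by apply/idP/idP; nia.
Qed.

Lemma arm_leg_total r :
  \sum_(0 <= a < la r) (k * (box_arm a r + 1) < box_leg a r)
  + \sum_(0 <= a < la r) (box_leg a r < k * box_arm a r)
  + \sum_(0 <= a < la r) (k * box_arm a r <= box_leg a r <= k * (box_arm a r + 1))
  = la r.
Proof.
transitivity (\sum_(0 <= a < la r) 1); last first.
  by rewrite sum_nat_const_nat subn0 muln1.
rewrite -!big_split /=; apply: eq_bigr => a _; rewrite mulnDr muln1.
by have := leq_addr k (k * box_arm a r); do 3!case: ltngtP => //=; lia.
Qed.

Definition count_below x y := \sum_(0 <= r < n) count_row r x y.
Definition count_stat := \sum_(0 <= r < n) \sum_(0 <= a < la r)
  (k * box_arm a r <= box_leg a r <= k * (box_arm a r + 1)).

(** The crossings of row r by the step at row b are split by r <= b or r > b. The two halves count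
    the boxes with leg too large and with leg too small, and [arm_leg_total] leaves those of b_k. *)
Lemma count_stat_boundary :
  count_below 0 n + \sum_(0 <= b < n) count_below (la b) b
  = count_stat + \sum_(0 <= b < n) count_below (la b) b.+1.
Proof.
have E b : count_below (la b) b + \sum_(0 <= r < n) crossings r b = count_below (la b) b.+1.
  by rewrite -big_split; apply: eq_bigr => r _; apply: count_row_crossings.
have -> : \sum_(0 <= b < n) count_below (la b) b.+1 = \sum_(0 <= b < n) count_below (la b) b
    + \sum_(0 <= r < n) \sum_(0 <= b < n) crossings r b.
  rewrite [X in _ = _ + X]exchange_big_nat -[RHS]big_split.
  by apply: eq_bigr => b _; exact: esym (E b).
have S : \sum_(0 <= r < n) \sum_(0 <= b < n) crossings r b =
    \sum_(0 <= r < n) (\sum_(r <= b < n) crossings r b)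
    + \sum_(0 <= r < n) (\sum_(r.+1 <= r' < n) crossings r' r).
  rewrite [X in _ = X + _](eq_big_nat _ _ (F2 := fun r =>
    \sum_(0 <= b < n) (r <= b) * crossings r b));
    last by move=> r /andP[_ rn]; exact: sum_nat_from (ltnW rn).
  rewrite [X in _ = _ + X](eq_big_nat _ _ (F2 := fun r =>
    \sum_(0 <= r' < n) (r < r') * crossings r' r));
    last by move=> r /andP[_ rn]; exact: sum_nat_from.
  rewrite [X in _ = _ + X]exchange_big_nat -[RHS]big_split; apply: eq_bigr => r _.
  rewrite -[RHS]big_split; apply: eq_bigr => b _ /=.
  by case: leqP => _; rewrite !(mul0n, mul1n, addn0, add0n).
rewrite S /count_below /count_stat.
have T1 : \sum_(0 <= r < n) count_row r 0 n + \sum_(0 <= r < n)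
      \sum_(0 <= a < la r) (k * (box_arm a r + 1) < box_leg a r)
    = \sum_(0 <= r < n) la r + \sum_(0 <= r < n) \sum_(r <= b < n) crossings r b.
  by rewrite -!big_split; apply: eq_big_nat => r /andP[_ rn]; apply: count_row_arm_leg.
have T2 : \sum_(0 <= r < n) (\sum_(r.+1 <= r' < n) crossings r' r)
   = \sum_(0 <= r < n) \sum_(0 <= a < la r) (box_leg a r < k * box_arm a r).
  by apply: eq_big_nat => r /andP[_ rn]; apply: crossings_below_arm_leg.
have T3 : \sum_(0 <= r < n) la r
    = \sum_(0 <= r < n) \sum_(0 <= a < la r) (k * (box_arm a r + 1) < box_leg a r)
    + \sum_(0 <= r < n) \sum_(0 <= a < la r) (box_leg a r < k * box_arm a r)
    + \sum_(0 <= r < n) \sum_(0 <= a < la r)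
        (k * box_arm a r <= box_leg a r <= k * (box_arm a r + 1)).
  by rewrite -!big_split; apply: eq_bigr => r _; exact: esym (arm_leg_total r).
move: T1; rewrite T2 T3; lia.
Qed.

(* Summed over the rows, the last terms on both sides telescope. *)
Definition row_unknowns b := (0 < la b) * count_below (la b) b
  + \sum_(0 <= a < la b) ((0 < a) || (la b.+1 == 0)) * count_below a b.+1.
Definition row_equations b := \sum_(0 <= a < la b) count_below a.+1 b.+1.

Lemma row_unknowns_equations b :
  row_unknowns b + count_below (la b) b.+1 + (la b == 0) * count_below 0 b
  = count_below (la b) b + row_equations b + (la b.+1 == 0) * count_below 0 b.+1.
Proof.
rewrite /row_unknowns /row_equations; have [l0|l0] := posnP (la b).
  have -> : la b.+1 = 0 by apply/eqP; rewrite -leqn0 -l0 row_length_mono.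
  by rewrite l0 !big_geq // eqxx !mul1n !mul0n; lia.
rewrite /= mul1n mul0n addn0.
have -> : \sum_(0 <= a < la b) ((0 < a) || (la b.+1 == 0)) * count_below a b.+1
    = (la b.+1 == 0) * count_below 0 b.+1 + \sum_(1 <= a < la b) count_below a b.+1.
  rewrite big_ltn //; congr (_ + _); apply: eq_big_nat => a /andP[a0 _].
  by rewrite a0 mul1n.
have -> : \sum_(0 <= a < la b) count_below a.+1 b.+1
    = \sum_(1 <= a < la b) count_below a b.+1 + count_below (la b) b.+1.
  by case: (la b) l0 => // l _; rewrite big_add1 /= big_nat_recr.
lia.
Qed.

Lemma sum_unknowns_equations :
  \sum_(0 <= b < n) row_unknowns b = count_stat + \sum_(0 <= b < n) row_equations b.
Proof.
have tele m : m <= n ->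
    \sum_(0 <= b < m) row_unknowns b + \sum_(0 <= b < m) count_below (la b) b.+1
  = \sum_(0 <= b < m) count_below (la b) b + \sum_(0 <= b < m) row_equations b
    + (la m == 0) * count_below 0 m.
  elim: m => [|m IH] mn.
    rewrite !big_geq // /count_below /count_row big1 ?muln0 // => r _.
    by rewrite big1 // => a _; rewrite [w 0 0]/(px n * 0 + _ * 0) !muln0.
  rewrite !big_nat_recr //=; have := IH (ltnW mn).
  have := row_unknowns_equations m; lia.
have := tele n (leqnn n); rewrite row_length0 // eqxx mul1n.
have := count_stat_boundary; lia.
Qed.

End Counting.

(** * From box counts to the exponent b_k + |D| *)

Section Dimension.
Local Open Scope nat_scope.

Lemma sum_nat_delta n x (f : nat -> nat) : x < n ->
  \sum_(0 <= a < n) (a == x) * f a = f x.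
Proof.
move=> xn; rewrite big_mkord (bigD1 (Ordinal xn)) //= eqxx mul1n big1 ?addn0 // => i.
by rewrite -val_eqE /= => /negbTE ->.
Qed.

Lemma sum_nat_initial n m (f : nat -> nat) : m <= n ->
  \sum_(0 <= a < n) (a < m) * f a = \sum_(0 <= a < m) f a.
Proof.
move=> mn; rewrite (big_cat_nat (n := m)) //= [X in _ + X](_ : _ = 0) ?addn0.
  by apply: eq_big_nat => a /andP[_ ->]; rewrite mul1n.
by rewrite big_nat_cond big1 // => a /andP[/andP[ma _] _]; rewrite ltnNge ma.
Qed.

Lemma card_sum (T : finType) (P : pred T) : #|P| = \sum_x P x.
Proof.
rewrite -sum1_card big_mkcond; apply: eq_bigr => x _.
by rewrite unfold_in; case: (P x).
Qed.

Variables (k n N : nat) (D : {set 'I_(k * n) * 'I_n}).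
Hypothesis k_gt0 : 0 < k.
Hypothesis D_young : young_diagram D.
Hypothesis D_card : #|D| = N.

Local Notation t := (diagram_tuple N D).
Local Notation DD := (in_diagram t).
Local Notation la := (row_length (k * n) DD).
Local Notation ht := (column_height n DD).

Let DD_down i j i' j' : DD i j -> i' <= i -> j' <= j -> DD i' j'.
Proof. exact: (in_diagram_down (diagram_tuple_down D_young D_card)). Qed.

Let DD_lt i j : DD i j -> (i < k * n) && (j < n).
Proof.
move=> /in_diagramP[x]; have [s _ ->] := diagram_box D_young D_card x.
by rewrite /grid_pair => -[<- <-]; rewrite !ltn_ord.
Qed.

Let DDE a b : DD a b = (a < la b) := row_lengthP DD_down DD_lt a b.
Let DDhE a b : DD a b = (b < ht a) := column_heightP DD_down DD_lt a b.

Let la_le b : la b <= k * n.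
Proof.
rewrite leqNgt -DDE; apply/negP => /DD_lt/andP[].
by rewrite ltnn.
Qed.

Let ht_le a : ht a <= n := column_height_le DD_down DD_lt a.

Lemma sum_diagram (f : nat -> nat -> nat) :
  \sum_(0 <= b < n) \sum_(0 <= a < k * n) DD a b * f a b
  = \sum_(0 <= b < n) \sum_(0 <= a < la b) f a b.
Proof.
apply: eq_big_nat => b _; rewrite -[RHS](sum_nat_initial (n := k * n)) //.
by apply: eq_bigr => a _; rewrite DDE.
Qed.

Lemma sum_box_diagram (f : nat -> nat -> nat) :
  \sum_(i < N) f (box t i).1 (box t i).2
  = \sum_(0 <= b < n) \sum_(0 <= a < la b) f a b.
Proof.
have b_inj := box_inj (diagram_tuple_inj D_young D_card).
have Blt i : ((box t i).1 < k * n) && ((box t i).2 < n).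
  exact: DD_lt (in_diagram_box t i).
have DDP a b : reflect (exists i, box t i = (a, b)) (DD a b) := in_diagramP t a b.
rewrite -sum_diagram; move: b_inj Blt DDP; move: (box t) (DD) => B DB b_inj Blt DDP.
 transitivity (\sum_(i < N) \sum_(0 <= b < n)
    (b == (B i).2) * \sum_(0 <= a < k * n) (a == (B i).1) * f a b).
  apply: eq_bigr => i _; have /andP[l1 l2] := Blt i.
  by rewrite sum_nat_delta // sum_nat_delta.
rewrite exchange_big; apply: eq_bigr => b _ /=.
under eq_bigr => i _ do rewrite big_distrr /=.
rewrite exchange_big; apply: eq_bigr => a _ /=.
case: (boolP (DB a b)) => [/DDP[i iE]|nD].
  rewrite (bigD1 i) //= iE !eqxx !mul1n big1 ?addn0 // => j ji.
  case: eqP => // bE; case: eqP => [aE|_]; last by rewrite muln0.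
  by case/eqP: ji; apply: b_inj; rewrite iE aE bE -surjective_pairing.
rewrite mul0n big1 // => i _; case: eqP => // bE; case: eqP => [aE|_]; last by rewrite muln0.
by case/DDP: nD; exists i; rewrite aE bE -surjective_pairing.
Qed.

Lemma sum_grid_diagram (f : nat -> nat -> nat) :
  \sum_(s in D) f s.1 s.2 = \sum_(0 <= b < n) \sum_(0 <= a < la b) f a b.
Proof.
rewrite -sum_diagram big_mkord; under [RHS]eq_bigr => b _ do rewrite big_mkord.
rewrite [RHS]exchange_big [RHS]pair_bigA /= [LHS]big_mkcond; apply: eq_bigr => s _ /=.
by rewrite (in_diagram_grid D_young D_card); case: (s \in D); rewrite ?mul1n.
Qed.

Lemma armE (s : 'I_(k * n) * 'I_n) : arm D s = box_arm n DD s.1 s.2.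
Proof.
rewrite /arm /box_arm -sum1dep_card big_mkcond /=.
transitivity (\sum_(u in D) ((u.1 : nat) == s.1) * (s.2 < u.2)).
  rewrite [RHS]big_mkcond; apply: eq_bigr => u _ /=; rewrite -val_eqE.
  by case: (u \in D) => //=; case: (_ == _) => //=; case: (_ < _).
rewrite (sum_grid_diagram (fun a b => (a == s.1) * (s.2 < b))).
transitivity (\sum_(0 <= b < n) (s.2 < b) * (b < ht s.1)).
  apply: eq_bigr => b _; rewrite -(sum_nat_initial (n := k * n)) //.
  rewrite -[RHS](sum_nat_delta (fun a => (s.2 < b) * (b < ht a)) (ltn_ord s.1)).
  apply: eq_bigr => a _; rewrite -DDE DDhE.
  by case: (b < ht a); rewrite !(mul0n, muln0, mul1n, muln1).
transitivity (\sum_(0 <= b < ht s.1) (s.2 < b)).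
  rewrite -[RHS](sum_nat_initial (n := n)) //.
  by apply: eq_bigr => b _; rewrite mulnC.
elim: (ht s.1) => [|h IH]; first by rewrite big_geq.
by rewrite big_nat_recr //= IH; lia.
Qed.

Lemma legE (s : 'I_(k * n) * 'I_n) : leg D s = box_leg (k * n) DD s.1 s.2.
Proof.
rewrite /leg /box_leg -sum1dep_card big_mkcond /=.
transitivity (\sum_(u in D) ((u.2 : nat) == s.2) * (s.1 < u.1)).
  rewrite [RHS]big_mkcond; apply: eq_bigr => u _ /=; rewrite -val_eqE.
  by case: (u \in D) => //=; case: (_ == _) => //=; case: (_ < _).
rewrite (sum_grid_diagram (fun a b => (b == s.2) * (s.1 < a))).
transitivity (\sum_(0 <= b < n) (b == s.2) * \sum_(0 <= a < la b) (s.1 < a)).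
  by apply: eq_bigr => b _; rewrite big_distrr.
rewrite (sum_nat_delta (fun b => \sum_(0 <= a < la b) (s.1 < a))) //.
elim: (la s.2) => [|h IH]; first by rewrite big_geq.
by rewrite big_nat_recr //= IH; lia.
Qed.

Lemma count_statE :
  #|[set s in D | k * arm D s <= leg D s <= k * (arm D s + 1)]|
  = count_stat k n (k * n) DD.
Proof.
rewrite -sum1dep_card big_mkcond /= /count_stat.
rewrite -(sum_grid_diagram (fun a r => k * box_arm n DD a r <= box_leg (k * n) DD a r
   <= k * (box_arm n DD a r + 1))).
rewrite [RHS]big_mkcond; apply: eq_bigr => s _; rewrite armE legE.
by case: (s \in D) => //=; case: (_ <= _ <= _).
Qed.

Let count_box x y :
  \sum_(j < N) (weight (px n) (py k n) (box t j) < weight (px n) (py k n) (x, y))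
  = count_below k n (k * n) DD x y.
Proof.
rewrite /count_below /count_row.
rewrite -(sum_box_diagram (fun a r =>
  weight (px n) (py k n) (a, r) < weight (px n) (py k n) (x, y))).
by apply: eq_bigr => j _; rewrite -surjective_pairing.
Qed.

(** The unknowns in the row of box i correspond to the boxes of smaller weight than box i shifted by
    x or y, whence [count_below]. In each nonempty row of the diagram only the last box has free
    x-entries. The summand N is the covector. *)
Lemma card_unknowns :
  #|{: {x | unknown t (px n) (py k n) x}}|
  = \sum_(0 <= b < n) row_unknowns k n (k * n) DD b + N.
Proof.
rewrite card_sig card_sum !big_sumType /=; congr (_ + _); last first.
  by rewrite sum_nat_const card_ord muln1.
rewrite -(pair_bigA _ (fun i j => x_unknown t (px n) (py k n) i j : nat)).
rewrite -(pair_bigA _ (fun i j => y_unknown t (px n) (py k n) i j : nat)) -big_split.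
pose c := count_below k n (k * n) DD.
transitivity (\sum_(i < N) (~~ DD (box t i).1.+1 (box t i).2 * c (box t i).1.+1 (box t i).2
   + ((0 < (box t i).1) || ~~ DD (box t i).1 (box t i).2.+1) * c (box t i).1 (box t i).2.+1)).
  apply: eq_bigr => i _; rewrite /c -!count_box !big_distrr /=; congr (_ + _);
    apply: eq_bigr => j _; rewrite mulnb; congr nat_of_bool; congr (_ && _);
    by rewrite [box t i]surjective_pairing /weight /=; congr (_ < _); lia.
rewrite (sum_box_diagram (fun a b => ~~ DD a.+1 b * c a.+1 b +
  ((0 < a) || ~~ DD a b.+1) * c a b.+1)).
apply: eq_bigr => b _; rewrite big_split /= /row_unknowns; congr (_ + _); last first.
  apply: eq_bigr => -[|a] _ //=; by rewrite DDE -leqNgt leqn0.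
case E : (la b) => [|l]; first by rewrite big_geq.
rewrite mul1n; transitivity (\sum_(0 <= a < l.+1) (a == l) * c a.+1 b).
  apply: eq_big_nat => a /andP[_ al]; rewrite DDE E; congr (nat_of_bool _ * _).
  by rewrite -leqNgt ltnS; lia.
by rewrite (sum_nat_delta (fun a => c a.+1 b)).
Qed.

Lemma card_equations :
  #|{: {e | equation t (px n) (py k n) e}}|
  = \sum_(0 <= b < n) row_equations k n (k * n) DD b.
Proof.
rewrite card_sig card_sum.
rewrite -(pair_bigA _ (fun i j => (equation t (px n) (py k n) (i, j) : nat))) /=.
pose c := count_below k n (k * n) DD.
transitivity (\sum_(i < N) c (box t i).1.+1 (box t i).2.+1).
  apply: eq_bigr => i _; rewrite /c -count_box; apply: eq_bigr => j _.
  congr nat_of_bool; rewrite /equation /=.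
  by rewrite [box t i]surjective_pairing /weight /=; congr (_ < _); lia.
by rewrite (sum_box_diagram (fun a b => c a.+1 b.+1)).
Qed.

Lemma stratum_dimension :
  #|{: {x | unknown t (px n) (py k n) x}}| - #|{: {e | equation t (px n) (py k n) e}}|
  = #|[set s in D | k * arm D s <= leg D s <= k * (arm D s + 1)]| + N.
Proof.
rewrite card_unknowns card_equations count_statE sum_unknowns_equations //.
lia.
Qed.

End Dimension.

(** * Dyck paths and Young diagrams *)

Section DyckDiagrams.
Local Open Scope nat_scope.
Variables k n : nat.
Hypothesis k_gt0 : 0 < k.
Local Notation L := (k * n + n).
Local Notation grid := ('I_(k * n) * 'I_n)%type.
Implicit Types pi : L.-tuple bool.

Lemma xposS pi (m : 'I_L) : xpos pi m.+1 = xpos pi m + ~~ tnth pi m.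
Proof.
rewrite /xpos (take_nth false) ?size_tuple // -cats1 count_cat /= addn0.
by rewrite -tnth_nth; case: (tnth pi m).
Qed.

Lemma xpos_mono pi m m' : m <= m' -> xpos pi m <= xpos pi m'.
Proof.
move=> mm'; rewrite /xpos -(subnKC mm') takeD count_cat.
exact: leq_addr.
Qed.

Lemma xpos_lip pi m d : xpos pi (m + d) <= xpos pi m + d.
Proof.
rewrite /xpos takeD count_cat leq_add2l.
by apply: leq_trans (count_size _ _) _; rewrite size_take; case: ltnP.
Qed.

Lemma xposDypos pi m : m <= L -> xpos pi m + ypos pi m = m.
Proof.
move=> mL; rewrite /xpos /ypos (eq_count (a2 := predC (pred1 true))); last by case.
by rewrite addnC count_predC size_takel ?size_tuple.
Qed.

Lemma ypos_mono pi m m' : m <= m' -> ypos pi m <= ypos pi m'.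
Proof.
move=> mm'; rewrite /ypos -(subnKC mm') takeD count_cat.
exact: leq_addr.
Qed.

Lemma dyck_pathP pi : reflect
  [/\ xpos pi L = k * n, ypos pi L = n &
      forall m, m <= L -> xpos pi m <= k * ypos pi m]
  (pi \in dyck_paths k n).
Proof.
rewrite inE; apply: (iffP and3P) => [[/eqP ? /eqP ? /forallP H]|[-> -> H]]; split=> //.
  by move=> m mL; have := H (Ordinal (mL : m < L.+1)).
by apply/forallP => m; apply: H; rewrite -ltnS.
Qed.

Lemma horizontal_step pi i : i < xpos pi L -> exists m : 'I_L,
  [/\ ~~ tnth pi m, xpos pi m = i & forall m', i < xpos pi m' -> m < m'].
Proof.
move=> iL; have exm : exists m, i < xpos pi m by exists L.
case: (ex_minnP exm) => -[|m] im m_min; first by rewrite /xpos take0 in im.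
have mL : m < L by apply: (m_min L).
have xm : xpos pi m <= i.
  by rewrite leqNgt; apply/negP => /m_min; rewrite ltnn.
exists (Ordinal mL); have := xposS pi (Ordinal mL); move: im => /= im.
case: (tnth pi _) => /= E; first by move: im; rewrite E addn0 ltnNge xm.
by split=> //; apply/eqP; rewrite eqn_leq xm /=; rewrite E in im; lia.
Qed.

Section Path.
Variable pi : L.-tuple bool.
Hypothesis pi_dyck : pi \in dyck_paths k n.

Let xL : xpos pi L = k * n. Proof. by case/dyck_pathP: pi_dyck. Qed.
Let yL : ypos pi L = n. Proof. by case/dyck_pathP: pi_dyck. Qed.
Let dyck m : m <= L -> xpos pi m <= k * ypos pi m.
Proof. by case/dyck_pathP: pi_dyck => _ _; apply. Qed.

(** After i + j + 1 steps the path is on the antidiagonal through the upper left and lower right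
    corners of the square, so its abscissa there decides on which side the square lies. *)
Lemma sq_aboveE i j : i < k * n -> j < n ->
  sq_above pi i j = (i < xpos pi (i + j.+1)).
Proof.
move=> ikn jn; apply/existsP/idP => [[m /and3P[tm /eqP xm ym]]|lt].
  have := xposS pi m; rewrite tm addn1 => E.
  rewrite -xm -E; apply: xpos_mono; rewrite addnS ltnS.
  by rewrite -[leqLHS](xposDypos pi (ltnW (ltn_ord m))) leq_add2l.
have [|m [tm xm m_min]] := @horizontal_step pi i; first by rewrite xL.
exists m; rewrite tm xm eqxx /=; have := m_min _ lt.
have := xposDypos pi (ltnW (ltn_ord m)); rewrite xm; lia.
Qed.

Lemma sq_belowE i j : i < k * n -> j < n ->
  sq_below pi i j = ~~ sq_above pi i j.
Proof.
move=> ikn jn; rewrite sq_aboveE // -leqNgt.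
apply/existsP/idP => [[m /and3P[tm /eqP xm ym]]|le].
  rewrite -[leqRHS]xm; apply: xpos_mono.
  by rewrite -[leqRHS](xposDypos pi (ltnW (ltn_ord m))) xm leq_add2l.
have [|m [tm xm m_min]] := @horizontal_step pi i; first by rewrite xL.
exists m; rewrite tm xm eqxx /=.
have := xposS pi m; rewrite tm xm addn1 => E.
have lt : i + j.+1 < m.+1.
  by rewrite ltnNge; apply/negP => /(xpos_mono pi); rewrite E leqNgt ltnS le.
have := xposDypos pi (ltnW (ltn_ord m)); rewrite xm; lia.
Qed.

Lemma dyck_diagramE (s : grid) :
  (s \in dyck_diagram pi) = (s.1 < xpos pi (s.1 + (n - s.2))).
Proof.
by rewrite inE sq_aboveE ?(ltn_ord (rev_ord s.2)) //= subnSK.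
Qed.

Lemma sq_above_dyck i j : i < k * n -> j < n -> sq_above pi i j -> i.+1 <= k * j.
Proof.
move=> ikn jn; rewrite sq_aboveE // => lt.
have mL : i + j.+1 <= L by lia.
have := dyck mL; have := xposDypos pi mL; nia.
Qed.

Lemma young_dyck_diagram : young_diagram (dyck_diagram pi).
Proof.
apply/forallP => s; apply/implyP => sD; apply/andP; split.
  move: sD; rewrite inE => /sq_above_dyck -/(_ (ltn_ord _) (ltn_ord _)) /=.
  by rewrite mulnBr mulnS; lia.
have down (a b c d : nat) : c <= a -> d <= b ->
    a < xpos pi (a + (n - b)) -> c < xpos pi (c + (n - d)).
  move=> ca db lt; have := xpos_lip pi (c + (n - b)) (a - c).
  rewrite (_ : c + (n - b) + (a - c) = a + (n - b)); last by lia.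
  have : xpos pi (c + (n - b)) <= xpos pi (c + (n - d)).
    by apply: xpos_mono; rewrite leq_add2l leq_sub2l.
  lia.
apply/forallP => u; apply/implyP => /andP[u1 u2].
by move: sD; rewrite !dyck_diagramE; apply: down.
Qed.

(** This recovers the path from its diagram. In column i the antidiagonal of time m belongs to row i
    + n - m; for m > i + n the abscissa exceeds i because the height is at most n. *)
Lemma xpos_diagram m (i : 'I_(k * n)) : m <= L -> (i < xpos pi m) =
  (i + n < m) || [exists r : 'I_n, (m + r == i + n) && ((i, r) \in dyck_diagram pi)].
Proof.
move=> mL; have E := xposDypos pi mL.
have yn : ypos pi m <= n by rewrite -[leqRHS]yL ypos_mono.
have [inm|min_] := ltnP (i + n) m; first by rewrite /=; apply/idP; lia.
apply/idP/existsP => /= [lt|[r /andP[/eqP mr]]]; last first.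
  rewrite dyck_diagramE /= (_ : i + (n - r) = m) //.
  by have := ltn_ord r; lia.
have rn : i + n - m < n by lia.
exists (Ordinal rn); rewrite dyck_diagramE /= subnKC // eqxx /=.
by rewrite (_ : i + (n - (i + n - m)) = m) //; lia.
Qed.

(** Squares above the path are above the line, so together with those counted by [area] they
    partition the squares above the line, k j of them in row j. *)
Lemma card_dyck_diagram : #|dyck_diagram pi| + area pi = k * n * (n - 1) %/ 2.
Proof.
pose U := [set s : grid | s.1.+1 <= k * s.2]%SET.
pose A := [set s : grid | sq_above pi s.1 s.2]%SET.
have -> : #|dyck_diagram pi| = #|A|.
  pose f (s : grid) : grid := (s.1, rev_ord s.2).
  have f_inj : injective f.
    move=> [a b] [c d] E; have /= /rev_ord_inj -> := congr1 snd E.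
    by have /= -> := congr1 fst E.
  rewrite -(card_imset (dyck_diagram pi) f_inj); apply: eq_card => s.
  rewrite [RHS]inE; apply/imsetP/idP => [[u]|sA]; first by rewrite inE => uA ->.
  exists (f s); last by case: (s) => a b; rewrite /f /= rev_ordK.
  by move: sA; rewrite !inE -[(f s).2]/(rev_ord s.2) rev_ordK.
have -> : area pi = #|U :\: A|.
  apply: eq_card => s; rewrite !inE -sq_belowE //.
  by apply/idP/idP; rewrite in_setE.
have {1}-> : A = U :&: A.
  apply/setP => s; rewrite !inE andbC.
  by case: (boolP (sq_above _ _ _)) => // /sq_above_dyck ->.
rewrite cardsID.
rewrite -sum1dep_card big_mkcond /=.
rewrite -(pair_bigA _ (fun (i : 'I_(k * n)) (j : 'I_n) => if i.+1 <= k * j then 1 else 0)) /=.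
rewrite exchange_big /=.
transitivity (\sum_(j < n) k * j).
  apply: eq_bigr => j _; have kj : k * j <= k * n by rewrite leq_mul2l ltnW ?orbT.
  rewrite -[RHS]muln1 -[k * j in RHS]subn0 -sum_nat_const_nat.
  rewrite -(sum_nat_initial (fun=> 1) kj) big_mkord; apply: eq_bigr => i _.
  by rewrite muln1; case: ltnP.
rewrite -big_distrr /= -(big_mkord xpredT id) bin2_sum.
have := mul_bin_diag n 1; rewrite bin1 -subn1 -mulnA => ->.
by rewrite mulnCA mulKn.
Qed.

End Path.

Lemma dyck_diagram_inj : {in dyck_paths k n &, injective (@dyck_diagram k n)}.
Proof.
move=> pi pi' d d' E; have xE m : m <= L -> xpos pi m = xpos pi' m.
  move=> mL; have le pi1 : pi1 \in dyck_paths k n -> xpos pi1 m <= k * n.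
    by case/dyck_pathP => <- _ _; apply: xpos_mono.
  have H (i : 'I_(k * n)) : (i < xpos pi m) = (i < xpos pi' m).
    by rewrite !xpos_diagram // E.
  apply/eqP; rewrite eqn_leq; apply/andP; split.
    rewrite leqNgt; apply/negP => lt; have := leq_trans lt (le _ d) => ikn.
    by have := H (Ordinal ikn); rewrite /= lt ltnn.
  rewrite leqNgt; apply/negP => lt; have := leq_trans lt (le _ d') => ikn.
  by have := H (Ordinal ikn); rewrite /= lt ltnn.
apply: eq_from_tnth => m; have := xposS pi m; have := xposS pi' m.
rewrite (xE m.+1 (ltn_ord m)) (xE m (ltnW (ltn_ord m))) => ->.
by move=> /addnI; case: (tnth pi m); case: (tnth pi' m).
Qed.

Lemma dyck_diagram_surj (D : {set grid}) : young_diagram D ->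
  exists2 pi, pi \in dyck_paths k n & dyck_diagram pi = D.
Proof.
move=> yD; pose DD a b := [exists s in D, grid_pair s == (a, b)].
have DDP (s : grid) : DD s.1 s.2 = (s \in D).
  apply/existsP/idP => [[u /andP[uD /eqP/grid_pair_inj <-]]//|sD].
  by exists s; rewrite sD eqxx.
have DD_lt a b : DD a b -> (a < k * n) && (b < n).
  by case/existsP => u /andP[_ /eqP[<- <-]]; rewrite !ltn_ord.
have DD_down i j i' j' : DD i j -> i' <= i -> j' <= j -> DD i' j'.
  move=> Dij i'i j'j; have /andP[l1 l2] := DD_lt _ _ Dij.
  move: Dij; rewrite (DDP (Ordinal l1, Ordinal l2)) => sD.
  have l1' := leq_ltn_trans i'i l1; have l2' := leq_ltn_trans j'j l2.
  by rewrite (DDP (Ordinal l1', Ordinal l2')); apply: (young_down yD sD).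
pose ht := column_height n DD.
have htE a b : DD a b = (b < ht a) := column_heightP DD_down DD_lt a b.
have ht_le a : ht a <= n := column_height_le DD_down DD_lt a.
have ht_mono a a' : a <= a' -> ht a' <= ht a.
  move=> aa'; rewrite leqNgt -htE; apply/negP => Da.
  by have := DD_down _ _ _ _ Da aa' (leqnn _); rewrite htE ltnn.
(* The time of the horizontal step over column i: it comes after i horizontal and n - ht i vertical
   steps. *)
pose h i := i + (n - ht i).
have h_lt i i' : i < i' -> h i < h i'.
  by rewrite /h => ii'; have := ht_mono _ _ (ltnW ii'); have := ht_le i; lia.
have h_inj : injective h.
  by move=> i i' E; case: (ltngtP i i') => // /h_lt; rewrite E ltnn.
pose pi := [tuple ~~ [exists i : 'I_(k * n), h i == m] | m < L].
have xE m : m <= L -> xpos pi m = \sum_(0 <= i < k * n) (h i < m).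
  elim: m => [|m IH] mL.
    by rewrite /xpos take0 big1.
  rewrite (xposS pi (Ordinal mL)) IH; last exact: ltnW.
  rewrite tnth_mktuple negbK /=.
  have -> : [exists i : 'I_(k * n), h i == m] = \sum_(0 <= i < k * n) (h i == m) :> nat.
    rewrite big_mkord; case: existsP => [[i /eqP iE]|no].
      rewrite (bigD1 i) //= iE eqxx big1 // => j ji.
      case: eqP => // jE; case/eqP: ji; apply/val_inj/h_inj.
      by rewrite jE.
    by rewrite big1 // => i _; case: eqP => // iE; case: no; exists i; apply/eqP.
  rewrite -big_split; apply: eq_bigr => i _ /=.
  by rewrite ltnS; case: ltngtP.
have ltE m i : i < k * n -> m <= L -> (i < xpos pi m) = (h i < m).
  move=> ikn mL; rewrite xE //.
  transitivity ((i < k * n) && (h i < m)); last by rewrite ikn.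
  rewrite (eq_big_nat _ _ (F2 := fun i => ((i < k * n) && (h i < m) : bool) : nat)).
    rewrite -(@initial_count (fun i => (i < k * n) && (h i < m))) // => c.
      by move=> /andP[ckn hc]; rewrite (ltnW ckn) /=; apply: ltn_trans hc; apply: h_lt.
    by case/andP.
  by move=> c /andP[_ ->].
have xL : xpos pi L = k * n.
  rewrite xE // (eq_big_nat _ _ (F2 := fun=> 1)).
    by rewrite sum_nat_const_nat subn0 muln1.
  by move=> i /andP[_ ikn]; rewrite (_ : h i < L) // /h; lia.
have pi_dyck : pi \in dyck_paths k n.
  apply/dyck_pathP; split=> [//||m mL].
    by have := xposDypos pi (leqnn L); rewrite xL => /addnI.
  have := xposDypos pi mL; case E : (xpos pi m) => [//|i] S.
  have ikn : i < k * n by rewrite -[ltnRHS]xL -E; apply: xpos_mono.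
  have : i < xpos pi m by rewrite E.
  rewrite ltE // /h => hm.
  have [h0|h0] := posnP (ht i).
    by move: hm; rewrite h0; have := ht_le i; nia.
  have Dih : DD i (ht i).-1 by rewrite htE prednK.
  have /andP[l1 l2] := DD_lt _ _ Dih.
  move: Dih; rewrite (DDP (Ordinal l1, Ordinal l2)) => sD.
  (* For the top box of column i, membership in V_(k,n) says i + 1 <= k (n - ht i), which is the
     Dyck condition just after the step over that column. *)
  have /= V := young_V yD sD.
  have hk : k * ht i = k * (ht i).-1 + k by rewrite -mulnSr prednK.
  have : k * (n - ht i) <= k * ypos pi m by rewrite leq_mul2l; apply/orP; right; lia.
  rewrite mulnBr hk; lia.
exists pi => //; apply/setP => s; rewrite dyck_diagramE // ltE //; last first.
  by rewrite leq_add ?leq_subr // ltnW.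
rewrite -DDP htE /h ltn_add2l; move: (ht_le s.1) (ltn_ord s.2).
by move: (ht s.1) (nat_of_ord s.2) => x y xn yn; apply/idP/idP; lia.
Qed.

End DyckDiagrams.

(** * Both sides as sums over diagrams *)

Lemma class_hilb_kn (K : closedFieldType) (k n N : nat) :
  (0 < k)%N -> (0 < n)%N -> (forall m, m.+1%:R != 0 :> K) ->
  class (hilb_kn K k n N) = \sum_(D in diagrams k n N)
    LL K ^+ (#|[set s in D | (k * arm D s <= leg D s <= k * (arm D s + 1))%N]%SET| + N).
Proof.
move=> k0 n0 char0.
pose r (D D' : {set 'I_(k * n) * 'I_n}) := (total_weight N D <= total_weight N D')%N.
pose s := sort r (enum (diagrams k n N)).
have sE : hilb_locus (fun I => spans_mod I (monomial_span (Vkn_monomials k n)))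
    = @strata K k n N s.
  rewrite hilb_kn_strata //; apply/seteqP.
  by split=> z [D Ds zD]; exists D => //; move: Ds; rewrite mem_sort.
have lc : locally_closed (@strata K k n N s).
  by rewrite -sE; exact: (@hilb_locus_lc K N (Vkn_monomials k n)).
rewrite (eq_class_vset (@hilb_locus_lc K N (Vkn_monomials k n)) lc sE).
rewrite (class_strata char0); first last.
- by apply: sort_sorted => D D'; apply: leq_total.
- by rewrite sort_uniq enum_uniq.
- by move=> D; rewrite mem_sort mem_enum.
rewrite (perm_big (enum (diagrams k n N))) ?perm_sort //= big_enum.
apply: eq_bigr => D; rewrite inE => /andP[yD /eqP cD].
by rewrite stratum_dimension.
Qed.

Lemma diagrams_dyck (k n N : nat) : (0 < k)%N ->
  diagrams k n N =
  (@dyck_diagram k n @: [set pi in dyck_paths k n | #|dyck_diagram pi| == N])%SET.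
Proof.
move=> k0; apply/setP => D; rewrite inE; apply/andP/imsetP => [[yD cD]|[pi]].
  have [pi d piE] := dyck_diagram_surj k0 yD.
  by exists pi; rewrite ?piE // inE d piE.
rewrite inE => /andP[d c] ->; split=> //; exact: young_dyck_diagram.
Qed.

(** By [card_dyck_diagram] the exponent of L t at a path is the size of its diagram, so the
    coefficient of t^N keeps the paths whose diagram has N boxes, each with L^(b_k + N). *)
Lemma catalan_series_diagrams (K : closedFieldType) (k n N : nat) : (0 < k)%N ->
  catalan_series K k n N = \sum_(D in diagrams k n N)
    LL K ^+ (#|[set s in D | (k * arm D s <= leg D s <= k * (arm D s + 1))%N]%SET| + N).
Proof.
move=> k0; rewrite diagrams_dyck // big_imset; last first.
  move=> pi pi'; rewrite inE => /andP[d _]; rewrite inE => /andP[d' _].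
  exact: dyck_diagram_inj.
rewrite (eq_bigl (fun pi => (pi \in dyck_paths k n) && (#|dyck_diagram pi| == N))); last first.
  by move=> pi; rewrite inE.
rewrite [RHS]big_mkcondr; apply: eq_bigr => pi d; rewrite /Lt_pow.
rewrite -(card_dyck_diagram k0 d) addnK eq_sym; case: eqP => [->|_]; last by rewrite mulr0.
by rewrite exprD.
Qed.

From mathcomp Require Import reals complex.

Local Open Scope complex_scope.

Theorem theorem1p5 (R : realType) (k n : nat) (hk : (1 <= k)%N) (hn : (1 <= n)%N) :
  (fun N : nat => class (hilb_kn R[i] k n N)) = catalan_series R[i] k n.
Proof.
apply/funext => N; rewrite catalan_series_diagrams // class_hilb_kn // => m.
by rewrite pnatr_eq0.
Qed.
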